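(* For integers $m\geq 1$, $r\geq 0$, $s\geq 0$, the number $t_{m,r,s}$ of $r$-heavy rectangulations with $m$ tiles and $s$ singular vertices is given by $$t_{m,r,s}=\sum_{\bar m,\bar r,\bar s,c}(-1)^{c+1}\binom{\ell-1}{c-1}\binom{\bar r+2-\ell}{c}\binom{\ell-c}{\Delta s}\binom{\Delta m-c-\Delta s+\ell-1}{\ell-1}\,t_{\bar m,\bar r,\bar s},$$ where the sum ranges over all integer tuples $(\bar m,\bar r,\bar s,c)$ with $1\leq \bar m\leq m-1$, $0\leq \bar r\leq \bar m-1$, $0\leq \bar s\leq s$ and $1\leq c\leq \lceil(\bar r+1)/2\rceil$, and where $\Delta s=s-\bar s$, $\Delta m=m-\bar m$, $\Delta r=r-\bar r$, $\ell=\Delta m-\Delta r$. The base of the recursion is $t_{k,k-1,0}=1$ for $k\geq 1$.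
   Context: A tiling of the unit square is a decomposition into finitely many axis-parallel rectangles (tiles) with disjoint interiors. Two tilings are combinatorially equivalent if there is a homeomorphism of the square taking one (its $1$-skeleton) to the other that fixes the four corners of the square and preserves horizontality and verticality of line segments. A rectangulation is a combinatorial equivalence class of tilings. A vertex of a rectangulation is singular if four rectangles meet there at a corner (i.e. it is a crossing of a horizontal and a vertical segment). A rectangulation is $r$-heavy if exactly $r$ edges of it hit the interior of the right side of the square. *)

(* Defs.v *)
From Stdlib Require Import Reals ZArith List Lia.
Open Scope R_scope.

Record rect := Rect { rx0 : R; rx1 : R; ry0 : R; ry1 : R }.

Definition pt := (R * R)%type.
Definition dummy_rect : rect := Rect 0 0 0 0.

Definition in_closed (q : rect) (p : pt) : Prop :=
  rx0 q <= fst p <= rx1 q /\ ry0 q <= snd p <= ry1 q.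
Definition in_open (q : rect) (p : pt) : Prop :=
  rx0 q < fst p < rx1 q /\ ry0 q < snd p < ry1 q.
Definition in_square (p : pt) : Prop := 0 <= fst p <= 1 /\ 0 <= snd p <= 1.

Definition tiling := list rect.

Definition is_tiling (T : tiling) : Prop :=
  (forall q, In q T -> (0 <= rx0 q < rx1 q /\ rx1 q <= 1) /\
                       (0 <= ry0 q < ry1 q /\ ry1 q <= 1)) /\
  (forall i j, (i < length T)%nat -> (j < length T)%nat -> i <> j ->
     forall p, ~ (in_open (nth i T dummy_rect) p /\ in_open (nth j T dummy_rect) p)) /\
  (forall p, in_square p -> exists q, In q T /\ in_closed q p).

Definition skeleton (T : tiling) (p : pt) : Prop :=
  exists q, In q T /\ in_closed q p /\ ~ in_open q p.

Definition hseg (a b y : R) (p : pt) : Prop := a <= fst p <= b /\ snd p = y.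
Definition vseg (x a b : R) (p : pt) : Prop := fst p = x /\ a <= snd p <= b.

Definition maps_onto (h : pt -> pt) (S S' : pt -> Prop) : Prop :=
  (forall p, S p -> S' (h p)) /\ (forall p', S' p' -> exists p, S p /\ h p = p').

Definition dist2 (p q : pt) : R := Rmax (Rabs (fst p - fst q)) (Rabs (snd p - snd q)).

Definition cont_on_square (h : pt -> pt) : Prop :=
  forall p, in_square p -> forall eps, eps > 0 -> exists delta, delta > 0 /\
    forall q, in_square q -> dist2 p q < delta -> dist2 (h p) (h q) < eps.

Definition square_homeo (h g : pt -> pt) : Prop :=
  cont_on_square h /\ cont_on_square g /\
  (forall p, in_square p -> in_square (h p)) /\
  (forall p, in_square p -> in_square (g p)) /\
  (forall p, in_square p -> g (h p) = p) /\
  (forall p, in_square p -> h (g p) = p).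

Definition fixes_corners (h : pt -> pt) : Prop :=
  h (0, 0) = (0, 0) /\ h (1, 0) = (1, 0) /\ h (0, 1) = (0, 1) /\ h (1, 1) = (1, 1).

Definition preserves_hv (T : tiling) (h : pt -> pt) : Prop :=
  (forall a b y, a < b -> (forall p, hseg a b y p -> skeleton T p) ->
     exists a' b' y', a' < b' /\ maps_onto h (hseg a b y) (hseg a' b' y')) /\
  (forall x a b, a < b -> (forall p, vseg x a b p -> skeleton T p) ->
     exists x' a' b', a' < b' /\ maps_onto h (vseg x a b) (vseg x' a' b')).

Definition comb_equiv (T1 T2 : tiling) : Prop :=
  exists h g, square_homeo h g /\ fixes_corners h /\
    maps_onto h (skeleton T1) (skeleton T2) /\
    preserves_hv T1 h /\ preserves_hv T2 g.

Definition is_corner (q : rect) (p : pt) : Prop :=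
  (fst p = rx0 q \/ fst p = rx1 q) /\ (snd p = ry0 q \/ snd p = ry1 q).

Definition singular (T : tiling) (p : pt) : Prop :=
  exists i1 i2 i3 i4,
    (i1 < length T)%nat /\ (i2 < length T)%nat /\ (i3 < length T)%nat /\ (i4 < length T)%nat /\
    i1 <> i2 /\ i1 <> i3 /\ i1 <> i4 /\ i2 <> i3 /\ i2 <> i4 /\ i3 <> i4 /\
    is_corner (nth i1 T dummy_rect) p /\ is_corner (nth i2 T dummy_rect) p /\
    is_corner (nth i3 T dummy_rect) p /\ is_corner (nth i4 T dummy_rect) p.

Definition num_singular (T : tiling) (s : nat) : Prop :=
  exists L : list pt, NoDup L /\ length L = s /\ forall p, In p L <-> singular T p.

Definition right_hit (T : tiling) (y : R) : Prop :=
  0 < y < 1 /\ exists a, a < 1 /\ forall p, hseg a 1 y p -> skeleton T p.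

Definition heavy (T : tiling) (r : nat) : Prop :=
  exists L : list R, NoDup L /\ length L = r /\ forall y, In y L <-> right_hit T y.

Definition good (m r s : nat) (T : tiling) : Prop :=
  is_tiling T /\ length T = m /\ heavy T r /\ num_singular T s.

(** There are exactly [n] rectangulations (combinatorial equivalence classes of
    tilings) with [m] tiles that are r-heavy and have [s] singular vertices:
    a list of [n] pairwise inequivalent representatives covering all classes. *)
Definition rect_count (m r s n : nat) : Prop :=
  exists L : list tiling, length L = n /\
    (forall T, In T L -> good m r s T) /\
    (forall i j, (i < n)%nat -> (j < n)%nat -> i <> j ->
       ~ comb_equiv (nth i L nil) (nth j L nil)) /\
    (forall T, good m r s T -> exists T', In T' L /\ comb_equiv T T').

Fixpoint binom (n k : nat) : nat :=
  match n, k with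
  | _, O => 1%nat
  | O, S _ => 0%nat
  | S n', S k' => (binom n' k' + binom n' k)%nat
  end.

(** Binomial coefficient on integers, with the convention binZ n k = 0
    unless 0 <= k <= n. *)
Definition binZ (n k : Z) : Z :=
  if andb (0 <=? n)%Z (0 <=? k)%Z then Z.of_nat (binom (Z.to_nat n) (Z.to_nat k)) else 0%Z.

Definition zsum (a n : nat) (f : nat -> Z) : Z :=
  fold_right (fun i acc => (f i + acc)%Z) 0%Z (seq a n).

(** Right-hand side of the recursion: sum over 1 <= mb <= m-1, 0 <= rb <= mb-1,
    0 <= sb <= s, 1 <= c <= ceil((rb+1)/2) = (rb+2)/2. *)
Definition rec_rhs (t : nat -> nat -> nat -> nat) (m r s : nat) : Z :=
  zsum 1 (m - 1) (fun mb =>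
  zsum 0 mb (fun rb =>
  zsum 0 (s + 1) (fun sb =>
  zsum 1 ((rb + 2) / 2) (fun c =>
    let dm := (Z.of_nat m - Z.of_nat mb)%Z in
    let dr := (Z.of_nat r - Z.of_nat rb)%Z in
    let ds := (Z.of_nat s - Z.of_nat sb)%Z in
    let l := (dm - dr)%Z in
    let cz := Z.of_nat c in
    ((-1) ^ (cz + 1) * binZ (l - 1) (cz - 1) * binZ (Z.of_nat rb + 2 - l) cz
      * binZ (l - cz) ds * binZ (dm - cz - ds + l - 1) (l - 1)
      * Z.of_nat (t mb rb sb))%Z)))).

(* Main.v *)
(** Along the right side of a tiling, call a block a maximal run of right tiles with the same left
    abscissa [a > 0] whose neighbours in the right stack both reach further to the left. A block can be
    removed by extending the tiles to its left up to the right side, and every tiling other than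
    a stack of horizontal tiles has a block, e.g. one bounded by a rightmost vertical segment.
    Conversely, a block is added in front of consecutive right tiles by choosing how the
    horizontal ends on its two sides interleave, common ends being the singular vertices.
    Always removing the topmost block encodes a tiling by a word, and two tilings are
    equivalent iff their words agree: tilings with the same word are related by a horizontal
    shear followed by a vertical one, and a word is recovered from the adjacencies between tiles, which
    an equivalence preserves. Counting the words with a set of [c] pairwise nonadjacent blocks put
    in front, with sign [(-1)^c], everything cancels in pairs (move the topmost of the blocks
    to the word, or back), except for the stacks; this is the recursion. *)
Require Import Defs.
From Stdlib Require Import Reals ZArith List Lia Lra Permutation Bool ClassicalEpsilon.
From Coquelicot Require Import Coquelicot.
Import ListNotations.

(** * Interpolation by increasing homeomorphisms *)

(** Origin of the binomials: $c$ nonadjacent blocks covering $\ell$ of the $\bar r+1$ right tiles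
    occupy $c$ distinct slots among the $\bar r+2-\ell$ slots around the uncovered tiles, whence
    $\binom{\bar r+2-\ell}{c}$. Their $c$ interleavings, written one after the other with $c-1$
    separators, form a word with $a$ ends on the left only, $\Delta s$ common ends and $b$ ends on
    the right only, where $\ell=a+\Delta s+c$ and $\Delta m=b+\Delta s+c$; placing the separators,
    the common ends and the right ends gives the other three factors. Two obstacles shape the
    geometry. Realizations of one word agree only in the order of the sides of tiles that share an
    ordinate, so a product of two maps of the coordinates cannot relate them; the map of the
    abscissas has to vary with the height. And a word has to be canonical: that each block is
    topmost is expressed by a bound on its position, which means that the left abscissas along the
    right side weakly increase downwards until the end of the last block and then drop. Such rises
    and drops are visible in the adjacencies. *)

Lemma cont_plus {U : UniformSpace} (f g : U -> R) x :
  continuous f x -> continuous g x -> continuous (fun z => f z + g z) x.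
Proof. intros; now apply (continuous_plus (V := R_NormedModule)). Qed.

Lemma cont_mult {U : UniformSpace} (f g : U -> R) x :
  continuous f x -> continuous g x -> continuous (fun z => f z * g z) x.
Proof. intros; now apply (continuous_mult (K := R_AbsRing)). Qed.

Lemma cont_minus {U : UniformSpace} (f g : U -> R) x :
  continuous f x -> continuous g x -> continuous (fun z => f z - g z) x.
Proof. intros; now apply (continuous_minus (V := R_NormedModule)). Qed.

Lemma cont_abs {U : UniformSpace} (f : U -> R) x :
  continuous f x -> continuous (fun z => Rabs (f z)) x.
Proof. intros; apply (continuous_comp f Rabs); auto. apply continuous_Rabs. Qed.

Lemma cont_max {U : UniformSpace} (f g : U -> R) x :
  continuous f x -> continuous g x -> continuous (fun z => Rmax (f z) (g z)) x.
Proof.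
  intros Hf Hg.
  apply continuous_ext with (fun z => (f z + g z + Rabs (f z - g z)) * / 2).
  - intros z. unfold Rmax. destruct (Rle_dec (f z) (g z)).
    + rewrite Rabs_left1; lra.
    + rewrite Rabs_right; lra.
  - apply cont_mult; [|apply continuous_const].
    apply cont_plus; [now apply cont_plus|]. apply cont_abs. now apply cont_minus.
Qed.

Lemma cont_min {U : UniformSpace} (f g : U -> R) x :
  continuous f x -> continuous g x -> continuous (fun z => Rmin (f z) (g z)) x.
Proof.
  intros Hf Hg.
  apply continuous_ext with (fun z => (f z + g z - Rabs (f z - g z)) * / 2).
  - intros z. unfold Rmin. destruct (Rle_dec (f z) (g z)).
    + rewrite Rabs_left1; lra.
    + rewrite Rabs_right; lra.
  - apply cont_mult; [|apply continuous_const].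
    apply cont_minus; [now apply cont_plus|]. apply cont_abs. now apply cont_minus.
Qed.

Lemma cont_inv {U : UniformSpace} (f : U -> R) x :
  continuous f x -> f x <> 0 -> continuous (fun z => / f z) x.
Proof. intros Hf Hn; apply (continuous_comp f Rinv); auto. now apply continuous_Rinv. Qed.

Definition increasing_homeo (F : R -> R) : Prop :=
  (forall x, continuous F x) /\ (forall x y, x < y -> F x < F y) /\
  (forall x, x <= 0 \/ 1 <= x -> F x = x).

(** The graph of [G] is the identity outside [[lo, hi]] and two line segments with vertex [(v, w)]
    inside. Written with [Rmax] and [Rmin] of three lines, it is continuous at once. *)
Lemma bump (v w lo hi : R) :
  lo < v < hi -> lo < w < hi ->
  exists G : R -> R, (forall x, continuous G x) /\ (forall x y, x < y -> G x < G y) /\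
    G v = w /\ (forall z, z <= lo \/ hi <= z -> G z = z).
Proof.
  intros Hv Hw.
  set (s1 := (w - lo) / (v - lo)). set (s2 := (hi - w) / (hi - v)).
  assert (E1 : (v - lo) * s1 = w - lo) by (unfold s1; field; lra).
  assert (E2 : (hi - v) * s2 = hi - w) by (unfold s2; field; lra).
  assert (P1 : 0 < s1) by (unfold s1; apply Rdiv_lt_0_compat; lra).
  assert (P2 : 0 < s2) by (unfold s2; apply Rdiv_lt_0_compat; lra).
  set (l1 := fun z => lo + (z - lo) * s1). set (l2 := fun z => hi - (hi - z) * s2).
  assert (C1 : forall x, continuous l1 x).
  { intros x. unfold l1. apply cont_plus; [apply continuous_const|].
    apply cont_mult; [|apply continuous_const].
    apply cont_minus; [apply continuous_id|apply continuous_const]. }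
  assert (C2 : forall x, continuous l2 x).
  { intros x. unfold l2. apply cont_minus; [apply continuous_const|].
    apply cont_mult; [|apply continuous_const].
    apply cont_minus; [apply continuous_const|apply continuous_id]. }
  assert (I1 : forall x y, x < y -> l1 x < l1 y) by (intros; unfold l1; nra).
  assert (I2 : forall x y, x < y -> l2 x < l2 y) by (intros; unfold l2; nra).
  assert (V1 : l1 v = w) by (unfold l1; lra).
  assert (V2 : l2 v = w) by (unfold l2; lra).
  destruct (Rle_or_lt v w) as [Hc|Hc].
  - exists (fun z => Rmax z (Rmin (l1 z) (l2 z))). repeat split.
    + intros x. apply cont_max; [apply continuous_id|]. now apply cont_min.
    + intros x y Hxy. generalize (I1 x y Hxy) (I2 x y Hxy). intros.
      apply Rmax_lub_lt.
      * eapply Rlt_le_trans; [exact Hxy|]. apply Rmax_l.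
      * eapply Rlt_le_trans; [|apply Rmax_r].
        unfold Rmin. repeat destruct Rle_dec; lra.
    + rewrite V1, V2, Rmin_left, Rmax_right; lra.
    + intros z Hz. apply Rmax_left.
      destruct Hz; [eapply Rle_trans; [apply Rmin_l|] | eapply Rle_trans; [apply Rmin_r|]].
      * unfold l1. assert (1 <= s1) by nra. nra.
      * unfold l2. assert (s2 <= 1) by nra. nra.
  - exists (fun z => Rmin z (Rmax (l1 z) (l2 z))). repeat split.
    + intros x. apply cont_min; [apply continuous_id|]. now apply cont_max.
    + intros x y Hxy. generalize (I1 x y Hxy) (I2 x y Hxy). intros.
      apply Rmin_glb_lt.
      * eapply Rle_lt_trans; [|exact Hxy]. apply Rmin_l.
      * eapply Rle_lt_trans; [apply Rmin_r|].
        unfold Rmax. repeat destruct Rle_dec; lra.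
    + rewrite V1, V2, Rmax_left, Rmin_right; lra.
    + intros z Hz. apply Rmin_left.
      destruct Hz; [eapply Rle_trans; [|apply Rmax_l] | eapply Rle_trans; [|apply Rmax_r]].
      * unfold l1. assert (s1 <= 1) by nra. nra.
      * unfold l2. assert (1 <= s2) by nra. nra.
Qed.

(** Finitely many values leave a gap below [m]: room for a [bump] that fixes them, or for a nearby
    point that crosses no side of a tile. *)
Lemma gap_below (l : list R) (m : R) :
  0 < m -> exists lo, 0 <= lo < m /\ forall b, In b l -> b < m -> b <= lo.
Proof.
  intros Hm. induction l as [|b l [lo [H1 H2]]].
  - exists 0. split; [lra|]. intros b [].
  - destruct (Rlt_dec b m) as [Hb|Hb].
    + exists (Rmax lo b). split.
      * split; [eapply Rle_trans; [apply H1|apply Rmax_l]|]. apply Rmax_lub_lt; lra.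
      * intros c [<-|Hc] Hcm; [apply Rmax_r|].
        eapply Rle_trans; [now apply H2|apply Rmax_l].
    + exists lo. split; [lra|]. intros c [<-|Hc] Hcm; [lra|auto].
Qed.

Lemma gap_above (l : list R) (m : R) :
  m < 1 -> exists hi, m < hi <= 1 /\ forall b, In b l -> m < b -> hi <= b.
Proof.
  intros Hm. destruct (gap_below (map (fun b => 1 - b) l) (1 - m)) as [lo [H1 H2]]; [lra|].
  exists (1 - lo). split; [lra|]. intros b Hb Hbm.
  specialize (H2 (1 - b)). enough (1 - b <= lo) by lra. apply H2; [|lra].
  now apply (in_map (fun b => 1 - b)).
Qed.

(** The pairs are treated one by one: the map for the tail is corrected by a [bump] whose support
    contains none of the values already prescribed. *)
Lemma interpolate (l : list (R * R)) :
  (forall p, In p l -> (fst p = 0 -> snd p = 0) /\ (fst p = 1 -> snd p = 1) /\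
     (0 < fst p < 1 -> 0 < snd p < 1) /\ 0 <= fst p <= 1) ->
  (forall p q, In p l -> In q l ->
     (fst p < fst q -> snd p < snd q) /\ (fst p = fst q -> snd p = snd q)) ->
  exists F, increasing_homeo F /\ forall p, In p l -> F (fst p) = snd p.
Proof.
  induction l as [|[a b] l IH]; intros Hr Hc.
  - exists (fun x => x). split; [|intros p []].
    split; [intros x; apply continuous_id|]. split; auto.
  - destruct IH as [F [[FC [FI FB]] FE]].
    { intros p Hp; apply Hr; now right. }
    { intros p q Hp Hq; apply Hc; now right. }
    destruct (classic (exists p, In p l /\ fst p = a)) as [[p [Hp Ea]]|Hn].
    { exists F. split; [repeat split; auto|]. intros q [<-|Hq]; [|auto]. simpl.
      rewrite <- Ea, FE by auto. apply (Hc p (a, b)); [now right|now left|exact Ea]. }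
    destruct (Hr (a, b) (or_introl eq_refl)) as [R0 [R1 [R2 R3]]]. simpl in *.
    destruct (Req_dec a 0) as [E0|N0].
    { exists F. split; [repeat split; auto|]. intros q [<-|Hq]; [|auto]. simpl.
      rewrite FB, R0; lra. }
    destruct (Req_dec a 1) as [E1|N1].
    { exists F. split; [repeat split; auto|]. intros q [<-|Hq]; [|auto]. simpl.
      rewrite FB, R1; lra. }
    assert (Hb : 0 < b < 1) by (apply R2; lra).
    assert (HF : 0 < F a < 1).
    { split; [replace 0 with (F 0) by (apply FB; lra)|replace 1 with (F 1) by (apply FB; lra)];
        apply FI; lra. }
    (* By monotonicity, each prescribed value lies on the same side of [F a] and of [b], hence not
       between them; so an interval around both avoids all of these values. *)
    destruct (gap_below (map snd l) (Rmin (F a) b)) as [lo [L1 L2]].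
    { apply Rmin_glb_lt; lra. }
    destruct (gap_above (map snd l) (Rmax (F a) b)) as [hi [H1 H2]].
    { apply Rmax_lub_lt; lra. }
    generalize (Rmin_l (F a) b) (Rmin_r (F a) b) (Rmax_l (F a) b) (Rmax_r (F a) b).
    intros M1 M2 M3 M4.
    destruct (bump (F a) b lo hi) as [G [GC [GI [GV GF]]]]; [lra|lra|].
    exists (fun x => G (F x)). split; [split; [|split]|].
    + intros x. now apply (continuous_comp F G).
    + intros x y Hxy. auto.
    + intros x Hx. rewrite (FB x Hx). apply GF. destruct Hx; lra.
    + intros p [<-|Hp]; [exact GV|]. rewrite FE by auto. apply GF.
      destruct (Rtotal_order (fst p) a) as [Hlt|[He|Hgt]].
      * left. apply L2; [now apply in_map|].
        apply Rmin_glb_lt.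
        -- rewrite <- FE by auto. now apply FI.
        -- apply (Hc p (a, b)); [now right|now left|exact Hlt].
      * exfalso. apply Hn. eauto.
      * right. apply H2; [now apply in_map|].
        apply Rmax_lub_lt.
        -- rewrite <- (FE p) by auto. now apply FI.
        -- apply (Hc (a, b) p); [now left|now right|simpl; lra].
Qed.

(** * Distance to an interval, finite sums and products: the weights of a convex combination *)

Definition idist (b c y : R) : R := Rmax 0 (Rmax (b - y) (y - c)).

Lemma idist_cont b c y : continuous (idist b c) y.
Proof.
  unfold idist. apply cont_max; [apply continuous_const|]. apply cont_max;
  apply cont_minus; try apply continuous_id; apply continuous_const.
Qed.

Lemma idist_pos b c y : 0 <= idist b c y.
Proof. apply Rmax_l. Qed.

Lemma idist_zero b c y : b <= y <= c -> idist b c y = 0.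
Proof. intros H. unfold idist. apply Rmax_left. apply Rmax_lub; lra. Qed.

Lemma idist_nonzero b c y : ~ (b <= y <= c) -> 0 < idist b c y.
Proof.
  intros H. unfold idist. destruct (Rle_dec b y).
  - eapply Rlt_le_trans; [|apply Rmax_r]. eapply Rlt_le_trans; [|apply Rmax_r]. lra.
  - eapply Rlt_le_trans; [|apply Rmax_r]. eapply Rlt_le_trans; [|apply Rmax_l]. lra.
Qed.

Definition rsum (f : nat -> R) (l : list nat) : R := fold_right (fun k s => f k + s) 0 l.
Definition rprod (f : nat -> R) (l : list nat) : R := fold_right (fun k s => f k * s) 1 l.

Lemma rsum_cont {U : UniformSpace} (f : nat -> U -> R) l x :
  (forall k, In k l -> continuous (f k) x) -> continuous (fun z => rsum (fun k => f k z) l) x.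
Proof.
  induction l as [|k l IH]; intros H; simpl; [apply continuous_const|].
  apply cont_plus; [apply H; now left|]. apply IH. intros; apply H; now right.
Qed.

Lemma rprod_cont {U : UniformSpace} (f : nat -> U -> R) l x :
  (forall k, In k l -> continuous (f k) x) -> continuous (fun z => rprod (fun k => f k z) l) x.
Proof.
  induction l as [|k l IH]; intros H; simpl; [apply continuous_const|].
  apply cont_mult; [apply H; now left|]. apply IH. intros; apply H; now right.
Qed.

Lemma rprod_pos f l : (forall k, In k l -> 0 < f k) -> 0 < rprod f l.
Proof.
  induction l as [|k l IH]; intros H; simpl; [lra|].
  apply Rmult_lt_0_compat; [apply H; now left|]. apply IH. intros; apply H; now right.
Qed.

Lemma rprod_nonneg f l : (forall k, In k l -> 0 <= f k) -> 0 <= rprod f l.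
Proof.
  induction l as [|k l IH]; intros H; simpl; [lra|].
  apply Rmult_le_pos; [apply H; now left|]. apply IH. intros; apply H; now right.
Qed.

Lemma rprod_zero f l k : In k l -> f k = 0 -> rprod f l = 0.
Proof.
  induction l as [|j l IH]; intros Hi H; [easy|]; destruct Hi as [Hi|Hi]; simpl.
  - subst. rewrite H. ring.
  - rewrite IH by auto. ring.
Qed.

Lemma rsum_nonneg f l : (forall k, In k l -> 0 <= f k) -> 0 <= rsum f l.
Proof.
  induction l as [|k l IH]; intros H; simpl; [lra|].
  assert (0 <= f k) by (apply H; now left).
  assert (0 <= rsum f l) by (apply IH; intros; apply H; now right). lra.
Qed.

Lemma rsum_pos f l k : (forall k, In k l -> 0 <= f k) -> In k l -> 0 < f k -> 0 < rsum f l.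
Proof.
  induction l as [|j l IH]; intros H Hi; [easy|]; destruct Hi as [Hi|Hi]; intros Hk; simpl.
  - subst. assert (0 <= rsum f l) by (apply rsum_nonneg; intros; apply H; now right). lra.
  - assert (0 <= f j) by (apply H; now left).
    assert (0 < rsum f l) by (apply IH; auto; intros; apply H; now right). lra.
Qed.

Lemma rsum_scal f g c l : (forall k, In k l -> f k = c * g k) -> rsum f l = c * rsum g l.
Proof.
  induction l as [|j l IH]; intros H; simpl; [ring|].
  rewrite (H j) by now left. rewrite IH by (intros; apply H; now right). ring.
Qed.

Lemma rsum_le f g l : (forall k, In k l -> f k <= g k) -> rsum f l <= rsum g l.
Proof.
  induction l as [|j l IH]; intros H; simpl; [lra|].
  apply Rplus_le_compat; [apply H; now left|]. apply IH; intros; apply H; now right.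
Qed.

Lemma rsum_lt f g l k : (forall k, In k l -> f k <= g k) -> In k l -> f k < g k ->
  rsum f l < rsum g l.
Proof.
  induction l as [|j l IH]; intros H Hi; [easy|]; destruct Hi as [Hi|Hi]; intros Hk; simpl.
  - subst. apply Rplus_lt_le_compat; auto. apply rsum_le; intros; apply H; now right.
  - apply Rplus_le_lt_compat; [apply H; now left|]. apply IH; auto; intros; apply H; now right.
Qed.

(* Interpolation of the vertical sides: a continuous family of increasing homeomorphisms,
   obtained as a convex combination, with weights depending on the height [y], of
   interpolations at finitely many heights (the lower ends [y0] of the intervals):
   the weight of the height [y0 k] vanishes unless all intervals containing [y]
   contain [y0 k]. *)
Lemma shear_function (D : list nat) (y0 y1 : nat -> R) (a a' : nat -> bool -> R) :
  D <> [] ->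
  (forall i al, In i D -> (a i al = 0 -> a' i al = 0) /\ (a i al = 1 -> a' i al = 1) /\
     (0 < a i al < 1 -> 0 < a' i al < 1) /\ 0 <= a i al <= 1) ->
  (forall i j al be, In i D -> In j D -> y0 i <= y1 i -> y0 j <= y1 j ->
     y0 i <= y1 j -> y0 j <= y1 i ->
     (a i al < a j be -> a' i al < a' j be) /\ (a i al = a j be -> a' i al = a' j be)) ->
  exists X : R * R -> R,
    (forall p, continuous X p) /\
    (forall x x' y, x < x' -> X (x, y) < X (x', y)) /\
    (forall x y, x <= 0 \/ 1 <= x -> X (x, y) = x) /\
    (forall i al y, In i D -> y0 i <= y <= y1 i -> X (a i al, y) = a' i al).
Proof.
  intros Hne Hr Hc.
  assert (HF : forall k, exists F, increasing_homeo F /\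
    forall i al, In i D -> y0 i <= y0 k <= y1 i -> F (a i al) = a' i al).
  { intros k.
    set (S := filter (fun i => if Rle_dec (y0 i) (y0 k) then
                                 if Rle_dec (y0 k) (y1 i) then true else false else false) D).
    assert (HS : forall i, In i S <-> In i D /\ y0 i <= y0 k <= y1 i).
    { intros i. unfold S. rewrite filter_In.
      destruct (Rle_dec (y0 i) (y0 k)); [destruct (Rle_dec (y0 k) (y1 i))|];
        split; intros [H1 H2]; split; auto; try discriminate; lra. }
    set (l := map (fun i => (a i false, a' i false)) S ++ map (fun i => (a i true, a' i true)) S).
    assert (Hl : forall p, In p l -> exists i al, In i D /\ y0 i <= y0 k <= y1 i /\
              p = (a i al, a' i al)).
    { intros p Hp. unfold l in Hp. apply in_app_or in Hp.
      destruct Hp as [Hp|Hp]; apply in_map_iff in Hp; destruct Hp as [i [<- Hi]];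
        apply HS in Hi; exists i; [exists false|exists true]; tauto. }
    destruct (interpolate l) as [F [F1 F2]].
    - intros p Hp. destruct (Hl p Hp) as [i [al [Hi [_ ->]]]]. now apply Hr.
    - intros p q Hp Hq. destruct (Hl p Hp) as [i [al [Hi [Hy ->]]]].
      destruct (Hl q Hq) as [j [be [Hj [Hy' ->]]]]. apply Hc; auto; lra.
    - exists F. split; auto. intros i al Hi Hy. apply (F2 (a i al, a' i al)).
      unfold l. apply in_or_app.
      destruct al; [right|left]; apply in_map_iff; exists i; (split; [reflexivity|]);
        now apply HS. }
  apply choice in HF. destruct HF as [F HF].
  (* An interval that misses [y0 k] contributes its distance to [y], which vanishes when [y] enters
     it; the intervals containing [y0 k] contribute 1. *)
  set (w := fun k y => rprod (fun j => if Rle_dec (y0 j) (y0 k) then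
                           if Rle_dec (y0 k) (y1 j) then 1 else idist (y0 j) (y1 j) y
                         else idist (y0 j) (y1 j) y) D).
  assert (Wc : forall k y, continuous (w k) y).
  { intros k y. unfold w. apply (rprod_cont (fun j y => _)). intros j _.
    destruct Rle_dec; [destruct Rle_dec|]; try apply continuous_const; apply idist_cont. }
  assert (Wn : forall k y, 0 <= w k y).
  { intros k y. apply rprod_nonneg. intros j _.
    destruct Rle_dec; [destruct Rle_dec|]; try apply idist_pos; lra. }
  assert (Wz : forall k y i, In i D -> y0 i <= y <= y1 i -> ~ (y0 i <= y0 k <= y1 i) -> w k y = 0).
  { intros k y i Hi Hy Hn. apply rprod_zero with i; auto.
    destruct Rle_dec; [destruct Rle_dec|]; try (exfalso; apply Hn; lra); now apply idist_zero. }
  (* Among the intervals containing [y], the one with the greatest lower end works: this end is at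
     most [y] and thus lies in all the others. If no interval contains [y], all factors are
     positive. *)
  assert (Wp : forall y, exists k, In k D /\ 0 < w k y).
  { intros y.
    assert (HM : forall l, (forall i, In i l -> ~ (y0 i <= y <= y1 i)) \/
       exists k, In k l /\ y0 k <= y <= y1 k /\
         forall i, In i l -> y0 i <= y <= y1 i -> y0 i <= y0 k).
    { induction l as [|i l IH]; [left; intros i []|].
      destruct (classic (y0 i <= y <= y1 i)) as [Hi|Hi].
      - right. destruct IH as [IH|[k [K1 [K2 K3]]]].
        + exists i. split; [now left|]. split; auto. intros j [<-|Hj] Hy; [lra|].
          exfalso. now apply (IH j).
        + destruct (Rle_dec (y0 i) (y0 k)).
          * exists k. split; [now right|]. split; auto. intros j [<-|Hj] Hy; auto.
          * exists i. split; [now left|]. split; auto. intros j [<-|Hj] Hy; [lra|].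
            specialize (K3 j Hj Hy). lra.
      - destruct IH as [IH|[k [K1 [K2 K3]]]].
        + left. intros j [<-|Hj]; auto.
        + right. exists k. split; [now right|]. split; auto. intros j [<-|Hj] Hy; [tauto|auto]. }
    destruct (HM D) as [H|[k [K1 [K2 K3]]]].
    - destruct D as [|k D']; [easy|]. exists k. split; [now left|].
      apply rprod_pos. intros j Hj.
      destruct Rle_dec; [destruct Rle_dec|]; try lra; apply idist_nonzero; auto.
    - exists k. split; auto. apply rprod_pos. intros j Hj.
      destruct Rle_dec; [destruct Rle_dec|]; try lra; apply idist_nonzero;
        intros Hy; specialize (K3 j Hj Hy); lra. }
  set (W := fun y => rsum (fun k => w k y) D).
  assert (WP : forall y, 0 < W y).
  { intros y. destruct (Wp y) as [k [K1 K2]]. apply rsum_pos with k; auto. }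
  exists (fun p => rsum (fun k => w k (snd p) * F k (fst p)) D * / W (snd p)).
  split; [|split; [|split]].
  - intros [x y]. apply cont_mult.
    + apply (rsum_cont (fun k p => w k (snd p) * F k (fst p))). intros k _. apply cont_mult.
      * apply (continuous_comp snd (w k)); [apply continuous_snd|apply Wc].
      * apply (continuous_comp fst (F k)); [apply continuous_fst|]. now apply HF.
    + apply cont_inv.
      * apply (continuous_comp snd W); [apply continuous_snd|].
        unfold W. apply (rsum_cont w). intros; apply Wc.
      * simpl. specialize (WP y). lra.
  - intros x x' y Hx. simpl. apply Rmult_lt_compat_r; [apply Rinv_0_lt_compat; auto|].
    destruct (Wp y) as [k [K1 K2]]. apply rsum_lt with k; auto.
    + intros j _. apply Rmult_le_compat_l; auto. apply Rlt_le. now apply HF.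
    + apply Rmult_lt_compat_l; auto. now apply HF.
  - intros x y Hx. simpl.
    rewrite (rsum_scal _ (fun k => w k y) x).
    + fold (W y). specialize (WP y). field. lra.
    + intros k _. replace (F k x) with x by (symmetry; now apply HF). ring.
  - intros i al y Hi Hy. simpl.
    rewrite (rsum_scal _ (fun k => w k y) (a' i al)).
    + fold (W y). specialize (WP y). field. lra.
    + intros k _. destruct (classic (y0 i <= y0 k <= y1 i)) as [Hk|Hk].
      * destruct (HF k) as [_ E]. rewrite E by auto. ring.
      * rewrite (Wz k y i) by auto. ring.
Qed.

(** * Shears and combinatorial equivalence *)

Lemma dist2_lt (p q : pt) e :
  dist2 p q < e <-> Rabs (fst p - fst q) < e /\ Rabs (snd p - snd q) < e.
Proof.
  unfold dist2. split.
  - intros H. split; eapply Rle_lt_trans; try exact H; [apply Rmax_l|apply Rmax_r].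
  - intros [H1 H2]. now apply Rmax_lub_lt.
Qed.

Lemma continuous_eps (X : R * R -> R) (p : pt) :
  continuous X p -> forall eps, eps > 0 -> exists delta, delta > 0 /\
    forall q : pt, dist2 p q < delta -> Rabs (X p - X q) < eps.
Proof.
  intros H eps He.
  assert (L : locally (X p) (fun v => Rabs (X p - v) < eps)).
  { exists (mkposreal eps He). intros v Hv. rewrite Rabs_minus_sym. exact Hv. }
  destruct (H _ L) as [d Hd]. exists d. split; [apply cond_pos|].
  intros q Hq. apply Hd. apply dist2_lt in Hq. destruct Hq as [H1 H2].
  split; rewrite Rabs_minus_sym in *; [exact H1|exact H2].
Qed.

Lemma continuous_neg {U : UniformSpace} (f : U -> R) x :
  continuous f x -> f x < 0 -> locally x (fun z => f z < 0).
Proof. intros H Hx. apply (H (fun v => v < 0)). now apply (open_lt 0). Qed.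

Lemma continuous_slice_l (X : R * R -> R) y z :
  continuous X (z, y) -> continuous (fun z => X (z, y)) z.
Proof.
  intros H. apply (continuous_comp_2 (fun z => z) (fun _ => y) (fun a b => X (a, b))).
  - apply continuous_id.
  - apply continuous_const.
  - eapply continuous_ext; [|exact H]. now intros [u v].
Qed.

Lemma continuous_slice_r (X : R * R -> R) y z :
  continuous X (z, y) -> continuous (fun y => X (z, y)) y.
Proof.
  intros H. apply (continuous_comp_2 (fun _ => z) (fun y => y) (fun a b => X (a, b))).
  - apply continuous_const.
  - apply continuous_id.
  - eapply continuous_ext; [|exact H]. now intros [u v].
Qed.

(** The abscissa part of a map of the plane that preserves horizontal lines. It is total and the
    identity outside the open strip, so the boundary of the square needs no separate treatment. *)
Definition shear_half (X : R * R -> R) : Prop :=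
  (forall p, continuous X p) /\
  (forall x x' y, x < x' -> X (x, y) < X (x', y)) /\
  (forall x y, x <= 0 \/ 1 <= x -> X (x, y) = x).

Definition shear_pair (X Z : R * R -> R) : Prop :=
  shear_half X /\ shear_half Z /\
  (forall x y, X (Z (x, y), y) = x) /\ (forall x y, Z (X (x, y), y) = x).

Lemma shear_pair_sym X Z : shear_pair X Z -> shear_pair Z X.
Proof. unfold shear_pair. tauto. Qed.

(** On each horizontal line the inverse exists by the intermediate value theorem. It is jointly
    continuous because [X (z0 - e, y) < x < X (z0 + e, y)] is an open condition on [(x, y)], and by
    monotonicity it puts the preimage within [e] of [z0]. *)
Lemma shear_inverse X : shear_half X -> exists Z, shear_pair X Z.
Proof.
  intros HX. assert (HX' := HX). destruct HX as [XC [XI XB]].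
  assert (H : forall p : R * R, exists z, X (z, snd p) = fst p).
  { intros [x y]. simpl.
    destruct (Rle_dec x 0); [exists x; apply XB; lra|].
    destruct (Rle_dec 1 x); [exists x; apply XB; lra|].
    destruct (IVT_gen_consistent (fun z => X (z, y)) 0 1 x) as [z [_ Hz]].
    - intros z. apply continuous_slice_l. apply XC.
    - rewrite (XB 0 y), (XB 1 y) by lra. rewrite Rmin_left, Rmax_right; lra.
    - now exists z. }
  apply choice in H. destruct H as [Z HZ].
  assert (E1 : forall x y, X (Z (x, y), y) = x) by (intros x y; apply (HZ (x, y))).
  assert (XJ : forall x x' y, X (x, y) < X (x', y) -> x < x').
  { intros x x' y H. destruct (Rtotal_order x x') as [L|[->|L]]; auto; [lra|].
    apply (XI _ _ y) in L. lra. }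
  assert (E2 : forall x y, Z (X (x, y), y) = x).
  { intros x y. generalize (E1 (X (x, y)) y). set (u := Z (X (x, y), y)). intros E.
    destruct (Rtotal_order u x) as [L|[L|L]]; auto; apply (XI _ _ y) in L; lra. }
  exists Z. split; [auto|]. split; [|auto]. split; [|split].
  - intros [x0 y0] P [eps HP].
    set (z0 := Z (x0, y0)). set (e := eps / 2).
    assert (He : 0 < e) by (unfold e; generalize (cond_pos eps); lra).
    assert (A1 : locally ((x0, y0) : R * R) (fun p => X (z0 - e, snd p) - fst p < 0)).
    { apply continuous_neg.
      - apply cont_minus; [|apply continuous_fst].
        apply (continuous_comp snd (fun y => X (z0 - e, y))); [apply continuous_snd|].
        apply continuous_slice_r. apply XC.
      - change (X (z0 - e, y0) - x0 < 0). assert (X (z0 - e, y0) < X (z0, y0)) by (apply XI; lra).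
        assert (E : X (z0, y0) = x0) by apply E1. lra. }
    assert (A2 : locally ((x0, y0) : R * R) (fun p => fst p - X (z0 + e, snd p) < 0)).
    { apply continuous_neg.
      - apply cont_minus; [apply continuous_fst|].
        apply (continuous_comp snd (fun y => X (z0 + e, y))); [apply continuous_snd|].
        apply continuous_slice_r. apply XC.
      - change (x0 - X (z0 + e, y0) < 0). assert (X (z0, y0) < X (z0 + e, y0)) by (apply XI; lra).
        assert (E : X (z0, y0) = x0) by apply E1. lra. }
    change (locally ((x0, y0) : R * R) (fun p => P (Z p))).
    generalize (filter_and _ _ A1 A2). apply filter_imp. intros [x y] [H1 H2]. simpl in *.
    apply HP. change (Rabs (Z (x, y) - z0) < eps).
    assert (z0 - e < Z (x, y)) by (apply XJ with y; rewrite E1; lra).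
    assert (Z (x, y) < z0 + e) by (apply XJ with y; rewrite E1; lra).
    apply Rabs_def1; unfold e in *; lra.
  - intros x x' y H. apply XJ with y. now rewrite !E1.
  - intros x y H. rewrite <- (XB x y H) at 1. apply E2.
Qed.

Definition sidex (q : rect) (al : bool) : R := if al then rx1 q else rx0 q.
Definition sidey (q : rect) (al : bool) : R := if al then ry1 q else ry0 q.
Definition valid_rect (q : rect) : Prop :=
  (0 <= rx0 q < rx1 q /\ rx1 q <= 1) /\ (0 <= ry0 q < ry1 q /\ ry1 q <= 1).

(** By the intermediate value theorem. It shows that a shear keeps a vertical segment of the
    skeleton vertical, even when the segment runs along several tiles. *)
Lemma finite_values_const (f : R -> R) (a b : R) (V : list R) :
  a <= b -> (forall y, continuous f y) -> (forall y, a <= y <= b -> In (f y) V) -> f a = f b.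
Proof.
  intros Hab Hf HV.
  destruct (Req_dec (f a) (f b)) as [|Hn]; auto. exfalso.
  assert (Hv : forall lo hi, lo < hi -> exists v, lo < v < hi /\ ~ In v V).
  { clear HV. induction V as [|w V IH]; intros lo hi H.
    - exists ((lo + hi) / 2). split; [lra|easy].
    - destruct (Rle_dec w ((lo + hi) / 2)).
      + destruct (IH ((lo + hi) / 2) hi) as [v [H1 H2]]; [lra|].
        exists v. split; [lra|]. intros [->|H3]; [lra|auto].
      + destruct (IH lo ((lo + hi) / 2)) as [v [H1 H2]]; [lra|].
        exists v. split; [lra|]. intros [->|H3]; [lra|auto]. }
  destruct (Hv (Rmin (f a) (f b)) (Rmax (f a) (f b))) as [v [H1 H2]].
  { unfold Rmin, Rmax. destruct Rle_dec; lra. }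
  destruct (IVT_gen_consistent f a b v Hf) as [y [Hy <-]]; [lra|].
  apply H2, HV. rewrite Rmin_left, Rmax_right in Hy; lra.
Qed.

Section Shear.
Variables (D : list nat) (c1 c2 : nat -> rect) (X Z : R * R -> R).
Hypothesis HXZ : shear_pair X Z.
Hypothesis Hy : forall i, In i D -> ry0 (c1 i) = ry0 (c2 i) /\ ry1 (c1 i) = ry1 (c2 i).
Hypothesis Hs : forall i al y, In i D -> ry0 (c1 i) <= y <= ry1 (c1 i) ->
  X (sidex (c1 i) al, y) = sidex (c2 i) al.

Let h (p : pt) : pt := (X p, snd p).

Lemma shear_lt x x' y : x < x' <-> X (x, y) < X (x', y).
Proof.
  destruct HXZ as [[_ [XI _]] _]. split; [apply XI|].
  intros H. destruct (Rtotal_order x x') as [L|[->|L]]; auto; [lra|].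
  apply (XI _ _ y) in L. lra.
Qed.

Lemma shear_le x x' y : x <= x' <-> X (x, y) <= X (x', y).
Proof. generalize (shear_lt x' x y). lra. Qed.

Lemma shear_closed i p : In i D -> in_closed (c1 i) p <-> in_closed (c2 i) (h p).
Proof.
  intros Hi. destruct p as [x y]. unfold in_closed, h; simpl.
  destruct (Hy i Hi) as [<- <-].
  assert (E : ry0 (c1 i) <= y <= ry1 (c1 i) ->
    X (rx0 (c1 i), y) = rx0 (c2 i) /\ X (rx1 (c1 i), y) = rx1 (c2 i)).
  { intros H. split; [apply (Hs i false)|apply (Hs i true)]; auto. }
  rewrite (shear_le (rx0 (c1 i)) x y), (shear_le x (rx1 (c1 i)) y).
  split; intros [H1 H2]; destruct (E H2) as [E1 E2]; split; auto; lra.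
Qed.

Lemma shear_open i p : In i D -> in_open (c1 i) p <-> in_open (c2 i) (h p).
Proof.
  intros Hi. destruct p as [x y]. unfold in_open, h; simpl.
  destruct (Hy i Hi) as [<- <-].
  assert (E : ry0 (c1 i) < y < ry1 (c1 i) ->
    X (rx0 (c1 i), y) = rx0 (c2 i) /\ X (rx1 (c1 i), y) = rx1 (c2 i)).
  { intros H. split; [apply (Hs i false)|apply (Hs i true)]; auto; lra. }
  rewrite (shear_lt (rx0 (c1 i)) x y), (shear_lt x (rx1 (c1 i)) y).
  split; intros [H1 H2]; destruct (E H2) as [E1 E2]; split; auto; lra.
Qed.

Lemma shear_skeleton p : skeleton (map c1 D) p <-> skeleton (map c2 D) (h p).
Proof.
  unfold skeleton. split; intros [q [Hq [H1 H2]]]; apply in_map_iff in Hq;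
    destruct Hq as [i [<- Hi]].
  - exists (c2 i). split; [now apply in_map|]. rewrite shear_closed, shear_open in * by auto. auto.
  - exists (c1 i). split; [now apply in_map|]. rewrite shear_closed, shear_open by auto. auto.
Qed.

Lemma shear_square p : in_square p -> in_square (h p).
Proof.
  destruct HXZ as [[_ [_ XB]] _]. destruct p as [x y]. unfold in_square, h; simpl.
  intros [H1 H2]. split; auto.
  generalize (XB 0 y) (XB 1 y) (shear_le 0 x y) (shear_le x 1 y). lra.
Qed.

Lemma shear_cont : cont_on_square h.
Proof.
  destruct HXZ as [[XC _] _].
  intros p _ eps He. destruct (continuous_eps X p (XC p) eps He) as [d [H1 H2]].
  exists (Rmin d eps). split; [now apply Rmin_Rgt_r|].
  intros q _ Hq. apply dist2_lt. simpl. split.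
  - apply H2. eapply Rlt_le_trans; [exact Hq|apply Rmin_l].
  - apply dist2_lt in Hq. eapply Rlt_le_trans; [apply Hq|apply Rmin_r].
Qed.

Lemma shear_corners : fixes_corners h.
Proof.
  destruct HXZ as [[_ [_ XB]] _]. unfold fixes_corners, h; simpl.
  repeat split; rewrite XB; auto; lra.
Qed.

Lemma shear_hv : preserves_hv (map c1 D) h.
Proof.
  destruct HXZ as [[XC [XI XB]] [_ [E1 E2]]].
  split.
  - intros a b y Hab _. exists (X (a, y)), (X (b, y)), y. split; [now apply XI|].
    split.
    + intros [x y'] [H1 H2]. simpl in *. subst y'. unfold hseg, h; simpl.
      rewrite <- !shear_le. auto.
    + intros [x y'] [H1 H2]. simpl in *. subst y'. exists (Z (x, y), y).
      unfold hseg, h; simpl. rewrite E1.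
      rewrite (shear_le a _ y), (shear_le _ b y), E1. auto.
  - intros x a b Hab Hsk.
    assert (HV : forall y, a <= y <= b -> X (x, a) = X (x, y)).
    { intros y Hyab.
      (* A point of the segment lies on a vertical side, whose image abscissa is known, or at the
         ordinate of a horizontal side, and there are finitely many of these. *)
      apply (finite_values_const (fun y => X (x, y)) a y
        (flat_map (fun i => [rx0 (c2 i); rx1 (c2 i); X (x, ry0 (c1 i)); X (x, ry1 (c1 i))]) D)).
      - lra.
      - intros z. apply continuous_slice_r, XC.
      - intros z Hz. destruct (Hsk (x, z)) as [q [Hq [H1 H2]]]; [split; simpl; lra|].
        apply in_map_iff in Hq. destruct Hq as [i [<- Hi]].
        apply in_flat_map. exists i. split; auto.
        unfold in_closed, in_open in *. simpl in H1, H2.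
        destruct (Req_dec z (ry0 (c1 i))) as [->|N0]; [simpl; auto|].
        destruct (Req_dec z (ry1 (c1 i))) as [->|N1]; [simpl; auto|].
        destruct (Req_dec x (rx0 (c1 i))) as [->|N2].
        { left. symmetry. apply (Hs i false); auto; lra. }
        destruct (Req_dec x (rx1 (c1 i))) as [->|N3].
        { right; left. symmetry. apply (Hs i true); auto; lra. }
        exfalso. apply H2. lra. }
    exists (X (x, a)), a, b. split; auto. split.
    + intros [x' y] [H1 H2]. simpl in *. subst x'. split; simpl; auto. symmetry; now apply HV.
    + intros [x' y] [H1 H2]. simpl in *. subst x'. exists (x, y).
      split; [split; simpl; auto|]. unfold h; simpl. f_equal. symmetry; now apply HV.
Qed.
End Shear.

(** Abscissas are compared only for tiles whose closed ranges of ordinates meet: no other pair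
    constrains the map at a common height. *)
Lemma shear_equiv (D : list nat) (c1 c2 : nat -> rect) :
  D <> [] ->
  (forall i, In i D -> valid_rect (c1 i)) ->
  (forall i, In i D -> ry0 (c1 i) = ry0 (c2 i) /\ ry1 (c1 i) = ry1 (c2 i)) ->
  (forall i al, In i D -> (sidex (c1 i) al = 0 -> sidex (c2 i) al = 0) /\
     (sidex (c1 i) al = 1 -> sidex (c2 i) al = 1) /\
     (0 < sidex (c1 i) al < 1 -> 0 < sidex (c2 i) al < 1)) ->
  (forall i j al be, In i D -> In j D ->
     ry0 (c1 i) <= ry1 (c1 j) -> ry0 (c1 j) <= ry1 (c1 i) ->
     (sidex (c1 i) al < sidex (c1 j) be -> sidex (c2 i) al < sidex (c2 j) be) /\
     (sidex (c1 i) al = sidex (c1 j) be -> sidex (c2 i) al = sidex (c2 j) be)) ->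
  comb_equiv (map c1 D) (map c2 D).
Proof.
  intros HD Hv Hy Hb Hc.
  destruct (shear_function D (fun i => ry0 (c1 i)) (fun i => ry1 (c1 i))
    (fun i al => sidex (c1 i) al) (fun i al => sidex (c2 i) al)) as [X [X1 [X2 [X3 X4]]]]; auto.
  { intros i al Hi. destruct (Hb i al Hi) as [B1 [B2 B3]]. repeat split; auto; try now apply B3.
    - destruct (Hv i Hi); destruct al; simpl; lra.
    - destruct (Hv i Hi); destruct al; simpl; lra. }
  destruct (shear_inverse X) as [Z HXZ]; [repeat split; auto|].
  assert (HZX := shear_pair_sym _ _ HXZ).
  assert (Hy' : forall i, In i D -> ry0 (c2 i) = ry0 (c1 i) /\ ry1 (c2 i) = ry1 (c1 i)).
  { intros i Hi. destruct (Hy i Hi). auto. }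
  assert (Hs' : forall i al y, In i D -> ry0 (c2 i) <= y <= ry1 (c2 i) ->
    Z (sidex (c2 i) al, y) = sidex (c1 i) al).
  { intros i al y Hi Hyy. destruct (Hy i Hi) as [Y1 Y2]. rewrite <- Y1, <- Y2 in Hyy.
    rewrite <- (X4 i al y Hi Hyy). apply HXZ. }
  assert (E1 : forall p : pt, (Z (X p, snd p), snd (X p, snd p)) = p).
  { intros [x y]. simpl. f_equal. apply HXZ. }
  assert (E2 : forall p : pt, (X (Z p, snd p), snd (Z p, snd p)) = p).
  { intros [x y]. simpl. f_equal. apply HXZ. }
  exists (fun p => (X p, snd p)), (fun p => (Z p, snd p)).
  split; [|split; [|split; [|split]]].
  - split; [now apply (shear_cont X Z)|]. split; [now apply (shear_cont Z X)|].
    split; [now apply (shear_square X Z)|]. split; [now apply (shear_square Z X)|].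
    split; intros p _; [apply E1|apply E2].
  - now apply (shear_corners X Z).
  - split.
    + intros p Hp. now apply (shear_skeleton D c1 c2 X Z HXZ Hy X4).
    + intros p Hp. exists (Z p, snd p). split; [|apply E2].
      now apply (shear_skeleton D c2 c1 Z X HZX Hy' Hs').
  - now apply (shear_hv D c1 c2 X Z).
  - now apply (shear_hv D c2 c1 Z X).
Qed.

(** * Composition and reflection of equivalences *)

(** The two maps of an equivalence are mutually inverse on the square only; the hypothesis on the
    middle skeleton allows cancelling them there. *)
Lemma comb_equiv_trans T1 T2 T3 :
  (forall p, skeleton T2 p -> in_square p) ->
  comb_equiv T1 T2 -> comb_equiv T2 T3 -> comb_equiv T1 T3.
Proof.
  intros S2.
  intros [h [g [[H1 [H2 [H3 [H4 [H5 H6]]]]] [H7 [[H8 H8'] [H9 H10]]]]]].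
  intros [k [l [[K1 [K2 [K3 [K4 [K5 K6]]]]] [K7 [[K8 K8'] [K9 K10]]]]]].
  assert (CC : forall f f', cont_on_square f -> cont_on_square f' ->
    (forall p, in_square p -> in_square (f p)) -> cont_on_square (fun p => f' (f p))).
  { intros f f' F F' S p Hp eps He. destruct (F' (f p) (S p Hp) eps He) as [d [D1 D2]].
    destruct (F p Hp d D1) as [d' [D1' D2']]. exists d'. split; auto. }
  assert (HV : forall T T' f f', preserves_hv T f -> preserves_hv T' f' ->
    (forall p, skeleton T p -> skeleton T' (f p)) -> preserves_hv T (fun p => f' (f p))).
  { intros T T' f f' [F1 F2] [G1 G2] S. split.
    - intros a b y Hab Hs. destruct (F1 a b y Hab Hs) as [a' [b' [y' [Hab' [M1 M2]]]]].
      destruct (G1 a' b' y' Hab') as [a2 [b2 [y2 [Hab2 [N1 N2]]]]].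
      { intros p' Hp'. destruct (M2 p' Hp') as [p [Hp <-]]. auto. }
      exists a2, b2, y2. split; auto. split; auto.
      intros p2 Hp2. destruct (N2 p2 Hp2) as [p' [Hp' <-]].
      destruct (M2 p' Hp') as [p [Hp <-]]. eauto.
    - intros a b y Hab Hs. destruct (F2 a b y Hab Hs) as [a' [b' [y' [Hab' [M1 M2]]]]].
      destruct (G2 a' b' y' Hab') as [a2 [b2 [y2 [Hab2 [N1 N2]]]]].
      { intros p' Hp'. destruct (M2 p' Hp') as [p [Hp <-]]. auto. }
      exists a2, b2, y2. split; auto. split; auto.
      intros p2 Hp2. destruct (N2 p2 Hp2) as [p' [Hp' <-]].
      destruct (M2 p' Hp') as [p [Hp <-]]. eauto. }
  exists (fun p => k (h p)), (fun p => g (l p)).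
  split; [|split; [|split; [|split]]].
  - split; [|split; [|split; [|split; [|split]]]]; auto.
    + intros p Hp. rewrite K5; auto.
    + intros p Hp. rewrite H6; auto.
  - unfold fixes_corners. destruct H7 as [-> [-> [-> ->]]]. exact K7.
  - split; auto. intros p' Hp'. destruct (K8' p' Hp') as [q [Hq <-]].
    destruct (H8' q Hq) as [p [Hp <-]]. eauto.
  - eapply HV; eauto.
  - eapply HV; eauto. intros p Hp. destruct (K8' p Hp) as [q [Hq <-]].
    rewrite K5; auto.
Qed.

(** An equivalence sees only the skeleton. Since tilings are lists, this is what allows permuting
    their tiles. *)
Lemma comb_equiv_same_skeleton T1 T1' T2 :
  (forall p, skeleton T1 p <-> skeleton T1' p) -> comb_equiv T1' T2 -> comb_equiv T1 T2.
Proof.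
  intros HS [h [g [H1 [H2 [[H3 H3'] [[H4 H4'] H5]]]]]].
  exists h, g. split; [auto|split; [auto|split; [split|split; [split|auto]]]].
  - intros p Hp. apply H3, HS, Hp.
  - intros p Hp. destruct (H3' p Hp) as [q [Hq <-]]. exists q. split; auto. now apply HS.
  - intros a b y Hab Hs. apply H4; auto. intros p Hp. now apply HS, Hs.
  - intros x a b Hab Hs. apply H4'; auto. intros p Hp. now apply HS, Hs.
Qed.

Definition swap (p : pt) : pt := (snd p, fst p).
Definition transpose (q : rect) : rect := Rect (ry0 q) (ry1 q) (rx0 q) (rx1 q).

Lemma skeleton_transpose T p : skeleton (map transpose T) p <-> skeleton T (swap p).
Proof.
  unfold skeleton, in_closed, in_open, swap. split.
  - intros [q [Hq H]]. apply in_map_iff in Hq. destruct Hq as [r [<- Hr]].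
    exists r. simpl in *. tauto.
  - intros [q [Hq H]]. exists (transpose q). split; [now apply in_map|]. simpl in *. tauto.
Qed.

(** Conjugation by the reflection in the diagonal; it turns the construction of horizontal shears
    into one of vertical shears. *)
Lemma comb_equiv_transpose T1 T2 :
  comb_equiv (map transpose T1) (map transpose T2) -> comb_equiv T1 T2.
Proof.
  intros [h [g [[H1 [H2 [H3 [H4 [H5 H6]]]]] [H7 [[H8 H8'] [H9 H10]]]]]].
  assert (SS : forall p, swap (swap p) = p) by now intros [x y].
  assert (SQ : forall p, in_square p -> in_square (swap p)).
  { intros p. unfold in_square, swap; simpl; tauto. }
  assert (D2 : forall p q, dist2 (swap p) (swap q) = dist2 p q).
  { intros p q. unfold dist2, swap; simpl. apply Rmax_comm. }
  assert (CC : forall f, cont_on_square f -> cont_on_square (fun p => swap (f (swap p)))).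
  { intros f F p Hp eps He. destruct (F (swap p) (SQ p Hp) eps He) as [d [D D']].
    exists d. split; auto. intros q Hq Hd. rewrite D2. apply D'; auto. now rewrite D2. }
  assert (SK : forall T p, skeleton T p <-> skeleton (map transpose T) (swap p)).
  { intros T p. now rewrite skeleton_transpose, SS. }
  assert (MO1 : forall f a b y a' b' y', maps_onto f (vseg y a b) (vseg y' a' b') ->
     maps_onto (fun p => swap (f (swap p))) (hseg a b y) (hseg a' b' y')).
  { intros f a b y a' b' y' [M1 M2]. split.
    - intros p [P1 P2]. destruct (M1 (swap p)) as [Q1 Q2]; [split; auto|]. split; auto.
    - intros p [P1 P2]. destruct (M2 (swap p)) as [q [[Q1 Q2] E]]; [split; auto|].
      exists (swap q). split; [split; auto|]. now rewrite SS, E, SS. }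
  assert (MO2 : forall f a b y a' b' y', maps_onto f (hseg a b y) (hseg a' b' y') ->
     maps_onto (fun p => swap (f (swap p))) (vseg y a b) (vseg y' a' b')).
  { intros f a b y a' b' y' [M1 M2]. split.
    - intros p [P1 P2]. destruct (M1 (swap p)) as [Q1 Q2]; [split; auto|]. split; auto.
    - intros p [P1 P2]. destruct (M2 (swap p)) as [q [[Q1 Q2] E]]; [split; auto|].
      exists (swap q). split; [split; auto|]. now rewrite SS, E, SS. }
  assert (HV : forall T f, preserves_hv (map transpose T) f ->
     preserves_hv T (fun p => swap (f (swap p)))).
  { intros T f [F1 F2]. split.
    - intros a b y Hab Hs. destruct (F2 y a b Hab) as [y' [a' [b' [H M]]]].
      + intros p [P1 P2]. apply skeleton_transpose, Hs. split; auto.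
      + exists a', b', y'. auto.
    - intros y a b Hab Hs. destruct (F1 a b y Hab) as [a' [b' [y' [H M]]]].
      + intros p [P1 P2]. apply skeleton_transpose, Hs. split; auto.
      + exists y', a', b'. auto. }
  exists (fun p => swap (h (swap p))), (fun p => swap (g (swap p))).
  split; [|split; [|split; [|split]]]; auto.
  - split; [|split; [|split; [|split; [|split]]]]; auto.
    + intros p Hp. now rewrite SS, H5, SS by auto.
    + intros p Hp. now rewrite SS, H6, SS by auto.
  - destruct H7 as [A1 [A2 [A3 A4]]]. unfold fixes_corners, swap at 2 4 6 8; simpl.
    rewrite A1, A2, A3, A4. auto.
  - split.
    + intros p Hp. apply SK. rewrite SS. apply H8. now apply SK in Hp.
    + intros p Hp. apply SK in Hp. destruct (H8' _ Hp) as [q [Hq E]].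
      exists (swap q). split; [now apply skeleton_transpose|]. now rewrite SS, E, SS.
Qed.

Lemma valid_skeleton_square T p :
  (forall q, In q T -> valid_rect q) -> skeleton T p -> in_square p.
Proof.
  intros HT [q [Hq [[H1 H2] _]]]. destruct (HT q Hq). unfold in_square. lra.
Qed.

Definition same_bounds (x x' : R) : Prop := (x = 0 <-> x' = 0) /\ (x = 1 <-> x' = 1).

(* The hypotheses are asymmetric in [c1] and [c2] because the proof passes through the hybrid
   tiling with the abscissas of [c2] and the ordinates of [c1]. *)
Lemma aligned_equiv (D : list nat) (c1 c2 : nat -> rect) :
  D <> [] ->
  (forall i, In i D -> valid_rect (c1 i)) ->
  (forall i, In i D -> valid_rect (c2 i)) ->
  (forall i al, In i D -> same_bounds (sidex (c1 i) al) (sidex (c2 i) al) /\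
     same_bounds (sidey (c1 i) al) (sidey (c2 i) al)) ->
  (forall i j al be, In i D -> In j D ->
     ry0 (c1 i) <= ry1 (c1 j) -> ry0 (c1 j) <= ry1 (c1 i) ->
     (sidex (c1 i) al < sidex (c1 j) be -> sidex (c2 i) al < sidex (c2 j) be) /\
     (sidex (c1 i) al = sidex (c1 j) be -> sidex (c2 i) al = sidex (c2 j) be)) ->
  (forall i j al be, In i D -> In j D ->
     rx0 (c2 i) <= rx1 (c2 j) -> rx0 (c2 j) <= rx1 (c2 i) ->
     (sidey (c1 i) al < sidey (c1 j) be -> sidey (c2 i) al < sidey (c2 j) be) /\
     (sidey (c1 i) al = sidey (c1 j) be -> sidey (c2 i) al = sidey (c2 j) be)) ->
  comb_equiv (map c1 D) (map c2 D).
Proof.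
  intros HD V1 V2 HB HX HY.
  set (m := fun i => Rect (rx0 (c2 i)) (rx1 (c2 i)) (ry0 (c1 i)) (ry1 (c1 i))).
  assert (VM : forall i, In i D -> valid_rect (m i)).
  { intros i Hi. generalize (V1 i Hi) (V2 i Hi). unfold valid_rect; simpl; tauto. }
  apply comb_equiv_trans with (map m D).
  - intros p. apply valid_skeleton_square. intros q Hq. apply in_map_iff in Hq.
    destruct Hq as [i [<- Hi]]. auto.
  - apply shear_equiv; auto.
    intros i al Hi. replace (sidex (m i) al) with (sidex (c2 i) al) by now destruct al.
    destruct (HB i al Hi) as [[B1 B2] _]. generalize (V2 i Hi). unfold valid_rect.
    destruct al; simpl in *; lra.
  - apply comb_equiv_transpose. rewrite !map_map. apply shear_equiv; auto.
    + intros i Hi. generalize (VM i Hi). unfold valid_rect; simpl; tauto.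
    + intros i al Hi. destruct (HB i al Hi) as [_ [B1 B2]]. generalize (V2 i Hi).
      unfold valid_rect. destruct al; simpl in *; lra.
Qed.

(** * Adjacencies preserved by an equivalence *)

(** For nondegenerate rectangles this is disjointness of the interiors, in the form of linear
    inequalities that [lra] can use. *)
Definition sep (p q : rect) : Prop :=
  rx1 p <= rx0 q \/ rx1 q <= rx0 p \/ ry1 p <= ry0 q \/ ry1 q <= ry0 p.

Definition in_half (q : rect) (x y : R) : Prop := rx0 q < x <= rx1 q /\ ry0 q < y <= ry1 q.

Definition sides (c : nat -> rect) (D : list nat) : list R :=
  flat_map (fun i => [rx0 (c i); rx1 (c i); ry0 (c i); ry1 (c i)]) D.

Lemma in_sides c D i : In i D ->
  In (rx0 (c i)) (sides c D) /\ In (rx1 (c i)) (sides c D) /\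
  In (ry0 (c i)) (sides c D) /\ In (ry1 (c i)) (sides c D).
Proof.
  intros Hi. unfold sides. repeat split; apply in_flat_map; exists i; simpl; tauto.
Qed.

(* The half-open tiles, indexed by [D], partition the half-open square. *)
Record HT (c : nat -> rect) (D : list nat) : Prop := {
  ht_nodup : NoDup D;
  ht_valid : forall i, In i D -> valid_rect (c i);
  ht_cover : forall x y, 0 < x <= 1 -> 0 < y <= 1 -> exists i, In i D /\ in_half (c i) x y;
  ht_sep : forall i j, In i D -> In j D -> i <> j -> sep (c i) (c j) }.

Arguments ht_nodup {c D}.
Arguments ht_valid {c D}.
Arguments ht_cover {c D}.
Arguments ht_sep {c D}.

Lemma HT_closed_cover c D p : HT c D -> in_square p -> exists i, In i D /\ in_closed (c i) p.
Proof.
  intros H. destruct p as [x y]. intros [Hx Hy]. simpl in *.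
  (* Half-open tiles miss the left and bottom sides of the square. A zero coordinate is replaced by
     [h], below every positive side coordinate, so the tile found reaches 0. *)
  destruct (gap_above (sides c D) 0) as [h [H1 H2]]; [lra|].
  set (x' := if Req_dec_T x 0 then h else x). set (y' := if Req_dec_T y 0 then h else y).
  assert (X' : 0 < x' <= 1) by (unfold x'; destruct (Req_dec_T x 0); lra).
  assert (Y' : 0 < y' <= 1) by (unfold y'; destruct (Req_dec_T y 0); lra).
  destruct (ht_cover H x' y' X' Y') as [i [Hi [I1 I2]]].
  - exists i. split; auto. destruct (in_sides c D i Hi) as [S1 [S2 [S3 S4]]].
    destruct (ht_valid H i Hi) as [V1 V2].
    generalize (H2 _ S1) (H2 _ S3). intros G1 G2.
    unfold in_closed; simpl. unfold x', y' in *.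
    destruct (Req_dec_T x 0), (Req_dec_T y 0); split; split; try lra;
      apply Rnot_lt_le; intros L; lra.
Qed.

Lemma open_sep p q z : valid_rect p -> valid_rect q -> in_open p z -> in_closed q z -> ~ sep p q.
Proof. unfold valid_rect, in_open, in_closed, sep. lra. Qed.

Lemma not_sep_open p q : valid_rect p -> valid_rect q ->
  (forall z, ~ (in_open p z /\ in_open q z)) -> sep p q.
Proof.
  intros Vp Vq H. destruct (classic (sep p q)) as [|Hn]; auto. exfalso.
  apply (H ((Rmax (rx0 p) (rx0 q) + Rmin (rx1 p) (rx1 q)) / 2,
            (Rmax (ry0 p) (ry0 q) + Rmin (ry1 p) (ry1 q)) / 2)).
  unfold sep, in_open, valid_rect in *; simpl.
  unfold Rmax, Rmin. repeat destruct Rle_dec; lra.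
Qed.

Lemma HT_is_tiling c D : HT c D -> is_tiling (map c D).
Proof.
  intros H. split; [|split].
  - intros q Hq. apply in_map_iff in Hq. destruct Hq as [i [<- Hi]]. now apply H.
  - intros i j Hi Hj Hn p [P1 P2]. rewrite length_map in *.
    rewrite (nth_indep _ _ (c 0%nat)), map_nth in P1 by now rewrite length_map.
    rewrite (nth_indep _ _ (c 0%nat)), map_nth in P2 by now rewrite length_map.
    assert (I1 := nth_In D 0%nat Hi). assert (I2 := nth_In D 0%nat Hj).
    eapply open_sep; [| |exact P1| |]; try (apply H; [exact I1|exact I2|]); try now apply H.
    + unfold in_open, in_closed in *. lra.
    + intros E. apply Hn. eapply NoDup_nth; eauto. apply H.
  - intros p Hp. destruct (HT_closed_cover c D p H Hp) as [i [Hi H']].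
    exists (c i). split; auto. now apply in_map.
Qed.

Lemma is_tiling_HT T : is_tiling T -> HT (fun i => nth i T dummy_rect) (seq 0 (length T)).
Proof.
  intros [H1 [H2 H3]]. set (c := fun i => nth i T dummy_rect).
  assert (V : forall i, In i (seq 0 (length T)) -> valid_rect (c i)).
  { intros i Hi. apply in_seq in Hi. apply H1. apply nth_In. lia. }
  split; auto.
  - apply seq_NoDup.
  - intros x y Hx Hy.
    (* The closed tile is chosen at a point slightly to the left of and below [(x, y)], with no side
       coordinate strictly in between; it then contains [(x, y)] in the half-open sense. *)
    destruct (gap_below (sides c (seq 0 (length T))) x) as [lx [X1 X2]]; [lra|].
    destruct (gap_below (sides c (seq 0 (length T))) y) as [ly [Y1 Y2]]; [lra|].
    destruct (H3 ((lx + x) / 2, (ly + y) / 2)) as [q [Q1 [Q2 Q3]]]; [split; simpl; lra|].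
    simpl in *. destruct (In_nth T q dummy_rect Q1) as [i [I1 I2]].
    assert (Hi : In i (seq 0 (length T))) by (apply in_seq; lia).
    exists i. split; auto. destruct (in_sides c _ i Hi) as [S1 [S2 [S3 S4]]].
    replace q with (c i) in * by auto.
    generalize (X2 _ S2) (Y2 _ S4). unfold in_half. intros G1 G2.
    repeat split; try lra; apply Rnot_lt_le; intros L; lra.
  - intros i j Hi Hj Hn. apply not_sep_open; auto. intros z. apply in_seq in Hi, Hj.
    apply H2; auto; lia.
Qed.

(** The strict inequalities make the common part of the two sides a nondegenerate segment, the kind
    of segment that [preserves_hv] transports. The relation is symmetric and does not tell left from
    right. *)
Definition hadj (p q : rect) : Prop :=
  (rx1 p = rx0 q \/ rx1 q = rx0 p) /\ ry0 p < ry1 q /\ ry0 q < ry1 p.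
Definition vadj (p q : rect) : Prop :=
  (ry1 p = ry0 q \/ ry1 q = ry0 p) /\ rx0 p < rx1 q /\ rx0 q < rx1 p.

(** The combinatorial data from which a word is recovered; the right and top sides of the square
    tell where the reading starts. *)
Record adj_iso (c1 : nat -> rect) (D1 : list nat) (c2 : nat -> rect) (D2 : list nat)
    (phi : nat -> nat) : Prop := {
  ai_in : forall i, In i D1 -> In (phi i) D2;
  ai_inj : forall i j, In i D1 -> In j D1 -> phi i = phi j -> i = j;
  ai_surj : forall k, In k D2 -> exists i, In i D1 /\ phi i = k;
  ai_h : forall i j, In i D1 -> In j D1 ->
    (hadj (c1 i) (c1 j) <-> hadj (c2 (phi i)) (c2 (phi j)));
  ai_v : forall i j, In i D1 -> In j D1 ->
    (vadj (c1 i) (c1 j) <-> vadj (c2 (phi i)) (c2 (phi j)));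
  ai_right : forall i, In i D1 -> (rx1 (c1 i) = 1 <-> rx1 (c2 (phi i)) = 1);
  ai_top : forall i, In i D1 -> (ry1 (c1 i) = 1 <-> ry1 (c2 (phi i)) = 1) }.

Arguments ai_in {c1 D1 c2 D2 phi}.
Arguments ai_inj {c1 D1 c2 D2 phi}.
Arguments ai_surj {c1 D1 c2 D2 phi}.
Arguments ai_h {c1 D1 c2 D2 phi}.
Arguments ai_v {c1 D1 c2 D2 phi}.
Arguments ai_right {c1 D1 c2 D2 phi}.
Arguments ai_top {c1 D1 c2 D2 phi}.

(** * Images of tiles under an equivalence *)

(** A continuous function that is positive inside the tile, zero on its boundary and negative
    outside, made for the intermediate value theorem. *)
Definition margin (q : rect) (p : pt) : R :=
  Rmin (Rmin (fst p - rx0 q) (rx1 q - fst p)) (Rmin (snd p - ry0 q) (ry1 q - snd p)).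

Lemma margin_open q p : in_open q p <-> 0 < margin q p.
Proof. unfold margin, in_open, Rmin. repeat destruct Rle_dec; lra. Qed.

Lemma margin_closed q p : in_closed q p <-> 0 <= margin q p.
Proof. unfold margin, in_closed, Rmin. repeat destruct Rle_dec; lra. Qed.

(** Extends paths from [[0, 1]] to the whole line, as the intermediate value theorem used here asks
    for continuity everywhere. *)
Definition clamp (t : R) : R := Rmax 0 (Rmin 1 t).
Definition segment (u v : pt) (t : R) : pt :=
  (fst u + t * (fst v - fst u), snd u + t * (snd v - snd u)).

Lemma clamp_bound t : 0 <= clamp t <= 1.
Proof. unfold clamp, Rmax, Rmin. repeat destruct Rle_dec; lra. Qed.

Lemma clamp_id t : 0 <= t <= 1 -> clamp t = t.
Proof. intros H. unfold clamp, Rmax, Rmin. repeat destruct Rle_dec; lra. Qed.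

Lemma clamp_lip s t : Rabs (clamp s - clamp t) <= Rabs (s - t).
Proof.
  unfold clamp, Rmax, Rmin. repeat destruct Rle_dec; unfold Rabs;
    repeat destruct Rcase_abs; lra.
Qed.

Lemma segment_square u v t : in_square u -> in_square v -> in_square (segment u v (clamp t)).
Proof.
  generalize (clamp_bound t). unfold in_square, segment; simpl. intros. split; nra.
Qed.

Lemma path_cont (h : pt -> pt) u v t :
  cont_on_square h -> in_square u -> in_square v ->
  continuous (fun t => fst (h (segment u v (clamp t)))) t /\
  continuous (fun t => snd (h (segment u v (clamp t)))) t.
Proof.
  intros Hh Hu Hv.
  assert (K : forall eps, eps > 0 -> exists d, d > 0 /\ forall s, Rabs (s - t) < d ->
    dist2 (h (segment u v (clamp t))) (h (segment u v (clamp s))) < eps).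
  { intros eps He. destruct (Hh _ (segment_square u v t Hu Hv) eps He) as [d [D1 D2]].
    exists d. split; auto. intros s Hs. apply D2; [now apply segment_square|].
    assert (L : Rabs (clamp t - clamp s) < d).
    { rewrite Rabs_minus_sym. eapply Rle_lt_trans; [apply clamp_lip|exact Hs]. }
    apply dist2_lt. unfold segment; simpl. unfold in_square in *.
    split.
    - replace (_ - _) with ((clamp t - clamp s) * (fst v - fst u)) by ring.
      rewrite Rabs_mult. assert (Rabs (fst v - fst u) <= 1) by (apply Rabs_le; lra).
      generalize (Rabs_pos (clamp t - clamp s)) (Rabs_pos (fst v - fst u)). nra.
    - replace (_ - _) with ((clamp t - clamp s) * (snd v - snd u)) by ring.
      rewrite Rabs_mult. assert (Rabs (snd v - snd u) <= 1) by (apply Rabs_le; lra).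
      generalize (Rabs_pos (clamp t - clamp s)) (Rabs_pos (snd v - snd u)). nra. }
  split; intros P [eps HP]; destruct (K eps (cond_pos eps)) as [d [D1 D2]];
    exists (mkposreal d D1); intros s Hs; apply HP; specialize (D2 s Hs); apply dist2_lt in D2;
    simpl in *; [destruct D2 as [D2 _]|destruct D2 as [_ D2]];
    rewrite Rabs_minus_sym in D2; exact D2.
Qed.

Lemma path_margin_cont (h : pt -> pt) u v q t :
  cont_on_square h -> in_square u -> in_square v ->
  continuous (fun t => margin q (h (segment u v (clamp t)))) t.
Proof.
  intros Hh Hu Hv. destruct (path_cont h u v t Hh Hu Hv) as [C1 C2].
  unfold margin. apply cont_min; apply cont_min; apply cont_minus; auto; apply continuous_const.
Qed.

Lemma open_square c D i p : HT c D -> In i D -> in_open (c i) p -> in_square p.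
Proof. intros H Hi. destruct (ht_valid H i Hi). unfold in_open, in_square. lra. Qed.

Lemma closed_square c D i p : HT c D -> In i D -> in_closed (c i) p -> in_square p.
Proof. intros H Hi. destruct (ht_valid H i Hi). unfold in_closed, in_square. lra. Qed.

Lemma open_not_skeleton c D i p : HT c D -> In i D -> in_open (c i) p -> ~ skeleton (map c D) p.
Proof.
  intros H Hi Hp [q [Hq [H1 H2]]]. apply in_map_iff in Hq. destruct Hq as [j [<- Hj]].
  destruct (Nat.eq_dec i j) as [->|Hn]; [auto|].
  apply (open_sep (c i) (c j) p); auto; now apply H.
Qed.

Lemma open_inj c D i j p : HT c D -> In i D -> In j D -> in_open (c i) p -> in_closed (c j) p ->
  i = j.
Proof.
  intros H Hi Hj H1 H2. destruct (Nat.eq_dec i j) as [|Hn]; auto.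
  exfalso. apply (open_sep (c i) (c j) p); auto; now apply H.
Qed.

Section TileMap.
Variables (c1 c2 : nat -> rect) (D1 D2 : list nat) (h g : pt -> pt).
Hypothesis (H1 : HT c1 D1) (H2 : HT c2 D2).
Hypothesis Hhom : square_homeo h g.
Hypothesis Hsk : maps_onto h (skeleton (map c1 D1)) (skeleton (map c2 D2)).
Hypothesis Hhv : preserves_hv (map c1 D1) h.
Hypothesis Hcor : fixes_corners h.

Lemma not_skeleton_image p :
  in_square p -> ~ skeleton (map c1 D1) p -> ~ skeleton (map c2 D2) (h p).
Proof.
  destruct Hhom as [_ [_ [_ [_ [HG _]]]]]. intros Hp Hn Hs.
  destruct Hsk as [_ S]. destruct (S _ Hs) as [q [Hq E]]. apply Hn.
  replace p with q; auto. rewrite <- (HG p Hp), <- E. symmetry. apply HG.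
  eapply valid_skeleton_square; [|exact Hq]. intros r Hr. apply in_map_iff in Hr.
  destruct Hr as [i [<- Hi]]. now apply H1.
Qed.

(** Connectedness: along a segment from the centre of the tile, the [margin] of the image cannot
    vanish, since an open tile contains no point of the skeleton and hence none that maps to a
    boundary. *)
Lemma tile_image_exists i : In i D1 ->
  exists k, In k D2 /\ (forall p, in_open (c1 i) p -> in_open (c2 k) (h p)) /\
    (forall p, in_closed (c1 i) p -> in_closed (c2 k) (h p)).
Proof.
  intros Hi. destruct Hhom as [HC [_ [HS [_ [HG _]]]]].
  set (u := ((rx0 (c1 i) + rx1 (c1 i)) / 2, (ry0 (c1 i) + ry1 (c1 i)) / 2)).
  assert (V := ht_valid H1 i Hi). unfold valid_rect in V.
  assert (Hu : in_open (c1 i) u) by (unfold in_open, u; simpl; lra).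
  assert (Su : in_square u) by now apply (open_square c1 D1 i).
  destruct (HT_closed_cover c2 D2 (h u) H2 (HS u Su)) as [k [Hk Ck]].
  assert (Ok : in_open (c2 k) (h u)).
  { apply NNPP. intros Hn. apply (not_skeleton_image u Su).
    - now apply (open_not_skeleton c1 D1 i).
    - exists (c2 k). split; auto. now apply in_map. }
  exists k. split; auto.
  assert (OP : forall p, in_open (c1 i) p -> in_open (c2 k) (h p)).
  { intros p Hp. assert (Sp : in_square p) by now apply (open_square c1 D1 i).
    set (f := fun t => margin (c2 k) (h (segment u p (clamp t)))).
    assert (F0 : f 0 = margin (c2 k) (h u)).
    { unfold f. rewrite clamp_id by lra. unfold segment.
      rewrite !Rmult_0_l, !Rplus_0_r. now destruct u. }
    assert (F1 : f 1 = margin (c2 k) (h p)).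
    { unfold f. rewrite clamp_id by lra. unfold segment. do 2 f_equal.
      destruct p as [x y]. simpl. f_equal; ring. }
    assert (FN : forall t, f t <> 0).
    { intros t E.
      assert (Ot : in_open (c1 i) (segment u p (clamp t))).
      { generalize (clamp_bound t). unfold in_open, segment in *; simpl in *. intros. nra. }
      apply (not_skeleton_image (segment u p (clamp t))).
      - now apply segment_square.
      - now apply (open_not_skeleton c1 D1 i).
      - exists (c2 k). split; [now apply in_map|]. rewrite margin_open, margin_closed.
        fold (f t). rewrite E. lra. }
    apply margin_open in Ok. apply margin_open. rewrite <- F1. rewrite <- F0 in Ok.
    destruct (Rlt_le_dec 0 (f 1)) as [|L]; auto. exfalso.
    destruct (IVT_gen_consistent f 0 1 0) as [t [_ Ht]].
    - intros t. now apply path_margin_cont.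
    - rewrite Rmin_right, Rmax_left; lra.
    - now apply (FN t). }
  split; auto.
  (* On the segment from [p] to the centre all points after [p] are interior, so a negative [margin]
     at [p] would contradict continuity. *)
  intros p Hp. assert (Sp : in_square p) by now apply (closed_square c1 D1 i).
  set (f := fun t => margin (c2 k) (h (segment p u (clamp t)))).
  assert (F0 : f 0 = margin (c2 k) (h p)).
  { unfold f. rewrite clamp_id by lra. unfold segment.
    rewrite !Rmult_0_l, !Rplus_0_r. now destruct p. }
  assert (FP : forall t, 0 < t <= 1 -> 0 < f t).
  { intros t Ht. apply margin_open, OP. rewrite clamp_id by lra.
    unfold in_open, in_closed, segment in *; simpl in *. nra. }
  apply margin_closed. rewrite <- F0. destruct (Rle_lt_dec 0 (f 0)) as [|L]; auto. exfalso.
  destruct (IVT_gen_consistent f 0 1 (f 0 / 2)) as [t [T1 T2]].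
  - intros t. now apply path_margin_cont.
  - assert (0 < f 1) by (apply FP; lra). rewrite Rmin_left, Rmax_right; lra.
  - rewrite Rmin_left, Rmax_right in T1 by lra.
    destruct (Req_dec t 0) as [->|N]; [lra|]. assert (0 < f t) by (apply FP; lra). lra.
Qed.

Variable phi : nat -> nat.
Hypothesis Hphi : forall i, In i D1 -> In (phi i) D2 /\
  (forall p, in_open (c1 i) p -> in_open (c2 (phi i)) (h p)) /\
  (forall p, in_closed (c1 i) p -> in_closed (c2 (phi i)) (h p)).
Hypothesis Hinj : forall i j, In i D1 -> In j D1 -> phi i = phi j -> i = j.

(** The common part of the two sides is a vertical segment of the skeleton. Its image is vertical
    and lies in both image tiles, and separated tiles can share such a segment only along vertical
    sides. *)
Lemma image_hadj i j : In i D1 -> In j D1 -> hadj (c1 i) (c1 j) -> hadj (c2 (phi i)) (c2 (phi j)).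
Proof.
  intros Hi Hj [Hx Hy]. destruct (Hphi i Hi) as [I1 [_ I2]]. destruct (Hphi j Hj) as [J1 [_ J2]].
  assert (Vi := ht_valid H1 i Hi). assert (Vj := ht_valid H1 j Hj).
  unfold valid_rect in *.
  assert (N : phi i <> phi j) by (intros E; apply Hinj in E; auto; subst; lra).
  assert (S := ht_sep H2 _ _ I1 J1 N).
  set (x := if Req_dec_T (rx1 (c1 i)) (rx0 (c1 j)) then rx1 (c1 i) else rx0 (c1 i)).
  set (a := Rmax (ry0 (c1 i)) (ry0 (c1 j))). set (b := Rmin (ry1 (c1 i)) (ry1 (c1 j))).
  generalize (Rmax_l (ry0 (c1 i)) (ry0 (c1 j))) (Rmax_r (ry0 (c1 i)) (ry0 (c1 j)))
    (Rmin_l (ry1 (c1 i)) (ry1 (c1 j))) (Rmin_r (ry1 (c1 i)) (ry1 (c1 j))).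
  fold a b. intros A1 A2 B1 B2.
  assert (Hab : a < b) by (apply Rmax_lub_lt; apply Rmin_glb_lt; lra).
  assert (K : forall p, vseg x a b p ->
     in_closed (c1 i) p /\ in_closed (c1 j) p /\ ~ in_open (c1 i) p).
  { intros [u v] [E1 E2]; simpl in *. subst u. unfold in_closed, in_open; simpl.
    unfold x. destruct Req_dec_T; lra. }
  destruct Hhv as [_ HV]. destruct (HV x a b Hab) as [x' [a' [b' [Hab' [_ M]]]]].
  { intros p Hp. exists (c1 i). split; [now apply in_map|]. split; apply (K p Hp). }
  assert (L : forall y, a' <= y <= b' -> in_closed (c2 (phi i)) (x', y) /\
             in_closed (c2 (phi j)) (x', y)).
  { intros y Hyy. destruct (M (x', y)) as [p [Hp <-]]; [split; auto|].
    destruct (K p Hp) as [K1 [K2 _]]. auto. }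
  destruct (L a') as [L1 L2]; [lra|]. destruct (L b') as [L3 L4]; [lra|].
  unfold in_closed, sep, hadj in *. simpl in *. lra.
Qed.

Lemma image_vadj i j : In i D1 -> In j D1 -> vadj (c1 i) (c1 j) -> vadj (c2 (phi i)) (c2 (phi j)).
Proof.
  intros Hi Hj [Hx Hy]. destruct (Hphi i Hi) as [I1 [_ I2]]. destruct (Hphi j Hj) as [J1 [_ J2]].
  assert (Vi := ht_valid H1 i Hi). assert (Vj := ht_valid H1 j Hj).
  unfold valid_rect in *.
  assert (N : phi i <> phi j) by (intros E; apply Hinj in E; auto; subst; lra).
  assert (S := ht_sep H2 _ _ I1 J1 N).
  set (x := if Req_dec_T (ry1 (c1 i)) (ry0 (c1 j)) then ry1 (c1 i) else ry0 (c1 i)).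
  set (a := Rmax (rx0 (c1 i)) (rx0 (c1 j))). set (b := Rmin (rx1 (c1 i)) (rx1 (c1 j))).
  generalize (Rmax_l (rx0 (c1 i)) (rx0 (c1 j))) (Rmax_r (rx0 (c1 i)) (rx0 (c1 j)))
    (Rmin_l (rx1 (c1 i)) (rx1 (c1 j))) (Rmin_r (rx1 (c1 i)) (rx1 (c1 j))).
  fold a b. intros A1 A2 B1 B2.
  assert (Hab : a < b) by (apply Rmax_lub_lt; apply Rmin_glb_lt; lra).
  assert (K : forall p, hseg a b x p ->
     in_closed (c1 i) p /\ in_closed (c1 j) p /\ ~ in_open (c1 i) p).
  { intros [u v] [E1 E2]; simpl in *. subst v. unfold in_closed, in_open; simpl.
    unfold x. destruct Req_dec_T; lra. }
  destruct Hhv as [HV _]. destruct (HV a b x Hab) as [a' [b' [x' [Hab' [_ M]]]]].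
  { intros p Hp. exists (c1 i). split; [now apply in_map|]. split; apply (K p Hp). }
  assert (L : forall y, a' <= y <= b' -> in_closed (c2 (phi i)) (y, x') /\
             in_closed (c2 (phi j)) (y, x')).
  { intros y Hyy. destruct (M (y, x')) as [p [Hp <-]]; [split; auto|].
    destruct (K p Hp) as [K1 [K2 _]]. auto. }
  destruct (L a') as [L1 L2]; [lra|]. destruct (L b') as [L3 L4]; [lra|].
  unfold in_closed, sep, vadj in *. simpl in *. lra.
Qed.

(** The right side of the square belongs to the skeleton; its image is a vertical segment through
    the fixed corner [(1, 0)], so it stays at abscissa 1. *)
Lemma image_right i : In i D1 -> rx1 (c1 i) = 1 -> rx1 (c2 (phi i)) = 1.
Proof.
  intros Hi Hr. destruct (Hphi i Hi) as [I1 [_ I2]].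
  destruct Hhv as [_ HV]. destruct (HV 1 0 1) as [x [a [b [Hab [M _]]]]]; [lra| |].
  { intros [u v] [E1 E2]; simpl in *; subst u.
    destruct (HT_closed_cover c1 D1 (1, v) H1) as [j [Hj Cj]]; [split; simpl; lra|].
    exists (c1 j). split; [now apply in_map|]. split; auto.
    generalize (ht_valid H1 j Hj). unfold valid_rect, in_open; simpl. lra. }
  assert (Hx : x = 1).
  { destruct (M (1, 0)) as [E _]; [split; simpl; lra|].
    destruct Hcor as [_ [C _]]. rewrite C in E. now simpl in E. }
  subst x. generalize (ht_valid H1 i Hi) (ht_valid H2 _ I1). unfold valid_rect. intros V V'.
  destruct (M (1, ry0 (c1 i))) as [E _]; [split; simpl; lra|].
  assert (Ci : in_closed (c1 i) (1, ry0 (c1 i))) by (unfold in_closed; simpl; lra).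
  apply I2 in Ci. unfold in_closed in Ci. lra.
Qed.

Lemma image_top i : In i D1 -> ry1 (c1 i) = 1 -> ry1 (c2 (phi i)) = 1.
Proof.
  intros Hi Hr. destruct (Hphi i Hi) as [I1 [_ I2]].
  destruct Hhv as [HV _]. destruct (HV 0 1 1) as [a [b [x [Hab [M _]]]]]; [lra| |].
  { intros [u v] [E1 E2]; simpl in *; subst v.
    destruct (HT_closed_cover c1 D1 (u, 1) H1) as [j [Hj Cj]]; [split; simpl; lra|].
    exists (c1 j). split; [now apply in_map|]. split; auto.
    generalize (ht_valid H1 j Hj). unfold valid_rect, in_open; simpl. lra. }
  assert (Hx : x = 1).
  { destruct (M (0, 1)) as [_ E]; [split; simpl; lra|].
    destruct Hcor as [_ [_ [C _]]]. rewrite C in E. now simpl in E. }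
  subst x. generalize (ht_valid H1 i Hi) (ht_valid H2 _ I1). unfold valid_rect. intros V V'.
  destruct (M (rx0 (c1 i), 1)) as [_ E]; [split; simpl; lra|].
  assert (Ci : in_closed (c1 i) (rx0 (c1 i), 1)) by (unfold in_closed; simpl; lra).
  apply I2 in Ci. unfold in_closed in Ci. lra.
Qed.
End TileMap.

(** The two homeomorphisms induce maps between the tiles, mutually inverse because the centre of a
    tile returns to itself. Hence each implication proved above, applied in both directions, gives
    an equivalence. *)
Lemma comb_equiv_adj_iso c1 D1 c2 D2 :
  HT c1 D1 -> HT c2 D2 -> comb_equiv (map c1 D1) (map c2 D2) ->
  exists phi, adj_iso c1 D1 c2 D2 phi.
Proof.
  intros H1 H2 [h [g [Hh [Hc [Hs [V1 V2]]]]]].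
  assert (Hg : square_homeo g h) by (unfold square_homeo in *; tauto).
  assert (Q00 : in_square (0, 0)) by (split; simpl; lra).
  assert (Q01 : in_square (0, 1)) by (split; simpl; lra).
  assert (Q10 : in_square (1, 0)) by (split; simpl; lra).
  assert (Q11 : in_square (1, 1)) by (split; simpl; lra).
  assert (Hc' : fixes_corners g).
  { destruct Hc as [C1 [C2 [C3 C4]]]. destruct Hh as [_ [_ [_ [_ [G _]]]]].
    unfold fixes_corners. rewrite <- C1 at 1. rewrite <- C2 at 1. rewrite <- C3 at 1.
    rewrite <- C4 at 1. now rewrite !G. }
  assert (Hs' : maps_onto g (skeleton (map c2 D2)) (skeleton (map c1 D1))).
  { destruct Hh as [_ [_ [_ [_ [G _]]]]]. destruct Hs as [S1 S2].
    assert (SQ : forall p, skeleton (map c1 D1) p -> in_square p).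
    { intros p. apply valid_skeleton_square. intros q Hq. apply in_map_iff in Hq.
      destruct Hq as [i [<- Hi]]. now apply H1. }
    split.
    - intros p Hp. destruct (S2 p Hp) as [q [Hq <-]]. rewrite G; auto.
    - intros p Hp. exists (h p). split; auto. }
  assert (EX : forall (c1 c2 : nat -> rect) D1 D2 h g, HT c1 D1 -> HT c2 D2 -> square_homeo h g ->
    maps_onto h (skeleton (map c1 D1)) (skeleton (map c2 D2)) ->
    exists phi : nat -> nat, forall i, In i D1 -> In (phi i) D2 /\
      (forall p, in_open (c1 i) p -> in_open (c2 (phi i)) (h p)) /\
      (forall p, in_closed (c1 i) p -> in_closed (c2 (phi i)) (h p))).
  { clear. intros c1 c2 D1 D2 h g H1 H2 Hh Hs.
    apply (choice (fun i k => In i D1 -> In k D2 /\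
      (forall p, in_open (c1 i) p -> in_open (c2 k) (h p)) /\
      (forall p, in_closed (c1 i) p -> in_closed (c2 k) (h p)))).
    intros i. destruct (classic (In i D1)) as [Hi|Hi]; [|exists 0%nat; tauto].
    destruct (tile_image_exists c1 c2 D1 D2 h g H1 H2 Hh Hs i Hi) as [k Hk]. exists k. tauto. }
  destruct (EX c1 c2 D1 D2 h g) as [phi HF]; auto.
  destruct (EX c2 c1 D2 D1 g h) as [psi HP]; auto.
  assert (PF : forall c1 c2 D1 D2 (h g : pt -> pt) (phi psi : nat -> nat),
    HT c1 D1 -> square_homeo h g ->
    (forall i, In i D1 -> In (phi i) D2 /\
      (forall p, in_open (c1 i) p -> in_open (c2 (phi i)) (h p)) /\
      (forall p, in_closed (c1 i) p -> in_closed (c2 (phi i)) (h p))) ->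
    (forall i, In i D2 -> In (psi i) D1 /\
      (forall p, in_open (c2 i) p -> in_open (c1 (psi i)) (g p)) /\
      (forall p, in_closed (c2 i) p -> in_closed (c1 (psi i)) (g p))) ->
    forall i, In i D1 -> psi (phi i) = i).
  { clear. intros c1 c2 D1 D2 h g phi psi H1 Hh HF HP i Hi.
    destruct (HF i Hi) as [I1 [I2 _]]. destruct (HP _ I1) as [J1 [J2 _]].
    set (u := ((rx0 (c1 i) + rx1 (c1 i)) / 2, (ry0 (c1 i) + ry1 (c1 i)) / 2)).
    assert (V := ht_valid H1 i Hi). unfold valid_rect in V.
    assert (Hu : in_open (c1 i) u) by (unfold in_open, u; simpl; lra).
    specialize (J2 _ (I2 _ Hu)). destruct Hh as [_ [_ [_ [_ [G _]]]]].
    rewrite G in J2 by now apply (open_square c1 D1 i).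
    apply (open_inj c1 D1 _ _ u); auto. unfold in_open, in_closed in *. lra. }
  assert (PF1 := PF c1 c2 D1 D2 h g phi psi H1 Hh HF HP).
  assert (PF2 := PF c2 c1 D2 D1 g h psi phi H2 Hg HP HF).
  assert (J1 : forall i j, In i D1 -> In j D1 -> phi i = phi j -> i = j).
  { intros i j Hi Hj E. rewrite <- (PF1 i Hi), <- (PF1 j Hj). now rewrite E. }
  assert (J2 : forall i j, In i D2 -> In j D2 -> psi i = psi j -> i = j).
  { intros i j Hi Hj E. rewrite <- (PF2 i Hi), <- (PF2 j Hj). now rewrite E. }
  exists phi. split; auto.
  - intros i Hi. now apply HF.
  - intros k Hk. exists (psi k). split; auto. now apply HP.
  - intros i j Hi Hj. split; [now apply (image_hadj c1 c2 D1 D2 h)|].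
    intros H. rewrite <- (PF1 i Hi), <- (PF1 j Hj).
    apply (image_hadj c2 c1 D2 D1 g); auto; now apply HF.
  - intros i j Hi Hj. split; [now apply (image_vadj c1 c2 D1 D2 h)|].
    intros H. rewrite <- (PF1 i Hi), <- (PF1 j Hj).
    apply (image_vadj c2 c1 D2 D1 g); auto; now apply HF.
  - intros i Hi. split; [now apply (image_right c1 c2 D1 D2 h)|].
    intros H. rewrite <- (PF1 i Hi).
    apply (image_right c2 c1 D2 D1 g); auto; now apply HF.
  - intros i Hi. split; [now apply (image_top c1 c2 D1 D2 h)|].
    intros H. rewrite <- (PF1 i Hi).
    apply (image_top c2 c1 D2 D1 g); auto; now apply HF.
Qed.

(** * Stacks of tiles *)

Lemma NoDup_app_iff {A : Type} (l1 l2 : list A) :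
  NoDup (l1 ++ l2) <-> NoDup l1 /\ NoDup l2 /\ (forall x, In x l1 -> ~ In x l2).
Proof.
  induction l1 as [|a l1 IH]; simpl.
  - split; [intros H; repeat split; auto; constructor|tauto].
  - rewrite !NoDup_cons_iff, IH, in_app_iff. split.
    + intros [H1 [H2 [H3 H4]]]. repeat split; auto. intros x [<-|Hx]; auto.
    + intros [[H1 H2] [H3 H4]]. repeat split; auto. intros [H|H]; auto. apply (H4 a); auto.
Qed.

Fixpoint chain (c : nat -> rect) (l : list nat) (hi lo : R) : Prop :=
  match l with
  | [] => hi = lo
  | i :: l => ry1 (c i) = hi /\ ry0 (c i) < hi /\ chain c l (ry0 (c i)) lo
  end.

Lemma chain_app c l1 l2 hi lo :
  chain c (l1 ++ l2) hi lo <-> exists mid, chain c l1 hi mid /\ chain c l2 mid lo.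
Proof.
  revert hi. induction l1 as [|i l1 IH]; intros hi; simpl.
  - split; [intros H; now exists hi|]. intros [mid [-> H]]. exact H.
  - split.
    + intros [H1 [H2 H3]]. apply IH in H3. destruct H3 as [mid [H3 H4]]. now exists mid.
    + intros [mid [[H1 [H2 H3]] H4]]. repeat split; auto. apply IH. eauto.
Qed.

Lemma chain_le c l hi lo : chain c l hi lo -> lo <= hi.
Proof.
  revert hi. induction l as [|i l IH]; intros hi; simpl; [lra|].
  intros [H1 [H2 H3]]. apply IH in H3. lra.
Qed.

Lemma chain_lt c l hi lo : l <> [] -> chain c l hi lo -> lo < hi.
Proof.
  destruct l as [|i l]; [easy|]. intros _ [H1 [H2 H3]]. apply chain_le in H3. lra.
Qed.

Lemma chain_ext c c' l hi lo :
  (forall i, In i l -> ry0 (c i) = ry0 (c' i) /\ ry1 (c i) = ry1 (c' i)) ->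
  chain c l hi lo -> chain c' l hi lo.
Proof.
  revert hi. induction l as [|i l IH]; intros hi H; simpl; auto.
  destruct (H i) as [-> ->]; [now left|]. intros [H1 [H2 H3]]. repeat split; auto.
  apply IH; auto. intros j Hj. apply H. now right.
Qed.

Lemma chain_in c l hi lo i : chain c l hi lo -> In i l ->
  lo <= ry0 (c i) /\ ry0 (c i) < ry1 (c i) /\ ry1 (c i) <= hi.
Proof.
  revert hi. induction l as [|j l IH]; intros hi; simpl; [easy|].
  intros [H1 [H2 H3]] [->|Hi].
  - apply chain_le in H3. lra.
  - destruct (IH _ H3 Hi). lra.
Qed.

Arguments chain_in {c l hi lo i}.

Lemma chain_cover c l hi lo y : chain c l hi lo -> lo < y <= hi ->
  exists i, In i l /\ ry0 (c i) < y <= ry1 (c i).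
Proof.
  revert hi. induction l as [|j l IH]; intros hi; simpl; [lra|].
  intros [H1 [H2 H3]] Hy. destruct (Rlt_dec (ry0 (c j)) y).
  - exists j. split; auto. lra.
  - destruct (IH _ H3) as [i [I1 I2]]; [lra|]. eauto.
Qed.

Lemma chain_sep c l hi lo i j : chain c l hi lo -> In i l -> In j l -> i <> j ->
  ry1 (c i) <= ry0 (c j) \/ ry1 (c j) <= ry0 (c i).
Proof.
  revert hi. induction l as [|k l IH]; intros hi; simpl; [easy|].
  intros [H1 [H2 H3]] [->|Hi] [->|Hj] Hn; try easy.
  - right. now apply (chain_in H3).
  - left. now apply (chain_in H3).
  - eauto.
Qed.

Arguments chain_sep {c l hi lo i j}.

Lemma chain_NoDup c l hi lo : chain c l hi lo -> NoDup l.
Proof.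
  revert hi. induction l as [|i l IH]; intros hi; simpl; [constructor|].
  intros [H1 [H2 H3]]. constructor; eauto.
  intros Hi. apply (chain_in H3) in Hi. lra.
Qed.

(** * Interleaving patterns of two stacks *)

Inductive letter := EL | ER | EB.

(* [Pat c L N p]: [p] is the word of ends (from top to bottom) of the intervals of two
   stacks [L], [N] covering the same interval: [EL] for an end in [L] only, [ER] for an
   end in [N] only, [EB] for a common end, i.e. a singular vertex. *)
Inductive Pat (c : nat -> rect) : list nat -> list nat -> list letter -> Prop :=
| Pat0 l n : ry0 (c l) = ry0 (c n) -> Pat c [l] [n] []
| PatL l l' ls n ns p : ry0 (c n) < ry0 (c l) -> ry1 (c l') = ry0 (c l) ->
    Pat c (l' :: ls) (n :: ns) p -> Pat c (l :: l' :: ls) (n :: ns) (EL :: p)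
| PatR l ls n n' ns p : ry0 (c l) < ry0 (c n) -> ry1 (c n') = ry0 (c n) ->
    Pat c (l :: ls) (n' :: ns) p -> Pat c (l :: ls) (n :: n' :: ns) (ER :: p)
| PatB l l' ls n n' ns p : ry0 (c l) = ry0 (c n) -> ry1 (c l') = ry0 (c l) ->
    ry1 (c n') = ry0 (c n) ->
    Pat c (l' :: ls) (n' :: ns) p -> Pat c (l :: l' :: ls) (n :: n' :: ns) (EB :: p).

Fixpoint nL (p : list letter) : nat :=
  match p with [] => 0 | EL :: p => S (nL p) | _ :: p => nL p end.
Fixpoint nR (p : list letter) : nat :=
  match p with [] => 0 | ER :: p => S (nR p) | _ :: p => nR p end.
Fixpoint nB (p : list letter) : nat :=
  match p with [] => 0 | EB :: p => S (nB p) | _ :: p => nB p end.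
(** A stack has one tile more than it has ends strictly inside its interval. *)
Definition lefts (p : list letter) : nat := S (nL p + nB p).
Definition rights (p : list letter) : nat := S (nR p + nB p).

Lemma Pat_length c L N p : Pat c L N p -> length L = lefts p /\ length N = rights p.
Proof.
  unfold lefts, rights. induction 1; simpl in *; lia.
Qed.

Arguments Pat_length {c L N p}.

Lemma Pat_ext c c' L N p :
  (forall i, In i (L ++ N) -> ry0 (c i) = ry0 (c' i) /\ ry1 (c i) = ry1 (c' i)) ->
  Pat c L N p -> Pat c' L N p.
Proof.
  intros H P. induction P as [l n E|l l' ls n ns p E1 E2 P IH|l ls n n' ns p E1 E2 P IH
    |l l' ls n n' ns p E1 E2 E3 P IH].
  - destruct (H l) as [A1 A2]; [simpl; auto|]. destruct (H n) as [B1 B2]; [simpl; auto|].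
    constructor. lra.
  - destruct (H l) as [A1 A2]; [simpl; auto|].
    destruct (H l') as [C1 C2]; [simpl; auto|].
    destruct (H n) as [B1 B2]; [simpl; rewrite in_app_iff; simpl; auto|].
    constructor; try lra.
    apply IH. intros i Hi. apply H. now right.
  - destruct (H l) as [A1 A2]; [simpl; auto|].
    destruct (H n) as [B1 B2]; [rewrite in_app_iff; simpl; auto|].
    destruct (H n') as [C1 C2]; [rewrite in_app_iff; simpl; auto|].
    constructor; try lra.
    apply IH. intros i Hi. apply H. rewrite in_app_iff in *. simpl in *. tauto.
  - destruct (H l) as [A1 A2]; [simpl; auto|].
    destruct (H l') as [F1 F2]; [simpl; auto|].
    destruct (H n) as [B1 B2]; [rewrite in_app_iff; simpl; auto|].
    destruct (H n') as [C1 C2]; [rewrite in_app_iff; simpl; auto|].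
    constructor; try lra.
    apply IH. intros i Hi. apply H. simpl. right. rewrite in_app_iff in *. simpl in *. tauto.
Qed.

Lemma Pat_reindex (f : nat -> nat) c c' L N p :
  (forall i, In i (L ++ N) -> ry0 (c (f i)) = ry0 (c' i) /\ ry1 (c (f i)) = ry1 (c' i)) ->
  Pat c (map f L) (map f N) p -> Pat c' L N p.
Proof.
  intros H P. apply (Pat_ext (fun i => c (f i))); auto.
  clear H. remember (map f L) as L0. remember (map f N) as N0.
  revert L N HeqL0 HeqN0.
  induction P as [l n E|l l' ls n ns p E1 E2 P IH|l ls n n' ns p E1 E2 P IH
    |l l' ls n n' ns p E1 E2 E3 P IH]; intros L N EL0 EN0.
  - destruct L as [|l0 [|]]; try discriminate. destruct N as [|n0 [|]]; try discriminate.
    simpl in *. constructor. congruence.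
  - destruct L as [|l0 [|l1 L]]; try discriminate. destruct N as [|n0 N]; try discriminate.
    injection EL0 as -> -> EL0. injection EN0 as -> EN0.
    constructor; auto. apply IH; simpl; congruence.
  - destruct L as [|l0 L]; try discriminate. destruct N as [|n0 [|n1 N]]; try discriminate.
    injection EL0 as -> EL0. injection EN0 as -> -> EN0.
    constructor; auto. apply IH; simpl; congruence.
  - destruct L as [|l0 [|l1 L]]; try discriminate. destruct N as [|n0 [|n1 N]]; try discriminate.
    injection EL0 as -> -> EL0. injection EN0 as -> -> EN0.
    constructor; auto. apply IH; simpl; congruence.
Qed.

(** A merge of the two decreasing sequences of lower ends. The tops may differ because a step of the
    merge can shorten one stack only. *)
Lemma Pat_exists c L N hi hi' lo :
  L <> [] -> N <> [] -> chain c L hi lo -> chain c N hi' lo ->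
  exists p, Pat c L N p.
Proof.
  remember (length L + length N)%nat as k. assert (Hk : (length L + length N <= k)%nat) by lia.
  clear Heqk. revert L N hi hi' Hk.
  induction k as [|k IH]; intros L N hi hi' Hk HL HN CL CN.
  { destruct L; simpl in *; [easy|lia]. }
  destruct L as [|l L]; [easy|]. destruct N as [|n N]; [easy|]. clear HL HN.
  simpl in Hk. destruct CL as [L1 [L2 L3]]. destruct CN as [N1 [N2 N3]].
  destruct (Rtotal_order (ry0 (c l)) (ry0 (c n))) as [E|[E|E]].
  - destruct N as [|n' N].
    + simpl in N3. apply chain_le in L3. lra.
    + destruct (IH (l :: L) (n' :: N) (ry1 (c l)) (ry1 (c n'))) as [p Hp]; simpl in *; try easy;
        try lia.
      * repeat split; auto. lra.
      * repeat split; try apply N3. destruct N3 as [-> [? _]]. lra.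
      * exists (ER :: p). constructor; auto. now destruct N3.
  - destruct L as [|l' L], N as [|n' N].
    + exists []. now constructor.
    + simpl in L3. rewrite E in L3. apply chain_lt in N3; [lra|easy].
    + simpl in N3. rewrite <- E in N3. apply chain_lt in L3; [lra|easy].
    + destruct (IH (l' :: L) (n' :: N) (ry0 (c l)) (ry0 (c n))) as [p Hp]; simpl in *; try easy;
        try lia.
      exists (EB :: p). constructor; auto; [now destruct L3|now destruct N3].
  - destruct L as [|l' L].
    + simpl in L3. apply chain_le in N3. lra.
    + destruct (IH (l' :: L) (n :: N) (ry0 (c l)) (ry1 (c n))) as [p Hp]; simpl in *; try easy;
        try lia.
      * repeat split; auto. lra.
      * exists (EL :: p). constructor; auto. now destruct L3.
Qed.

Definition same_order (x y x' y' : R) : Prop :=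
  (x < y -> x' < y') /\ (x = y -> x' = y') /\ (y < x -> y' < x').

Lemma Pat_order c1 c2 L N p h1 h2 k1 k2 lo1 lo2 :
  Pat c1 L N p -> Pat c2 L N p ->
  chain c1 L h1 lo1 -> chain c1 N k1 lo1 -> chain c2 L h2 lo2 -> chain c2 N k2 lo2 ->
  lo1 < h1 -> lo1 < k1 -> lo2 < h2 -> lo2 < k2 ->
  (forall l n L' N', L = l :: L' -> N = n :: N' -> ry0 (c1 l) < k1 /\ ry0 (c2 l) < k2 /\
     ry0 (c1 n) < h1 /\ ry0 (c2 n) < h2) ->
  same_order h1 k1 h2 k2 ->
  forall l n al be, In l L -> In n N ->
    same_order (sidey (c1 l) al) (sidey (c1 n) be) (sidey (c2 l) al) (sidey (c2 n) be).
Proof.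
  intros P1. revert h1 h2 k1 k2.
  assert (SO : forall x y x' y', (x < y /\ x' < y') \/ (y < x /\ y' < x') \/ (x = y /\ x' = y') ->
    same_order x y x' y') by (unfold same_order; intros; lra).
  induction P1 as [l n E|l l' ls n ns p E1 E2 P1 IH|l ls n n' ns p E1 E2 P1 IH
    |l l' ls n n' ns p E1 E2 E3 P1 IH]; intros h1 h2 k1 k2 P2 A1 B1 A2 B2 X1 X2 X3 X4 HO HS;
    inversion P2; subst; clear P2;
    destruct (HO _ _ _ _ eq_refl eq_refl) as [O1 [O2 [O3 O4]]]; clear HO.
  - intros ? ? al be [<-|[]] [<-|[]]. simpl in *.
    destruct A1 as [A1 [? ?]], A2 as [A2 [? ?]], B1 as [B1 [? ?]], B2 as [B2 [? ?]].
    destruct al, be; simpl; rewrite ?A1, ?A2, ?B1, ?B2; auto; apply SO; lra.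
  - destruct A1 as [A1 [A1' A1'']], A2 as [A2 [A2' A2'']].
    assert (B1c := B1). assert (B2c := B2).
    destruct B1 as [B1 [B1' B1'']], B2 as [B2 [B2' B2'']].
    assert (C1 := A1''). assert (C2 := A2'').
    destruct C1 as [C1 [C1' _]], C2 as [C2 [C2' _]].
    assert (lo1 < ry0 (c1 l)) by (eapply chain_lt; [|exact A1'']; easy).
    assert (lo2 < ry0 (c2 l)) by (eapply chain_lt; [|exact A2'']; easy).
    assert (IH' := IH (ry0 (c1 l)) (ry0 (c2 l)) k1 k2 ltac:(assumption) A1'' B1c A2'' B2c).
    intros i j al be Hi Hj. destruct Hi as [<-|Hi].
    + destruct Hj as [<-|Hj].
      * destruct al, be; simpl; rewrite ?A1, ?A2, ?B1, ?B2; auto; apply SO; lra.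
      * generalize (chain_in B1'' Hj) (chain_in B2'' Hj). intros.
        destruct al, be; simpl; apply SO; lra.
    + apply IH'; auto; try lra; try (apply SO; lra).
      intros ? ? ? ? Q1 Q2. injection Q1 as <- <-. injection Q2 as <- <-. lra.
  - assert (A1c := A1). assert (A2c := A2).
    destruct A1 as [A1 [A1' A1'']], A2 as [A2 [A2' A2'']].
    destruct B1 as [B1 [B1' B1'']], B2 as [B2 [B2' B2'']].
    assert (C1 := B1''). assert (C2 := B2'').
    destruct C1 as [C1 [C1' _]], C2 as [C2 [C2' _]].
    assert (lo1 < ry0 (c1 n)) by (eapply chain_lt; [|exact B1'']; easy).
    assert (lo2 < ry0 (c2 n)) by (eapply chain_lt; [|exact B2'']; easy).
    assert (IH' := IH h1 h2 (ry0 (c1 n)) (ry0 (c2 n)) ltac:(assumption) A1c B1'' A2c B2'').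
    intros i j al be Hi Hj. destruct Hj as [<-|Hj].
    + destruct Hi as [<-|Hi].
      * destruct al, be; simpl; rewrite ?A1, ?A2, ?B1, ?B2; auto; apply SO; lra.
      * generalize (chain_in A1'' Hi) (chain_in A2'' Hi). intros.
        destruct al, be; simpl; apply SO; lra.
    + apply IH'; auto; try lra; try (apply SO; lra).
      intros ? ? ? ? Q1 Q2. injection Q1 as <- <-. injection Q2 as <- <-. lra.
  - destruct A1 as [A1 [A1' A1'']], A2 as [A2 [A2' A2'']].
    destruct B1 as [B1 [B1' B1'']], B2 as [B2 [B2' B2'']].
    assert (C1 := B1''). assert (C2 := B2'').
    destruct C1 as [C1 [C1' _]], C2 as [C2 [C2' _]].
    assert (C3 := A1''). assert (C4 := A2'').
    destruct C3 as [C3 [C3' _]], C4 as [C4 [C4' _]].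
    assert (lo1 < ry0 (c1 n)) by (eapply chain_lt; [|exact B1'']; easy).
    assert (lo2 < ry0 (c2 n)) by (eapply chain_lt; [|exact B2'']; easy).
    assert (IH' := IH (ry0 (c1 l)) (ry0 (c2 l)) (ry0 (c1 n)) (ry0 (c2 n)) ltac:(assumption)
       A1'' B1'' A2'' B2'').
    assert (IH2 : forall i j al be, In i (l' :: ls) -> In j (n' :: ns) ->
      same_order (sidey (c1 i) al) (sidey (c1 j) be) (sidey (c2 i) al) (sidey (c2 j) be)).
    { apply IH'; auto; try lra; try (apply SO; lra).
      intros ? ? ? ? Q1 Q2. injection Q1 as <- <-. injection Q2 as <- <-. lra. }
    intros i j al be Hi Hj. destruct Hj as [<-|Hj], Hi as [<-|Hi].
    + destruct al, be; simpl; rewrite ?A1, ?A2, ?B1, ?B2; auto; apply SO; lra.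
    + generalize (chain_in A1'' Hi) (chain_in A2'' Hi). intros.
      assert (Q := IH2 i n' al true Hi (or_introl eq_refl)). simpl in Q.
      rewrite C1, C2 in Q. destruct be; [|exact Q].
      destruct al; simpl; apply SO; lra.
    + generalize (chain_in B1'' Hj) (chain_in B2'' Hj). intros.
      assert (Q := IH2 l' j true be (or_introl eq_refl) Hj). simpl in Q.
      rewrite C3, C4 in Q. destruct al; [|exact Q].
      destruct be; simpl; apply SO; lra.
    + now apply IH2.
Qed.

(** * Adding a block *)

(* [F] lists from top to bottom the tiles touching the right side. *)
Record Front (c : nat -> rect) (D F : list nat) : Prop := {
  fr_in : forall i, In i F -> In i D;
  fr_right : forall i, In i D -> (rx1 (c i) = 1 <-> In i F);
  fr_chain : chain c F 1 0 }.

(* The tiling [c] arises from [cb] by pushing the right tiles [L] back to the abscissa [a]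
   and filling the gap with a stack [N] of new tiles. *)
Record Step (cb c : nat -> rect) (Db A L C N : list nat) (p : list letter) (a hi lo : R)
  : Prop := {
  st_old : forall i, In i Db -> ~ In i L -> c i = cb i;
  st_left : forall i, In i L ->
    c i = Rect (rx0 (cb i)) a (ry0 (cb i)) (ry1 (cb i)) /\ rx0 (cb i) < a;
  st_a : a < 1;
  st_new : forall i, In i N -> rx0 (c i) = a /\ rx1 (c i) = 1;
  st_above : forall A' z, A = A' ++ [z] -> rx0 (cb z) < a;
  st_below : forall z C', C = z :: C' -> rx0 (cb z) < a;
  st_chainA : chain cb A 1 hi;
  st_chainL : chain cb L hi lo;
  st_chainC : chain cb C lo 0;
  st_chainN : chain c N hi lo;
  st_pat : Pat c L N p }.

Arguments fr_in {c D F}.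
Arguments fr_right {c D F}.
Arguments fr_chain {c D F}.
Arguments st_old {cb c Db A L C N p a hi lo}.
Arguments st_left {cb c Db A L C N p a hi lo}.
Arguments st_a {cb c Db A L C N p a hi lo}.
Arguments st_new {cb c Db A L C N p a hi lo}.
Arguments st_above {cb c Db A L C N p a hi lo}.
Arguments st_below {cb c Db A L C N p a hi lo}.
Arguments st_chainA {cb c Db A L C N p a hi lo}.
Arguments st_chainL {cb c Db A L C N p a hi lo}.
Arguments st_chainC {cb c Db A L C N p a hi lo}.
Arguments st_chainN {cb c Db A L C N p a hi lo}.
Arguments st_pat {cb c Db A L C N p a hi lo}.

Lemma nonempty_In {T : Type} (l : list T) : l <> [] -> exists x, In x l.
Proof. destruct l as [|x l]; [easy|]. intros _. exists x. now left. Qed.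

Lemma Front_NoDup c D F : Front c D F -> NoDup F.
Proof. intros H. eapply chain_NoDup. apply H. Qed.

Arguments Front_NoDup {c D F}.

Lemma chain_last c l i h m : chain c (l ++ [i]) h m -> ry0 (c i) = m.
Proof. intros H. apply chain_app in H. destruct H as [m' [_ [_ [_ H]]]]. exact H. Qed.

Section StepFacts.
Variables (cb c : nat -> rect) (Db A L C N : list nat) (p : list letter) (a hi lo : R).
Hypothesis HS : Step cb c Db A L C N p a hi lo.
Hypothesis Hb : HT cb Db.
Hypothesis Fb : Front cb Db (A ++ L ++ C).
Hypothesis HN : forall i, In i N -> ~ In i Db.
#[local] Set Default Proof Using "HS Hb Fb HN".

Lemma step_L_nonempty : L <> [] /\ N <> [].
Proof. destruct (st_pat HS); easy. Qed.

Lemma step_lt : lo < hi.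
Proof. eapply chain_lt; [|apply HS]. apply step_L_nonempty. Qed.

Lemma step_bounds : 0 <= lo /\ hi <= 1.
Proof.
  split; [eapply chain_le; apply HS|eapply chain_le; apply HS].
Qed.

Lemma step_in_Db i : In i A \/ In i L \/ In i C -> In i Db.
Proof. intros H. apply (fr_in Fb). rewrite !in_app_iff. exact H. Qed.

Lemma step_disj i : (In i A -> In i L -> False) /\ (In i L -> In i C -> False) /\
  (In i A -> In i C -> False).
Proof.
  assert (ND := Front_NoDup Fb). apply NoDup_app_iff in ND.
  destruct ND as [_ [ND D1]]. apply NoDup_app_iff in ND. destruct ND as [_ [_ D2]].
  split; [|split]; intros H1 H2.
  - apply (D1 i H1). apply in_or_app. auto.
  - now apply (D2 i H1).
  - apply (D1 i H1). apply in_or_app. auto.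
Qed.

Lemma step_a_pos : 0 < a.
Proof.
  destruct (nonempty_In L) as [l HL]; [apply step_L_nonempty|].
  destruct (st_left HS l HL) as [_ H].
  assert (Hl : In l Db) by (apply step_in_Db; auto).
  destruct (ht_valid Hb l Hl) as [V _]. lra.
Qed.

Lemma step_y i : In i Db -> ry0 (c i) = ry0 (cb i) /\ ry1 (c i) = ry1 (cb i).
Proof.
  intros Hi. destruct (in_dec Nat.eq_dec i L) as [HL|HL].
  - destruct (st_left HS i HL) as [-> _]. auto.
  - rewrite (st_old HS i Hi HL). auto.
Qed.

Lemma step_x0 i : In i Db -> rx0 (c i) = rx0 (cb i).
Proof.
  intros Hi. destruct (in_dec Nat.eq_dec i L) as [HL|HL].
  - destruct (st_left HS i HL) as [-> _]. auto.
  - rewrite (st_old HS i Hi HL). auto.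
Qed.

Lemma step_x1 i : In i Db -> (In i L /\ rx1 (c i) = a /\ rx1 (cb i) = 1 /\ rx0 (cb i) < a) \/
  (~ In i L /\ rx1 (c i) = rx1 (cb i)).
Proof.
  intros Hi. destruct (in_dec Nat.eq_dec i L) as [HL|HL].
  - left. destruct (st_left HS i HL) as [-> H]. repeat split; auto.
    apply (fr_right Fb i Hi). rewrite !in_app_iff. auto.
  - right. rewrite (st_old HS i Hi HL). auto.
Qed.

Lemma step_x1_le i : In i Db -> rx1 (c i) <= rx1 (cb i).
Proof.
  generalize (st_a HS). intros Ha Hi. destruct (step_x1 i Hi); lra.
Qed.

(** The right tiles directly above and below the block. Both start to the left of [a], which shields
    the new vertical segment from the rest of the tiling at its two ends. *)
Definition neighbour (i : nat) : Prop := (exists A', A = A' ++ [i]) \/ (exists C', C = i :: C').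

Lemma neighbour_spec i : neighbour i ->
  In i Db /\ ~ In i L /\ rx0 (cb i) < a /\ rx1 (cb i) = 1 /\ c i = cb i.
Proof.
  intros Hn.
  assert (HI : In i A \/ In i C).
  { destruct Hn as [[A' E]|[C' E]]; rewrite E; [left; apply in_or_app; simpl; auto|right; now left]. }
  assert (Hi : In i Db) by (apply step_in_Db; tauto).
  assert (HL : ~ In i L) by (generalize (step_disj i); tauto).
  split; auto. split; auto. split; [|split].
  - destruct Hn as [[A' E]|[C' E]].
    + now apply (st_above HS A' i).
    + now apply (st_below HS i C').
  - apply (fr_right Fb i Hi). rewrite !in_app_iff. tauto.
  - now apply (st_old HS).
Qed.

(** To the right of a tile touching the strip [[lo, hi]] there is a tile of [L], if their ordinates
    overlap, or a neighbour, if the strip is touched only at [lo] or at [hi]. *)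
Lemma step_touch i : In i Db -> ry0 (cb i) <= hi -> lo <= ry1 (cb i) ->
  In i L \/ neighbour i \/
  exists z, (In z L \/ neighbour z) /\ ry0 (cb i) <= ry1 (cb z) /\ ry0 (cb z) <= ry1 (cb i) /\
    rx1 (cb i) <= rx0 (cb z).
Proof.
  intros Hi H1 H2.
  destruct (in_dec Nat.eq_dec i L) as [|HL]; auto. right.
  destruct (classic (neighbour i)) as [|Hn]; auto. right.
  assert (Vi := ht_valid Hb i Hi). unfold valid_rect in Vi.
  assert (Hlt := step_lt). assert (Hbd := step_bounds).
  assert (SP : forall z, In z L \/ neighbour z -> In z Db /\ z <> i /\ rx1 (cb z) = 1).
  { intros z [Hz|Hz].
    - assert (Z : In z Db) by (apply step_in_Db; auto). split; auto. split; [now intros ->|].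
      destruct (step_x1 z Z) as [|[? _]]; [tauto|contradiction].
    - destruct (neighbour_spec z Hz) as [? [? [? [? ?]]]]. repeat split; auto.
      now intros ->. }
  destruct (Rlt_dec (ry0 (cb i)) hi) as [L1|L1]; [destruct (Rlt_dec lo (ry1 (cb i))) as [L2|L2]|].
  - destruct (chain_cover cb L hi lo (Rmin (ry1 (cb i)) hi)) as [z [Z1 Z2]].
    + apply HS.
    + split; [now apply Rmin_glb_lt|apply Rmin_r].
    + exists z. destruct (SP z) as [Z3 [Z4 Z5]]; auto. split; auto.
      generalize (Rmin_l (ry1 (cb i)) hi) (Rmin_r (ry1 (cb i)) hi). intros.
      assert (S := ht_sep Hb _ _ Hi Z3 ltac:(auto)). unfold sep in S.
      assert (ry0 (cb i) < Rmin (ry1 (cb i)) hi) by (apply Rmin_glb_lt; lra). lra.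
  - assert (E : ry1 (cb i) = lo) by lra.
    assert (CH := st_chainC HS).
    assert (EC : C = [] \/ exists z C', C = z :: C') by (destruct C; eauto).
    destruct EC as [EC|[z [C' EC]]]; rewrite EC in CH; [simpl in CH; lra|].
    destruct CH as [Z1 [Z2 _]].
    assert (Nz : neighbour z) by (right; eauto).
    exists z. destruct (SP z) as [Z3 [Z4 Z5]]; auto. split; auto.
    assert (S := ht_sep Hb _ _ Hi Z3 ltac:(auto)). unfold sep in S. lra.
  - assert (E : ry0 (cb i) = hi) by lra.
    assert (CH := st_chainA HS).
    destruct (exists_last (l := A)) as [A' [z EA]].
    { intros E'. rewrite E' in CH. simpl in CH. lra. }
    assert (Z2 : ry0 (cb z) = hi) by (rewrite EA in CH; now apply chain_last in CH).
    assert (Nz : neighbour z) by (left; eauto).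
    exists z. destruct (SP z) as [Z3 [Z4 Z5]]; auto. split; auto.
    assert (S := ht_sep Hb _ _ Hi Z3 ltac:(auto)).
    assert (Vz := ht_valid Hb z Z3). unfold sep, valid_rect in *. lra.
Qed.

(** The locality of the construction: no old tile touching the strip starts at [a] or beyond, so
    pulling the right sides of [L] back from 1 to [a] neither creates nor destroys a contact between
    old tiles. *)
Lemma step_touch_x i : In i Db -> ry0 (cb i) <= hi -> lo <= ry1 (cb i) -> rx0 (cb i) < a.
Proof.
  intros Hi H1 H2. assert (Vi := ht_valid Hb i Hi). unfold valid_rect in Vi.
  assert (LX : forall z, In z L -> rx0 (cb z) < a) by (intros z Hz; now apply HS).
  destruct (step_touch i Hi H1 H2) as [H|[H|[z [[Hz|Hz] [_ [_ H]]]]]].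
  - now apply LX.
  - now apply neighbour_spec.
  - specialize (LX z Hz). lra.
  - apply neighbour_spec in Hz. lra.
Qed.

(** Within the strip, the part of the square to the right of [a] belonged to the tiles of [L]
    alone. *)
Lemma step_block_free i : In i Db -> ~ In i L -> a <= rx1 (c i) ->
  hi <= ry0 (cb i) \/ ry1 (cb i) <= lo.
Proof.
  intros Hi HnL Hx.
  destruct (Rlt_dec (ry0 (cb i)) hi) as [L1|L1]; [|lra].
  destruct (Rlt_dec lo (ry1 (cb i))) as [L2|L2]; [|lra]. exfalso.
  assert (Vi := ht_valid Hb i Hi). unfold valid_rect in Vi.
  destruct (step_x1 i Hi) as [[HL _]|[HL E]]; [contradiction|].
  destruct (chain_cover cb L hi lo (Rmin (ry1 (cb i)) hi)) as [z [Z1 Z2]].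
  - apply HS.
  - split; [apply Rmin_glb_lt; auto; apply step_lt|apply Rmin_r].
  - assert (Z3 : In z Db) by (apply step_in_Db; auto).
    assert (Z4 : i <> z) by now intros ->.
    generalize (Rmin_l (ry1 (cb i)) hi) (Rmin_r (ry1 (cb i)) hi). intros.
    assert (S := ht_sep Hb _ _ Hi Z3 Z4). unfold sep in S.
    assert (ry0 (cb i) < Rmin (ry1 (cb i)) hi) by (apply Rmin_glb_lt; lra).
    destruct (step_x1 z Z3) as [[_ [_ [E1 E2]]]|[? _]]; [|contradiction]. lra.
Qed.

Lemma step_chain : chain c A 1 hi /\ chain c L hi lo /\ chain c C lo 0 /\ chain c N hi lo.
Proof.
  assert (E : forall l h m, (forall i, In i l -> In i Db) -> chain cb l h m -> chain c l h m).
  { intros l h m Hl. apply chain_ext. intros i Hi. destruct (step_y i (Hl i Hi)). auto. }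
  repeat split; try (apply E; [intros i Hi; apply step_in_Db; auto|apply HS]). apply HS.
Qed.

Lemma step_new_y i : In i N -> lo <= ry0 (c i) /\ ry0 (c i) < ry1 (c i) /\ ry1 (c i) <= hi.
Proof. intros Hi. eapply chain_in; [apply step_chain|auto]. Qed.

Lemma step_HT : HT c (Db ++ N).
Proof.
  assert (Ha := st_a HS). assert (Ha0 := step_a_pos).
  assert (Hbd := step_bounds).
  assert (VN : forall i, In i N -> valid_rect (c i)).
  { intros i Hi. destruct (st_new HS i Hi). generalize (step_new_y i Hi).
    unfold valid_rect. lra. }
  assert (SN : forall i j, In i Db -> In j N -> sep (c i) (c j)).
  { intros i j Hi Hj. destruct (st_new HS j Hj) as [X0 X1].
    generalize (step_new_y j Hj). destruct (step_y i Hi) as [Y0 Y1].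
    unfold sep. destruct (Rlt_dec a (rx1 (c i))) as [Hx|Hx]; [|lra].
    destruct (step_x1 i Hi) as [[_ [E _]]|[HL _]]; [lra|].
    destruct (step_block_free i Hi HL); lra. }
  split.
  - apply NoDup_app_iff. split; [apply Hb|]. split; [eapply chain_NoDup; apply HS|].
    intros i H1 H2. now apply (HN i).
  - intros i Hi. apply in_app_or in Hi. destruct Hi as [Hi|Hi]; [|auto].
    assert (V := ht_valid Hb i Hi). unfold valid_rect in *.
    destruct (step_y i Hi) as [-> ->]. rewrite (step_x0 i Hi).
    destruct (step_x1 i Hi); lra.
  - intros x y Hx Hy.
    destruct (ht_cover Hb x y Hx Hy) as [i [Hi [I1 I2]]].
    destruct (Rle_dec x (rx1 (c i))) as [Hc|Hc].
    + exists i. split; [apply in_or_app; auto|]. unfold in_half.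
      destruct (step_y i Hi) as [-> ->]. rewrite (step_x0 i Hi). lra.
    + destruct (step_x1 i Hi) as [[HL [E1 [E2 _]]]|[_ E]]; [|lra].
      generalize (chain_in (st_chainL HS) HL). intros.
      destruct (chain_cover c N hi lo y) as [j [J1 J2]]; [apply HS|lra|].
      exists j. split; [apply in_or_app; auto|].
      destruct (st_new HS j J1). unfold in_half. lra.
  - intros i j Hi Hj Hn. apply in_app_or in Hi, Hj.
    destruct Hi as [Hi|Hi], Hj as [Hj|Hj].
    + assert (S := ht_sep Hb i j Hi Hj Hn). unfold sep in *.
      destruct (step_y i Hi) as [-> ->]. rewrite (step_x0 i Hi).
      destruct (step_y j Hj) as [-> ->]. rewrite (step_x0 j Hj).
      generalize (step_x1_le i Hi) (step_x1_le j Hj). lra.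
    + now apply SN.
    + generalize (SN j i Hj Hi). unfold sep. tauto.
    + generalize (chain_sep (st_chainN HS) Hi Hj Hn).
      unfold sep. tauto.
Qed.

Lemma step_Front : Front c (Db ++ N) (A ++ N ++ C).
Proof.
  assert (Ha := st_a HS).
  split.
  - intros i. rewrite !in_app_iff. generalize (step_in_Db i). tauto.
  - intros i Hi. rewrite !in_app_iff. apply in_app_or in Hi. destruct Hi as [Hi|Hi].
    + assert (R := fr_right Fb i Hi). rewrite !in_app_iff in R.
      assert (NN : In i N -> False) by (intros H; now apply (HN i)).
      destruct (step_x1 i Hi) as [[HL [E1 [E2 _]]]|[HL E]].
      * generalize (step_disj i). split; [lra|tauto].
      * rewrite E. tauto.
    + destruct (st_new HS i Hi). tauto.
  - destruct step_chain as [C1 [_ [C3 C4]]].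
    apply chain_app. exists hi. split; auto. apply chain_app. now exists lo.
Qed.

Lemma step_hadj i j : In i Db -> In j Db -> (hadj (c i) (c j) <-> hadj (cb i) (cb j)).
Proof.
  intros Hi Hj. unfold hadj. destruct (step_y i Hi) as [-> ->]. destruct (step_y j Hj) as [-> ->].
  rewrite (step_x0 i Hi), (step_x0 j Hj).
  assert (K : forall i j, In i Db -> In j Db -> ry0 (cb i) < ry1 (cb j) ->
    ry0 (cb j) < ry1 (cb i) -> (rx1 (c i) = rx0 (cb j) <-> rx1 (cb i) = rx0 (cb j))).
  { clear i j Hi Hj. intros i j Hi Hj Y1 Y2.
    destruct (step_x1 i Hi) as [[HL [E1 [E2 E3]]]|[_ ->]]; [|tauto].
    assert (Vj := ht_valid Hb j Hj). unfold valid_rect in Vj.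
    split; [|lra]. intros E. exfalso.
    assert (HC := chain_in (st_chainL HS) HL).
    assert (rx0 (cb j) < a) by (apply step_touch_x; auto; lra). lra. }
  generalize (K i j Hi Hj) (K j i Hj Hi). tauto.
Qed.

Lemma step_vadj i j : In i Db -> In j Db -> (vadj (c i) (c j) <-> vadj (cb i) (cb j)).
Proof.
  intros Hi Hj. unfold vadj. destruct (step_y i Hi) as [-> ->]. destruct (step_y j Hj) as [-> ->].
  rewrite (step_x0 i Hi), (step_x0 j Hj).
  assert (K : forall i j, In i Db -> In j Db -> ry1 (cb i) = ry0 (cb j) \/ ry1 (cb j) = ry0 (cb i) ->
    (rx0 (cb j) < rx1 (c i) <-> rx0 (cb j) < rx1 (cb i))).
  { clear i j Hi Hj. intros i j Hi Hj Y.
    destruct (step_x1 i Hi) as [[HL [E1 [E2 E3]]]|[_ ->]]; [|tauto].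
    assert (Vj := ht_valid Hb j Hj). unfold valid_rect in Vj.
    assert (HC := chain_in (st_chainL HS) HL).
    assert (rx0 (cb j) < a) by (apply step_touch_x; auto; lra). lra. }
  generalize (K i j Hi Hj) (K j i Hj Hi). tauto.
Qed.

(** Recovers [L] from the block and the adjacencies; the neighbours are excluded because they end at
    1, not at [a]. *)
Lemma step_left_adj i : In i (Db ++ N) ->
  (In i L <-> exists n, In n N /\ hadj (c i) (c n)).
Proof.
  intros Hi. split.
  - intros HL. assert (Hd : In i Db) by (apply step_in_Db; auto).
    assert (HC := chain_in (st_chainL HS) HL).
    destruct (chain_cover c N hi lo (ry1 (cb i))) as [n [N1 N2]]; [apply HS|lra|].
    exists n. split; auto. destruct (st_new HS n N1) as [X0 X1].
    destruct (step_x1 i Hd) as [[_ [E1 _]]|[? _]]; [|contradiction].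
    destruct (step_y i Hd) as [Y0 Y1]. unfold hadj. lra.
  - intros [n [Hn [Hx [Hy1 Hy2]]]].
    destruct (st_new HS n Hn) as [X0 X1].
    assert (Ha := st_a HS).
    assert (HT' := step_HT). assert (Vi := ht_valid HT' i Hi). unfold valid_rect in Vi.
    apply in_app_or in Hi. destruct Hi as [Hd|Hi].
    + assert (HC := step_new_y n Hn). destruct (step_y i Hd) as [Y0 Y1].
      destruct (step_touch i Hd) as [H|[H|[z [Hz [_ [_ H]]]]]]; try lra; auto; exfalso.
      * apply neighbour_spec in H. destruct H as [_ [_ [_ [H E]]]]. rewrite E in *. lra.
      * assert (rx0 (cb z) < a).
        { destruct Hz as [Hz|Hz]; [now apply HS|now apply neighbour_spec]. }
        generalize (step_x1_le i Hd). lra.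
    + destruct (st_new HS i Hi) as [? ?]. lra.
Qed.
End StepFacts.

Arguments step_L_nonempty {cb c Db A L C N p a hi lo}.
Arguments step_lt {cb c Db A L C N p a hi lo}.
Arguments step_bounds {cb c Db A L C N p a hi lo}.
Arguments step_in_Db {cb c Db A L C N p a hi lo}.
Arguments step_disj {cb c Db A L C N p a hi lo}.
Arguments step_a_pos {cb c Db A L C N p a hi lo}.
Arguments step_y {cb c Db A L C N p a hi lo}.
Arguments step_x0 {cb c Db A L C N p a hi lo}.
Arguments step_x1 {cb c Db A L C N p a hi lo}.
Arguments step_x1_le {cb c Db A L C N p a hi lo}.
Arguments neighbour_spec {cb c Db A L C N p a hi lo}.
Arguments step_touch {cb c Db A L C N p a hi lo}.
Arguments step_touch_x {cb c Db A L C N p a hi lo}.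
Arguments step_block_free {cb c Db A L C N p a hi lo}.
Arguments step_chain {cb c Db A L C N p a hi lo}.
Arguments step_new_y {cb c Db A L C N p a hi lo}.
Arguments step_HT {cb c Db A L C N p a hi lo}.
Arguments step_Front {cb c Db A L C N p a hi lo}.
Arguments step_hadj {cb c Db A L C N p a hi lo}.
Arguments step_vadj {cb c Db A L C N p a hi lo}.
Arguments step_left_adj {cb c Db A L C N p a hi lo}.

(** * Words and their realizations *)

(* [Root k] is the stack of [k] horizontal tiles; [Ext w u p] adds to [w] a block
   in front of [lefts p] consecutive right tiles, below the [u] topmost ones. *)
Inductive word := Root (k : nat) | Ext (w : word) (u : nat) (p : list letter).

Fixpoint size (w : word) : nat :=
  match w with Root k => k | Ext w u p => size w + rights p end.
Fixpoint width (w : word) : nat :=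
  match w with Root k => k | Ext w u p => width w - lefts p + rights p end.
Fixpoint sing (w : word) : nat :=
  match w with Root k => 0 | Ext w u p => sing w + nB p end.
(* The number of right tiles down to the bottom of the block added last. *)
Definition ends (w : word) : nat :=
  match w with Root k => k | Ext w u p => u + rights p end.
Fixpoint frontier (w : word) : list nat :=
  match w with
  | Root k => seq 0 k
  | Ext w u p => firstn u (frontier w) ++ seq (size w) (rights p) ++ skipn (u + lefts p) (frontier w)
  end.
(* The condition [u <= ends w] selects among all orders of adding the blocks the one
   in which each block is the topmost removable one at the time of its addition. *)
Fixpoint valid (w : word) : Prop :=
  match w with
  | Root k => (1 <= k)%nat
  | Ext w u p => valid w /\ (u <= ends w)%nat /\ (u + lefts p <= width w)%nat
  end.

(** Tiles are numbered in the order of their addition and from top to bottom within a block, so the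
    index of a tile is the same in all realizations of a word. *)
Inductive Real : (nat -> rect) -> word -> Prop :=
| RealRoot c k : (forall i, In i (seq 0 k) -> rx0 (c i) = 0 /\ rx1 (c i) = 1) ->
    chain c (seq 0 k) 1 0 -> Real c (Root k)
| RealExt cb c w u p A L C a hi lo :
    Real cb w -> frontier w = A ++ L ++ C -> length A = u -> (u <= ends w)%nat ->
    Step cb c (seq 0 (size w)) A L C (seq (size w) (rights p)) p a hi lo ->
    Real c (Ext w u p).

Lemma seq_split w p : seq 0 (size w + rights p) = seq 0 (size w) ++ seq (size w) (rights p).
Proof. apply seq_app. Qed.

Lemma new_fresh n q : forall i, In i (seq n q) -> ~ In i (seq 0 n).
Proof. intros i H1 H2. apply in_seq in H1, H2. lia. Qed.

Lemma frontier_ext w u p A L C :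
  frontier w = A ++ L ++ C -> length A = u -> length L = lefts p ->
  frontier (Ext w u p) = A ++ seq (size w) (rights p) ++ C.
Proof.
  intros E HA HL. simpl frontier. rewrite E. f_equal; [|f_equal].
  - rewrite firstn_app, <- HA, firstn_all, Nat.sub_diag. simpl. apply app_nil_r.
  - rewrite app_assoc, skipn_app, skipn_all2 by (rewrite length_app; lia).
    rewrite length_app, HA, HL, Nat.sub_diag. reflexivity.
Qed.

Lemma Real_frontier_ext cb c w u p A L C a hi lo :
  frontier w = A ++ L ++ C -> length A = u ->
  Step cb c (seq 0 (size w)) A L C (seq (size w) (rights p)) p a hi lo ->
  frontier (Ext w u p) = A ++ seq (size w) (rights p) ++ C.
Proof.
  intros E HA HS. apply frontier_ext with L; auto.
  now destruct (Pat_length (st_pat HS)).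
Qed.

Arguments Real_frontier_ext {cb c w u p A L C a hi lo}.

Lemma Real_inv c w : Real c w ->
  HT c (seq 0 (size w)) /\ Front c (seq 0 (size w)) (frontier w).
Proof.
  induction 1 as [c k Hx Hc|cb c w u p A L C a hi lo HR [IH1 IH2] E HA Hu HS].
  - simpl. split; split; auto.
    + apply seq_NoDup.
    + intros i Hi. generalize (chain_in Hc Hi). destruct (Hx i Hi).
      unfold valid_rect. lra.
    + intros x y H1 H2. destruct (chain_cover _ _ _ _ y Hc) as [i [Hi Hy]]; [lra|].
      exists i. split; auto. destruct (Hx i Hi). unfold in_half. lra.
    + intros i j Hi Hj Hn. generalize (chain_sep Hc Hi Hj Hn). unfold sep. tauto.
    + intros i Hi. destruct (Hx i Hi). tauto.
  - rewrite (Real_frontier_ext E HA HS). simpl size. rewrite seq_split.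
    rewrite E in IH2. generalize (new_fresh (size w) (rights p)). intros HN.
    split; [eapply step_HT; eauto|eapply step_Front; eauto].
Qed.

Arguments Real_inv {c w}.

Lemma Real_width c w : Real c w -> length (frontier w) = width w.
Proof.
  induction 1 as [c k Hx Hc|cb c w u p A L C a hi lo HR IH E HA Hu HS].
  - apply length_seq.
  - rewrite (Real_frontier_ext E HA HS). simpl width.
    destruct (Pat_length (st_pat HS)) as [E1 E2].
    rewrite <- IH, E, !length_app, length_seq. lia.
Qed.

Arguments Real_width {c w}.

Lemma Real_valid c w : Real c w -> valid w.
Proof.
  induction 1 as [c k Hx Hc|cb c w u p A L C a hi lo HR IH E HA Hu HS]; simpl.
  - destruct k; [simpl in Hc; lra|lia].
  - split; [auto|]. split; [auto|].
    destruct (Pat_length (st_pat HS)) as [E1 E2].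
    rewrite <- (Real_width HR), E, !length_app. lia.
Qed.

Arguments Real_valid {c w}.

(** * Heaviness and singular vertices of a realization *)

(** The edges that hit the right side are at the lower ends of all right tiles but the last; at any
    other interior ordinate a horizontal segment ending at 1 enters an open tile. *)
Lemma heavy_front c D F : HT c D -> Front c D F -> heavy (map c D) (length F - 1).
Proof.
  intros H [F1 F2 F3]. destruct (exists_last (l := F)) as [F' [f E]].
  { intros ->. simpl in F3. lra. }
  exists (map (fun i => ry0 (c i)) F'). subst F.
  assert (F3' := F3). apply chain_app in F3'. destruct F3' as [m [M1 [M2 [M3 M4]]]].
  simpl in M4.
  split; [|split].
  - clear - M1. revert M1. generalize 1. induction F' as [|i F' IH]; intros h; simpl; [constructor|].
    intros [H1 [H2 H3]]. constructor; eauto. intros Hi. apply in_map_iff in Hi.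
    destruct Hi as [j [E Hj]]. generalize (chain_in H3 Hj). lra.
  - rewrite length_map, length_app. simpl. lia.
  - intros y. split.
    + intros Hy. apply in_map_iff in Hy. destruct Hy as [i [<- Hi]].
      generalize (chain_in M1 Hi). intros B.
      assert (HF : In i (F' ++ [f])) by (apply in_or_app; auto).
      assert (HD := F1 i HF). apply F2 in HF; auto.
      assert (V := ht_valid H i HD). unfold valid_rect in V.
      split; [lra|]. exists (rx0 (c i)). split; [lra|].
      intros [x y] [P1 P2]; simpl in *. exists (c i). split; [now apply in_map|].
      unfold in_closed, in_open; simpl. lra.
    + intros [Hy [x [Hx Hs]]].
      destruct (chain_cover _ _ _ _ y F3) as [i [Hi Hyi]]; [lra|].
      assert (HD := F1 i Hi). assert (R := proj2 (F2 i HD) Hi).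
      assert (V := ht_valid H i HD). unfold valid_rect in V.
      destruct (Rlt_dec y (ry1 (c i))) as [Hl|Hl].
      * exfalso. generalize (Rmax_l x (rx0 (c i))) (Rmax_r x (rx0 (c i))). intros.
        assert (Rmax x (rx0 (c i)) < 1) by (apply Rmax_lub_lt; lra).
        apply (open_not_skeleton c D i ((Rmax x (rx0 (c i)) + 1) / 2, y)); auto.
        -- unfold in_open; simpl. lra.
        -- apply Hs. split; simpl; lra.
      (* Here [y] is the upper end of [i] and less than 1, so [i] has a predecessor on the right
         side, whose lower end is [y]. *)
      * apply in_split in Hi. destruct Hi as [l1 [l2 E]].
        destruct l1 as [|j0 l1] using rev_ind; [|clear IHl1].
        { simpl in E. rewrite E in F3. destruct F3 as [F3 _]. lra. }
        rewrite <- app_assoc in E. simpl in E.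
        assert (F3' := F3). rewrite E in F3'. apply chain_app in F3'.
        destruct F3' as [m' [_ [_ [_ [M5 _]]]]].
        apply in_map_iff. exists j0. split; [lra|].
        assert (E' : removelast (F' ++ [f]) = removelast (l1 ++ j0 :: i :: l2)) by now rewrite E.
        rewrite removelast_last, removelast_app in E' by easy.
        rewrite E'. apply in_or_app. right. now left.
Qed.

(** One tile in each of the four quadrants at [p]; unlike [singular], this does not mention
    positions in a list. *)
Definition singular_at (c : nat -> rect) (D : list nat) (p : pt) : Prop :=
  forall al be, exists i, In i D /\ fst p = sidex (c i) al /\ snd p = sidey (c i) be.

Lemma same_corner c D i j p al be : HT c D -> In i D -> In j D ->
  fst p = sidex (c i) al -> snd p = sidey (c i) be ->
  fst p = sidex (c j) al -> snd p = sidey (c j) be -> i = j.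
Proof.
  intros H Hi Hj. destruct (Nat.eq_dec i j) as [|N]; auto.
  assert (S := ht_sep H i j Hi Hj N). assert (Vi := ht_valid H i Hi).
  assert (Vj := ht_valid H j Hj). unfold sep, valid_rect in *.
  destruct al, be; simpl; lra.
Qed.

(** By [same_corner], distinct tiles have corners of distinct types at [p], so four tiles exhaust
    the four types. *)
Lemma singular_corners c D p : HT c D -> (singular (map c D) p <-> singular_at c D p).
Proof.
  intros H.
  assert (NT : forall k, (k < length (map c D))%nat ->
    In (nth k D 0%nat) D /\ nth k (map c D) dummy_rect = c (nth k D 0%nat)).
  { intros k Hk. rewrite length_map in Hk. split; [now apply nth_In|].
    rewrite (nth_indep _ _ (c 0%nat)) by now rewrite length_map. apply map_nth. }
  split.
  - intros [k1 [k2 [k3 [k4 [B1 [B2 [B3 [B4 [N12 [N13 [N14 [N23 [N24 [N34 [C1 [C2 [C3 C4]]]]]]]]]]]]]]]]].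
    assert (TY : forall k, (k < length (map c D))%nat -> is_corner (nth k (map c D) dummy_rect) p ->
      exists t : bool * bool, fst p = sidex (c (nth k D 0%nat)) (fst t) /\
        snd p = sidey (c (nth k D 0%nat)) (snd t)).
    { intros k Hk [[X|X] [Y|Y]]; destruct (NT k Hk) as [_ E]; rewrite E in *;
        [exists (false, false)|exists (false, true)|exists (true, false)|exists (true, true)]; auto. }
    destruct (TY k1 B1 C1) as [t1 T1]. destruct (TY k2 B2 C2) as [t2 T2].
    destruct (TY k3 B3 C3) as [t3 T3]. destruct (TY k4 B4 C4) as [t4 T4].
    assert (DJ : forall k k' t t', (k < length (map c D))%nat -> (k' < length (map c D))%nat ->
      k <> k' -> fst p = sidex (c (nth k D 0%nat)) (fst t) /\ snd p = sidey (c (nth k D 0%nat)) (snd t) ->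
      fst p = sidex (c (nth k' D 0%nat)) (fst t') /\ snd p = sidey (c (nth k' D 0%nat)) (snd t') ->
      t <> t').
    { intros k k' t t' Hk Hk' N [X Y] [X' Y'] <-. apply N.
      apply (proj1 (NoDup_nth D 0%nat) (ht_nodup H)); try (now rewrite length_map in * ).
      apply (same_corner c D _ _ p (fst t) (snd t)); auto; now apply NT. }
    assert (ND : NoDup [t1; t2; t3; t4]).
    { assert (t1 <> t2) by (apply (DJ k1 k2); auto).
      assert (t1 <> t3) by (apply (DJ k1 k3); auto).
      assert (t1 <> t4) by (apply (DJ k1 k4); auto).
      assert (t2 <> t3) by (apply (DJ k2 k3); auto).
      assert (t2 <> t4) by (apply (DJ k2 k4); auto).
      assert (t3 <> t4) by (apply (DJ k3 k4); auto).
      repeat (constructor; [simpl; intuition congruence|]). constructor. }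
    assert (IN : incl [(false, false); (false, true); (true, false); (true, true)] [t1; t2; t3; t4]).
    { apply NoDup_length_incl; auto. intros [[] []] _; simpl; tauto. }
    intros al be.
    assert (I : In (al, be) [t1; t2; t3; t4]) by (apply IN; destruct al, be; simpl; tauto).
    simpl in I. destruct I as [->|[->|[->|[->|[]]]]].
    + exists (nth k1 D 0%nat). split; [now apply NT|exact T1].
    + exists (nth k2 D 0%nat). split; [now apply NT|exact T2].
    + exists (nth k3 D 0%nat). split; [now apply NT|exact T3].
    + exists (nth k4 D 0%nat). split; [now apply NT|exact T4].
  - intros S.
    assert (KX : forall al be, exists k, (k < length (map c D))%nat /\
      fst p = sidex (nth k (map c D) dummy_rect) al /\ snd p = sidey (nth k (map c D) dummy_rect) be /\
      valid_rect (nth k (map c D) dummy_rect)).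
    { intros al be. destruct (S al be) as [i [Hi [X Y]]].
      destruct (In_nth D i 0%nat Hi) as [k [K1 K2]]. exists k.
      assert (Hk : (k < length (map c D))%nat) by now rewrite length_map.
      split; auto. destruct (NT k Hk) as [_ ->]. rewrite K2. repeat split; auto; now apply H. }
    destruct (KX false false) as [k1 [B1 [X1 [Y1 V1]]]].
    destruct (KX false true) as [k2 [B2 [X2 [Y2 V2]]]].
    destruct (KX true false) as [k3 [B3 [X3 [Y3 V3]]]].
    destruct (KX true true) as [k4 [B4 [X4 [Y4 V4]]]].
    exists k1, k2, k3, k4. unfold is_corner, valid_rect in *. simpl in *.
    repeat split; auto; intros ->; lra.
Qed.

Lemma chain_next c l hi lo i : chain c l hi lo -> In i l -> lo < ry0 (c i) ->
  exists j, In j l /\ ry1 (c j) = ry0 (c i).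
Proof.
  revert hi. induction l as [|k l IH]; intros hi; simpl; [easy|].
  intros [H1 [H2 H3]] [->|Hi] HL.
  - destruct l as [|j l]; simpl in H3; [lra|]. exists j. simpl. tauto.
  - destruct (IH _ H3 Hi HL) as [j [J1 J2]]. eauto.
Qed.

(** The common lower end [lo] of the two stacks is the end of the block and not a crossing, hence
    the condition [lo < y]. *)
Lemma Pat_common c L N p h k lo : Pat c L N p -> chain c L h lo -> chain c N k lo ->
  exists ys, NoDup ys /\ length ys = nB p /\
    forall y, In y ys <-> lo < y /\ exists l n, In l L /\ In n N /\ ry0 (c l) = y /\ ry0 (c n) = y.
Proof.
  intros P. revert h k. induction P as [l n E|l l' ls n ns p E1 E2 P IH|l ls n n' ns p E1 E2 P IH
    |l l' ls n n' ns p E1 E2 E3 P IH]; intros h k CL CN.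
  - exists []. split; [constructor|]. split; auto. intros y. split; [easy|].
    destruct CL as [_ [_ CL]]. simpl in CL.
    intros [H1 [i [j [[<-|[]] [_ [E3 _]]]]]]. lra.
  - destruct CL as [L1 [L2 L3]]. destruct (IH _ _ L3 CN) as [ys [Y1 [Y2 Y3]]].
    exists ys. split; auto. split; auto. intros y. rewrite Y3. split.
    + intros [H1 [i [j [Hi [Hj H]]]]]. split; auto. exists i, j. split; auto. now right.
    + intros [H1 [i [j [Hi [Hj [H2 H3]]]]]]. split; auto. exists i, j. split; auto.
      destruct Hi as [<-|Hi]; auto. exfalso.
      destruct CN as [_ [_ CN]]. destruct Hj as [<-|Hj]; [lra|].
      generalize (chain_in CN Hj). lra.
  - destruct CN as [N1 [N2 N3]]. destruct (IH _ _ CL N3) as [ys [Y1 [Y2 Y3]]].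
    exists ys. split; auto. split; auto. intros y. rewrite Y3. split.
    + intros [H1 [i [j [Hi [Hj H]]]]]. split; auto. exists i, j. split; auto. split; auto. now right.
    + intros [H1 [i [j [Hi [Hj [H2 H3]]]]]]. split; auto. exists i, j. split; auto. split; auto.
      destruct Hj as [<-|Hj]; auto. exfalso.
      destruct CL as [_ [_ CL]]. destruct Hi as [<-|Hi]; [lra|].
      generalize (chain_in CL Hi). lra.
  - destruct CL as [L1 [L2 L3]], CN as [N1 [N2 N3]]. destruct (IH _ _ L3 N3) as [ys [Y1 [Y2 Y3]]].
    exists (ry0 (c l) :: ys). split; [|split].
    + constructor; auto. rewrite Y3. intros [_ [i [j [Hi [_ [H _]]]]]].
      generalize (chain_in L3 Hi). lra.
    + simpl. lia.
    + intros y. simpl. rewrite Y3. split.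
      * intros [<-|[H1 [i [j [Hi [Hj H]]]]]].
        -- split; [eapply chain_lt; [|exact L3]; easy|]. exists l, n. simpl. repeat split; auto.
        -- split; auto. exists i, j. simpl in *. tauto.
      * intros [H1 [i [j [[<-|Hi] [[<-|Hj] [H2 H3]]]]]]; try (left; lra).
        right. split; auto. exists i, j. auto.
Qed.

Section StepSingular.
Variables (cb c : nat -> rect) (Db A L C N : list nat) (p : list letter) (a hi lo : R).
Hypothesis HS : Step cb c Db A L C N p a hi lo.
Hypothesis Hb : HT cb Db.
Hypothesis Fb : Front cb Db (A ++ L ++ C).
Hypothesis HN : forall i, In i N -> ~ In i Db.
#[local] Set Default Proof Using "HS Hb Fb HN".

Lemma step_touch_not i : In i Db -> ry0 (cb i) <= hi -> lo <= ry1 (cb i) -> rx0 (cb i) = a -> False.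
Proof.
  intros Hi H1 H2 H3.
  assert (rx0 (cb i) < a) by (eapply step_touch_x; eauto). lra.
Qed.

(** By [step_touch_x]: the tile to the lower right of such a vertex would start at [a] and touch the
    strip. So old and new vertices are counted without overlap. *)
Lemma step_singular_old q : singular_at cb Db q -> ~ (fst q = a /\ lo < snd q <= hi).
Proof.
  intros S [Hx Hy]. destruct (S false true) as [i [Hi [X Y]]]. simpl in *.
  assert (V := ht_valid Hb i Hi). unfold valid_rect in V.
  apply (step_touch_not i); auto; lra.
Qed.

Lemma step_singular q : singular_at c (Db ++ N) q <->
  singular_at cb Db q \/ (fst q = a /\ lo < snd q /\
    exists l n, In l L /\ In n N /\ ry0 (c l) = snd q /\ ry0 (c n) = snd q).
Proof.
  assert (Ha := st_a HS).
  assert (SY : forall i, In i Db -> ry0 (c i) = ry0 (cb i) /\ ry1 (c i) = ry1 (cb i))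
    by (intros; eapply step_y; eauto).
  assert (SX : forall i, In i Db -> rx0 (c i) = rx0 (cb i)) by (intros; eapply step_x0; eauto).
  assert (SX1 : forall i, In i Db -> (In i L /\ rx1 (c i) = a /\ rx1 (cb i) = 1 /\ rx0 (cb i) < a) \/
    (~ In i L /\ rx1 (c i) = rx1 (cb i))) by (intros; eapply step_x1; eauto).
  assert (SN := st_new HS).
  assert (SNy : forall i, In i N -> lo <= ry0 (c i) /\ ry0 (c i) < ry1 (c i) /\ ry1 (c i) <= hi)
    by (intros; eapply step_new_y; eauto).
  assert (SL : forall i, In i L -> In i Db /\ rx1 (c i) = a /\ lo <= ry0 (cb i) /\ ry1 (cb i) <= hi).
  { intros i Hi. assert (Hd : In i Db) by (eapply step_in_Db; eauto).
    generalize (chain_in (st_chainL HS) Hi). intros B.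
    split; auto. split; [|lra]. destruct (SX1 i Hd); tauto. }
  assert (SV : forall i, In i Db -> valid_rect (cb i)) by apply Hb.
  assert (SC := step_chain HS Hb Fb HN).
  destruct SC as [_ [CL [_ CN]]].
  split.
  - intros S.
    destruct (S true true) as [q1 [I1 [X1 Y1]]]. destruct (S false true) as [q2 [I2 [X2 Y2]]].
    destruct (S true false) as [q3 [I3 [X3 Y3]]]. destruct (S false false) as [q4 [I4 [X4 Y4]]].
    simpl in *. apply in_app_or in I1, I2, I3, I4.
    (* The tile with upper left corner [q] decides: if it is old, then so are all four and the
       vertex was singular before; if it is new, then [q] lies on the new segment. *)
    destruct I2 as [I2|I2]; [|clear I1].
    + assert (V2 := SV q2 I2). unfold valid_rect in V2. destruct (SY q2 I2) as [Y20 Y21].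
      rewrite (SX q2 I2) in X2.
      assert (NT2 : ry0 (cb q2) <= hi -> lo <= ry1 (cb q2) -> fst q = a -> False).
      { intros T1 T2 T3. apply (step_touch_not q2); auto. lra. }
      destruct I4 as [I4|I4].
      2:{ exfalso. destruct (SN q4 I4) as [E4 _]. generalize (SNy q4 I4). intros.
          apply NT2; lra. }
      left.
      assert (J1 : In q1 Db /\ ~ In q1 L).
      { destruct I1 as [I1|I1]; [|destruct (SN q1 I1); lra]. split; auto. intros HL.
        destruct (SL q1 HL) as [_ [E [E1 E2]]]. destruct (SY q1 I1) as [Y10 Y11].
        assert (V1 := SV q1 I1). unfold valid_rect in V1. apply NT2; lra. }
      assert (J3 : In q3 Db /\ ~ In q3 L).
      { destruct I3 as [I3|I3]; [|destruct (SN q3 I3); lra]. split; auto. intros HL.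
        destruct (SL q3 HL) as [_ [E [E1 E2]]]. destruct (SY q3 I3) as [Y30 Y31].
        assert (V3 := SV q3 I3). unfold valid_rect in V3. apply NT2; lra. }
      destruct J1 as [J1 K1], J3 as [J3 K3].
      intros al be. destruct al, be.
      * exists q1. rewrite <- (st_old HS q1 J1 K1). auto.
      * exists q3. rewrite <- (st_old HS q3 J3 K3). auto.
      * exists q2. simpl. rewrite <- Y21. auto.
      * exists q4. simpl. rewrite <- (SX q4 I4). destruct (SY q4 I4) as [<- _]. auto.
    + right. destruct (SN q2 I2) as [E2 _]. generalize (SNy q2 I2). intros B2.
      assert (Hq : fst q = a) by lra.
      assert (Hy : lo < snd q <= hi) by lra.
      destruct I4 as [I4|I4].
      { exfalso. apply (step_touch_not q4 I4).
        - destruct (SY q4 I4). lra.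
        - assert (V4 := SV q4 I4). unfold valid_rect in V4. destruct (SY q4 I4). lra.
        - rewrite <- (SX q4 I4). lra. }
      generalize (SNy q4 I4). intros B4.
      destruct I3 as [I3|I3]; [|destruct (SN q3 I3); lra].
      destruct (SY q3 I3) as [Y30 Y31].
      assert (V3 := SV q3 I3). unfold valid_rect in V3.
      split; [auto|]. split; [lra|]. exists q3, q4. split; [|repeat split; auto].
      destruct (SX1 q3 I3) as [[HL _]|[HL E3]]; auto. exfalso.
      destruct (step_touch HS Hb Fb HN q3 I3) as [T|[T|[z [Hz [_ [_ T]]]]]];
        try lra.
      * contradiction.
      * eapply neighbour_spec in T; eauto. lra.
      * assert (rx0 (cb z) < a).
        { destruct Hz as [Hz|Hz]; [now apply HS|]. eapply neighbour_spec in Hz; eauto. tauto. }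
        lra.
  - intros [S|[Hx [Hy [l [n [Hl [Hn [Yl Yn]]]]]]]].
    + assert (Hq : fst q < 1).
      { destruct (S false false) as [i [Hi [X _]]]. assert (V := SV i Hi).
        unfold valid_rect in V. simpl in X. lra. }
      intros al be. destruct (S al be) as [i [Hi [X Y]]]. exists i.
      split; [apply in_or_app; auto|]. destruct (SY i Hi) as [Y0 Y1].
      split.
      * destruct al; simpl in *; [|now rewrite (SX i Hi)].
        destruct (SX1 i Hi); lra.
      * destruct be; simpl in *; lra.
    + destruct (chain_next _ _ _ _ l CL Hl) as [l' [Hl' Yl']]; [lra|].
      destruct (chain_next _ _ _ _ n CN Hn) as [n' [Hn' Yn']]; [lra|].
      destruct (SL l Hl) as [Dl [Xl _]]. destruct (SL l' Hl') as [Dl' [Xl' _]].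
      destruct (SN n Hn) as [Xn _]. destruct (SN n' Hn') as [Xn' _].
      intros [] [].
      * exists l'. simpl. rewrite in_app_iff. repeat split; auto; lra.
      * exists l. simpl. rewrite in_app_iff. repeat split; auto; lra.
      * exists n'. simpl. rewrite in_app_iff. repeat split; auto; lra.
      * exists n. simpl. rewrite in_app_iff. repeat split; auto; lra.
Qed.
End StepSingular.

Arguments step_singular_old {cb c Db A L C N p a hi lo}.
Arguments step_singular {cb c Db A L C N p a hi lo}.

Lemma Real_singular c w : Real c w ->
  exists ps, NoDup ps /\ length ps = sing w /\
    forall q, In q ps <-> singular_at c (seq 0 (size w)) q.
Proof.
  induction 1 as [c k Hx Hc|cb c w u p A L C a hi lo HR IH E HA Hu HS].
  - exists []. split; [constructor|]. split; auto. intros q. split; [easy|].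
    intros S. destruct (S false true) as [i [Hi [Xi _]]]. destruct (S true true) as [j [Hj [Xj _]]].
    destruct (Hx i Hi), (Hx j Hj). simpl in *. lra.
  - destruct (Real_inv HR) as [Hb Fb]. rewrite E in Fb.
    generalize (new_fresh (size w) (rights p)). intros HN.
    destruct IH as [ps [P1 [P2 P3]]].
    destruct (step_chain HS Hb Fb HN) as [_ [CL [_ CN]]].
    destruct (Pat_common _ _ _ _ _ _ _ (st_pat HS) CL CN)
      as [ys [Y1 [Y2 Y3]]].
    exists (map (fun y => (a, y)) ys ++ ps). split; [|split].
    + apply NoDup_app_iff. split; [|split; auto].
      * apply NoDup_map_inv with (f := snd). rewrite map_map. simpl. now rewrite map_id.
      * intros q Hq. apply in_map_iff in Hq. destruct Hq as [y [<- Hy]]. rewrite P3. intros S.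
        apply (step_singular_old HS Hb Fb HN _ S).
        apply Y3 in Hy. destruct Hy as [Hy [l [n [Hl [Hn [Yl Yn]]]]]]. simpl.
        split; [reflexivity|]. generalize (chain_in CL Hl). lra.
    + rewrite length_app, length_map. simpl. rewrite Nat.add_comm.
      apply f_equal2; [exact P2|exact Y2].
    + intros q. simpl size. rewrite seq_split.
      rewrite (step_singular HS Hb Fb HN q), in_app_iff, P3.
      rewrite in_map_iff. split.
      * intros [[y [<- Hy]]|H]; auto. right. apply Y3 in Hy. simpl. tauto.
      * intros [H|[H1 H2]]; auto. left. exists (snd q). split; [now rewrite <- H1; destruct q|].
        now apply Y3.
Qed.

Arguments Real_singular {c w}.

Lemma Real_good c w : Real c w ->
  good (size w) (width w - 1) (sing w) (map c (seq 0 (size w))).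
Proof.
  intros HR. destruct (Real_inv HR) as [H F]. split; [|split; [|split]].
  - now apply HT_is_tiling.
  - now rewrite length_map, length_seq.
  - rewrite <- (Real_width HR). now apply heavy_front.
  - destruct (Real_singular HR) as [ps [P1 [P2 P3]]]. exists ps. repeat split; auto.
    + intros Hp. apply singular_corners; auto. now apply P3.
    + intros Hp. apply P3. now apply singular_corners.
Qed.

Arguments Real_good {c w}.

(** * Tilings with the same word are equivalent *)

(** The comparisons asked for by [aligned_equiv], with abscissas compared at common ordinates of
    [c1] and ordinates at common abscissas of [c2], in the three-way form that survives an induction
    on the word. *)
Record aligned (c1 c2 : nat -> rect) (D : list nat) : Prop := {
  al_bounds : forall i al, In i D -> same_bounds (sidex (c1 i) al) (sidex (c2 i) al) /\
     same_bounds (sidey (c1 i) al) (sidey (c2 i) al);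
  al_x : forall i j al be, In i D -> In j D ->
     ry0 (c1 i) <= ry1 (c1 j) -> ry0 (c1 j) <= ry1 (c1 i) ->
     same_order (sidex (c1 i) al) (sidex (c1 j) be) (sidex (c2 i) al) (sidex (c2 j) be);
  al_y : forall i j al be, In i D -> In j D ->
     rx0 (c2 i) <= rx1 (c2 j) -> rx0 (c2 j) <= rx1 (c2 i) ->
     same_order (sidey (c1 i) al) (sidey (c1 j) be) (sidey (c2 i) al) (sidey (c2 j) be) }.

Lemma same_order_intro x y x' y' :
  (x < y /\ x' < y') \/ (y < x /\ y' < x') \/ (x = y /\ x' = y') -> same_order x y x' y'.
Proof. unfold same_order. lra. Qed.

Lemma same_order_sym x y x' y' : same_order x y x' y' -> same_order y x y' x'.
Proof. unfold same_order. lra. Qed.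

Lemma same_order_cases x y x' y' : same_order x y x' y' ->
  (x < y /\ x' < y') \/ (y < x /\ y' < x') \/ (x = y /\ x' = y').
Proof. unfold same_order. destruct (Rtotal_order x y) as [|[|]]; tauto. Qed.

Arguments same_order_cases {x y x' y'}.

Lemma chain_same_order c1 c2 l h1 h2 lo1 lo2 : chain c1 l h1 lo1 -> chain c2 l h2 lo2 ->
  forall i j al be, In i l -> In j l ->
    same_order (sidey (c1 i) al) (sidey (c1 j) be) (sidey (c2 i) al) (sidey (c2 j) be).
Proof.
  revert h1 h2. induction l as [|k l IH]; intros h1 h2; [easy|].
  intros [A1 [A2 A3]] [B1 [B2 B3]].
  assert (K : forall j al be, In j l ->
    same_order (sidey (c1 k) al) (sidey (c1 j) be) (sidey (c2 k) al) (sidey (c2 j) be)).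
  { intros j al be Hj.
    generalize (chain_in A3 Hj) (chain_in B3 Hj). intros HA HB.
    destruct al; [destruct be; simpl; apply same_order_intro; lra|].
    destruct l as [|k' l]; [easy|].
    destruct (same_order_cases (IH _ _ A3 B3 k' j true be (or_introl eq_refl) Hj)) as [Q|Q];
      destruct A3 as [A3 _], B3 as [B3 _]; simpl in *; apply same_order_intro; lra. }
  intros i j al be [<-|Hi] [<-|Hj].
  - apply same_order_intro. destruct al, be; simpl; lra.
  - now apply K.
  - apply same_order_sym. now apply K.
  - eapply IH; eauto.
Qed.

(** Used for the ends of new tiles, which are squeezed between the top and the bottom of the
    block. *)
Lemma same_bounds_between h h' l l' s s' :
  0 <= l <= s /\ s <= h <= 1 -> 0 <= l' <= s' /\ s' <= h' <= 1 ->
  same_bounds h h' -> same_bounds l l' ->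
  same_order h s h' s' -> same_order l s l' s' -> same_bounds s s'.
Proof.
  intros B B' [_ Hh] [Hl _] O1 O2.
  apply same_order_cases in O1. apply same_order_cases in O2.
  split; split; intros E.
  - assert (l' = 0) by (apply Hl; lra). lra.
  - assert (l = 0) by (apply Hl; lra). lra.
  - assert (h' = 1) by (apply Hh; lra). lra.
  - assert (h = 1) by (apply Hh; lra). lra.
Qed.

Section StepAligned.
Variables (cb1 c1 cb2 c2 : nat -> rect) (Db A L C N : list nat) (p : list letter).
Variables (a1 hi1 lo1 a2 hi2 lo2 : R).
Hypothesis HS1 : Step cb1 c1 Db A L C N p a1 hi1 lo1.
Hypothesis HS2 : Step cb2 c2 Db A L C N p a2 hi2 lo2.
Hypothesis (H1 : HT cb1 Db) (H2 : HT cb2 Db).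
Hypothesis (F1 : Front cb1 Db (A ++ L ++ C)) (F2 : Front cb2 Db (A ++ L ++ C)).
Hypothesis HN : forall i, In i N -> ~ In i Db.
Hypothesis HA : aligned cb1 cb2 Db.

(** Sides of old tiles are compared by the hypothesis on the base tilings, ends of [L] and [N] by
    the common pattern; the remaining pairs pass through [a] or through the extreme tiles of [L]. *)
Lemma step_aligned : aligned c1 c2 (Db ++ N).
Proof.
  assert (A1 := st_a HS1). assert (A2 := st_a HS2).
  assert (P1 := step_a_pos HS1 H1 F1 HN).
  assert (P2 := step_a_pos HS2 H2 F2 HN).
  assert (BD1 := step_bounds HS1 H1 F1 HN).
  assert (BD2 := step_bounds HS2 H2 F2 HN).
  assert (LT1 := step_lt HS1 H1 F1 HN).
  assert (LT2 := step_lt HS2 H2 F2 HN).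
  assert (Y1 := step_y HS1 H1 F1 HN).
  assert (Y2 := step_y HS2 H2 F2 HN).
  assert (X1 := step_x0 HS1 H1 F1 HN).
  assert (X2 := step_x0 HS2 H2 F2 HN).
  assert (XX1 := step_x1 HS1 H1 F1 HN).
  assert (XX2 := step_x1 HS2 H2 F2 HN).
  assert (W1 := st_new HS1). assert (W2 := st_new HS2).
  assert (NY1 := step_new_y HS1 H1 F1 HN).
  assert (NY2 := step_new_y HS2 H2 F2 HN).
  destruct (step_chain HS1 H1 F1 HN) as [_ [CL1 [_ CN1]]].
  destruct (step_chain HS2 H2 F2 HN) as [_ [CL2 [_ CN2]]].
  assert (NE := step_L_nonempty HS1 H1 F1 HN).
  assert (LD : forall i, In i L -> In i Db)
    by (intros i Hi; apply (step_in_Db HS1 H1 F1 HN); auto).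
  assert (PO : forall l n al be, In l L -> In n N ->
    same_order (sidey (c1 l) al) (sidey (c1 n) be) (sidey (c2 l) al) (sidey (c2 n) be)).
  { apply (Pat_order c1 c2 L N p hi1 hi2 hi1 hi2 lo1 lo2); auto.
    - apply HS1.
    - apply HS2.
    - intros l n L' N' -> ->. destruct CL1 as [? [? _]], CL2 as [? [? _]], CN1 as [? [? _]],
        CN2 as [? [? _]]. auto.
    - apply same_order_intro. lra. }
  assert (TOP : exists l, In l L /\ ry1 (c1 l) = hi1 /\ ry1 (c2 l) = hi2).
  { destruct L as [|l L']; [now destruct NE|]. exists l. split; [now left|].
    destruct CL1 as [? _], CL2 as [? _]. auto. }
  assert (BOT : exists l, In l L /\ ry0 (c1 l) = lo1 /\ ry0 (c2 l) = lo2).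
  { destruct (exists_last (proj1 NE)) as [L' [l E]]. exists l. rewrite E.
    split; [apply in_or_app; right; now left|]. rewrite E in CL1, CL2.
    split; eapply chain_last; eassumption. }
  destruct TOP as [lt [LT [LT_1 LT_2]]]. destruct BOT as [lb [LB [LB_1 LB_2]]].
  split.
  - intros i al Hi. apply in_app_or in Hi. destruct Hi as [Hi|Hi].
    + destruct (al_bounds _ _ _ HA i al Hi) as [B1 B2]. split.
      * destruct al; simpl in *; [|now rewrite (X1 i Hi), (X2 i Hi)].
        destruct (XX1 i Hi) as [[I1 [-> _]]|[I1 ->]], (XX2 i Hi) as [[I2 [-> _]]|[I2 ->]];
          try contradiction; auto. unfold same_bounds. lra.
      * destruct (Y1 i Hi) as [E1 E2], (Y2 i Hi) as [E3 E4].
        destruct al; simpl in *; congruence.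
    + split.
      * destruct (W1 i Hi) as [E1 E2], (W2 i Hi) as [E3 E4].
        destruct al; simpl; rewrite ?E1, ?E2, ?E3, ?E4; unfold same_bounds; lra.
      * destruct (al_bounds _ _ _ HA lt true (LD _ LT)) as [_ B1]. simpl in B1.
        destruct (al_bounds _ _ _ HA lb false (LD _ LB)) as [_ B2]. simpl in B2.
        rewrite <- (proj2 (Y1 lt (LD _ LT))), <- (proj2 (Y2 lt (LD _ LT))) in B1.
        rewrite <- (proj1 (Y1 lb (LD _ LB))), <- (proj1 (Y2 lb (LD _ LB))) in B2.
        assert (Q1 := PO lt i true al LT Hi). assert (Q2 := PO lb i false al LB Hi).
        generalize (NY1 i Hi) (NY2 i Hi). intros. simpl in Q1, Q2.
        apply (same_bounds_between (ry1 (c1 lt)) (ry1 (c2 lt)) (ry0 (c1 lb)) (ry0 (c2 lb))); auto;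
          destruct al; simpl in *; lra.
  (* The sides of tiles touching the strip fall into three classes, the same in both tilings: before
     the new segment, on it, or on the right side of the square. *)
  - assert (CLS : forall j be, In j (Db ++ N) -> ry0 (c1 j) <= hi1 -> lo1 <= ry1 (c1 j) ->
      (sidex (c1 j) be < a1 /\ sidex (c2 j) be < a2) \/
      (sidex (c1 j) be = a1 /\ sidex (c2 j) be = a2) \/
      (sidex (c1 j) be = 1 /\ sidex (c2 j) be = 1)).
    { intros j be Hj T1 T2. apply in_app_or in Hj. destruct Hj as [Hj|Hj].
      2:{ destruct (W1 j Hj), (W2 j Hj). destruct be; simpl; auto. }
      destruct (Y1 j Hj) as [E1 E2]. rewrite E1 in T1. rewrite E2 in T2.
      assert (V1 := ht_valid H1 j Hj). assert (V2 := ht_valid H2 j Hj).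
      unfold valid_rect in V1, V2.
      destruct (XX1 j Hj) as [[I1 [U1 [_ U1']]]|[I1 U1]], (XX2 j Hj) as [[I2 [U2 [_ U2']]]|[I2 U2]];
        try contradiction.
      { rewrite <- (X1 j Hj) in U1'. rewrite <- (X2 j Hj) in U2'. destruct be; simpl; lra. }
      destruct (step_touch HS1 H1 F1 HN j Hj T1 T2)
        as [T|[T|[z [Hz [Z1 [Z2 Z3]]]]]]; [contradiction| |].
      - destruct (neighbour_spec HS1 H1 F1 HN j T) as [_ [_ [? [? _]]]].
        destruct (neighbour_spec HS2 H2 F2 HN j T) as [_ [_ [? [? _]]]].
        generalize (X1 j Hj) (X2 j Hj). destruct be; simpl; lra.
      - left.
        assert (Dz : In z Db /\ rx0 (cb1 z) < a1 /\ rx0 (cb2 z) < a2).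
        { destruct Hz as [Hz|Hz].
          - split; auto. split; [now apply HS1|now apply HS2].
          - destruct (neighbour_spec HS1 H1 F1 HN z Hz) as [? [_ [? [? _]]]].
            destruct (neighbour_spec HS2 H2 F2 HN z Hz) as [? [_ [? [? _]]]].
            auto. }
        destruct Dz as [Dz [Dz1 Dz2]].
        assert (Q := al_x _ _ _ HA j z true false Hj Dz Z1 Z2).
        apply same_order_cases in Q. simpl in Q.
        generalize (X1 j Hj) (X2 j Hj). destruct be; simpl; lra. }
    assert (SPEC : forall i al, In i (Db ++ N) ->
      (lo1 <= ry0 (c1 i) /\ ry1 (c1 i) <= hi1 /\
        ((sidex (c1 i) al = a1 /\ sidex (c2 i) al = a2) \/
         (sidex (c1 i) al = 1 /\ sidex (c2 i) al = 1))) \/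
      (In i Db /\ sidex (c1 i) al = sidex (cb1 i) al /\ sidex (c2 i) al = sidex (cb2 i) al)).
    { intros i al Hi. apply in_app_or in Hi. destruct Hi as [Hi|Hi].
      - destruct al; [|right; simpl; auto].
        destruct (XX1 i Hi) as [[I1 [U1 [_ U1']]]|[I1 U1]], (XX2 i Hi) as [[I2 [U2 [_ U2']]]|[I2 U2]];
          try contradiction; [left|right; auto].
        generalize (chain_in CL1 I1). simpl. intros. lra.
      - left. generalize (NY1 i Hi). intros. destruct (W1 i Hi), (W2 i Hi).
        destruct al; simpl; lra. }
    assert (V : forall i, In i (Db ++ N) -> valid_rect (c1 i)).
    { apply (ht_valid (step_HT HS1 H1 F1 HN)). }
    intros i j al be Hi Hj T1 T2.
    assert (Vi := V i Hi). assert (Vj := V j Hj). unfold valid_rect in Vi, Vj.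
    destruct (SPEC i al Hi) as [[B1 [B2 B3]]|[B1 [B2 B3]]].
    + assert (K := CLS j be Hj). apply same_order_intro. destruct K as [K|[K|K]]; lra.
    + destruct (SPEC j be Hj) as [[C1 [C2 C3]]|[C1 [C2 C3]]].
      * assert (K := CLS i al Hi). apply same_order_intro. destruct K as [K|[K|K]]; lra.
      * rewrite B2, B3, C2, C3. destruct (Y1 i B1) as [R1 R2], (Y1 j C1) as [R3 R4].
        apply HA; auto; lra.
  (* An old tile outside [L] that reaches [a] is above or below the block. In the base tilings it
     shares an abscissa with the tiles of [L], so its ends compare with the top or bottom of the
     block. *)
  - assert (K : forall i j al be, In i N -> In j Db -> rx0 (c2 i) <= rx1 (c2 j) ->
      same_order (sidey (c1 j) al) (sidey (c1 i) be) (sidey (c2 j) al) (sidey (c2 i) be)).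
    { intros i j al be Hi Hj T.
      destruct (in_dec Nat.eq_dec j L) as [HL|HL]; [now apply PO|].
      destruct (W2 i Hi) as [E1 E2]. rewrite E1 in T.
      assert (Vj := ht_valid H2 j Hj). unfold valid_rect in Vj.
      destruct (Y1 j Hj) as [U1 U2], (Y2 j Hj) as [U3 U4].
      generalize (NY1 i Hi) (NY2 i Hi). intros.
      assert (T' : rx0 (cb2 j) <= 1 /\ a2 <= rx1 (cb2 j)).
      { destruct (XX2 j Hj) as [[? _]|[_ ?]]; [contradiction|]. lra. }
      assert (OL : forall l be, In l L -> same_order (sidey (c1 j) al) (sidey (c1 l) be)
         (sidey (c2 j) al) (sidey (c2 l) be)).
      { intros l be' Hl. destruct (XX2 l (LD l Hl)) as [[_ [_ [? ?]]]|[? _]]; [|contradiction].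
        assert (Q := al_y _ _ _ HA j l al be' Hj (LD l Hl)).
        destruct (Y1 l (LD l Hl)) as [Q1 Q2], (Y2 l (LD l Hl)) as [Q3 Q4].
        replace (sidey (c1 j) al) with (sidey (cb1 j) al) by (destruct al; simpl; congruence).
        replace (sidey (c2 j) al) with (sidey (cb2 j) al) by (destruct al; simpl; congruence).
        replace (sidey (c1 l) be') with (sidey (cb1 l) be') by (destruct be'; simpl; congruence).
        replace (sidey (c2 l) be') with (sidey (cb2 l) be') by (destruct be'; simpl; congruence).
        apply Q; lra. }
      apply same_order_intro.
      destruct (step_block_free HS2 H2 F2 HN j Hj HL T) as [B|B].
      - assert (Q1 := same_order_cases (OL lt true LT)).
        assert (Q2 := same_order_cases (PO lt i true be LT Hi)). simpl in Q1, Q2.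
        assert (hi2 <= sidey (c2 j) al) by (destruct al; simpl; lra).
        assert (sidey (c2 i) be <= hi2) by (destruct be; simpl; lra). lra.
      - assert (Q1 := same_order_cases (OL lb false LB)).
        assert (Q2 := same_order_cases (PO lb i false be LB Hi)). simpl in Q1, Q2.
        assert (sidey (c2 j) al <= lo2) by (destruct al; simpl; lra).
        assert (lo2 <= sidey (c2 i) be) by (destruct be; simpl; lra). lra. }
    intros i j al be Hi Hj T1 T2. apply in_app_or in Hi, Hj.
    destruct Hi as [Hi|Hi], Hj as [Hj|Hj].
    + assert (Q := al_y _ _ _ HA i j al be Hi Hj).
      destruct (Y1 i Hi) as [U1 U2], (Y2 i Hi) as [U3 U4].
      destruct (Y1 j Hj) as [U1' U2'], (Y2 j Hj) as [U3' U4'].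
      replace (sidey (c1 i) al) with (sidey (cb1 i) al) by (destruct al; simpl; congruence).
      replace (sidey (c2 i) al) with (sidey (cb2 i) al) by (destruct al; simpl; congruence).
      replace (sidey (c1 j) be) with (sidey (cb1 j) be) by (destruct be; simpl; congruence).
      replace (sidey (c2 j) be) with (sidey (cb2 j) be) by (destruct be; simpl; congruence).
      generalize (step_x1_le HS2 H2 F2 HN i Hi).
      generalize (step_x1_le HS2 H2 F2 HN j Hj). intros.
      rewrite (X2 i Hi) in T1. rewrite (X2 j Hj) in T2. apply Q; lra.
    + now apply K.
    + apply same_order_sym. now apply K.
    + eapply chain_same_order; eauto.
Qed.
End StepAligned.

Lemma app_split {T : Type} (A A' B B' : list T) :
  A ++ B = A' ++ B' -> length A = length A' -> A = A' /\ B = B'.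
Proof.
  revert A'. induction A as [|a A IH]; intros [|a' A'] E H; simpl in *; try easy.
  injection E as -> E. destruct (IH A' E) as [-> ->]; auto.
Qed.

Arguments app_split {T A A' B B'}.

Lemma Real_aligned c1 c2 w : Real c1 w -> Real c2 w -> aligned c1 c2 (seq 0 (size w)).
Proof.
  intros HR. revert c2. induction HR as [c k Hx Hc|cb c w u p A L C a hi lo HR IH E HA Hu HS];
    intros c2 HR2; inversion HR2 as [c' k' Hx' Hc'|cb' c' w' u' p' A' L' C' a' hi' lo' HR' E' HA' Hu' HS'];
    subst.
  - simpl. split.
    + intros i al Hi. destruct (Hx i Hi) as [U1 U2], (Hx' i Hi) as [U3 U4]. split.
      * destruct al; simpl; rewrite ?U1, ?U2, ?U3, ?U4; unfold same_bounds; lra.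
      * destruct k as [|k]; [easy|].
        assert (Q1 := chain_same_order _ _ _ _ _ _ _ Hc Hc' 0%nat i true al (or_introl eq_refl) Hi).
        assert (Hk : In k (seq 0 (S k))) by (apply in_seq; lia).
        assert (Q2 := chain_same_order _ _ _ _ _ _ _ Hc Hc' k i false al Hk Hi).
        assert (E1 : ry1 (c 0%nat) = 1 /\ ry1 (c2 0%nat) = 1) by (simpl in *; tauto).
        assert (E2 : ry0 (c k) = 0 /\ ry0 (c2 k) = 0).
        { rewrite seq_S in Hc, Hc'. split; eapply chain_last; eassumption. }
        generalize (chain_in Hc Hi) (chain_in Hc' Hi). intros.
        apply (same_bounds_between (ry1 (c 0%nat)) (ry1 (c2 0%nat)) (ry0 (c k)) (ry0 (c2 k))); auto;
          try (destruct al; simpl in *; lra); unfold same_bounds; lra.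
    + intros i j al be Hi Hj _ _. destruct (Hx i Hi) as [U1 U2], (Hx' i Hi) as [U3 U4].
      destruct (Hx j Hj) as [U1' U2'], (Hx' j Hj) as [U3' U4'].
      apply same_order_intro. destruct al, be; simpl; lra.
    + intros i j al be Hi Hj _ _. eapply chain_same_order; eauto.
  - rewrite E in E'.
    destruct (Pat_length (st_pat HS)) as [E1 _].
    destruct (Pat_length (st_pat HS')) as [E2 _].
    (* Both realizations split the same [frontier], and the word gives the lengths [u] and [lefts p]
       of the first two pieces. *)
    destruct (app_split E' ltac:(congruence)) as [<- E3].
    destruct (app_split E3 ltac:(congruence)) as [<- <-].
    destruct (Real_inv HR) as [H1 F1]. destruct (Real_inv HR') as [H2 F2].
    rewrite E in F1, F2. simpl size. rewrite seq_split.
    eapply step_aligned; eauto. apply new_fresh.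
Qed.

Lemma Real_equiv c1 c2 w : Real c1 w -> Real c2 w ->
  comb_equiv (map c1 (seq 0 (size w))) (map c2 (seq 0 (size w))).
Proof.
  intros HR1 HR2. destruct (Real_aligned _ _ _ HR1 HR2) as [B1 B2 B3].
  destruct (Real_inv HR1) as [H1 F1]. destruct (Real_inv HR2) as [H2 F2].
  apply aligned_equiv; auto; try apply H1; try apply H2.
  - intros E. destruct (ht_cover H1 1 1) as [i [Hi _]]; [lra|lra|]. now rewrite E in Hi.
  - intros i j al be Hi Hj T1 T2. generalize (B2 i j al be Hi Hj T1 T2). unfold same_order. tauto.
  - intros i j al be Hi Hj T1 T2. generalize (B3 i j al be Hi Hj T1 T2). unfold same_order. tauto.
Qed.

(** * Every word is realized *)

Lemma chain_map f c l hi lo : chain (fun i => c (f i)) l hi lo <-> chain c (map f l) hi lo.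
Proof.
  revert hi. induction l as [|i l IH]; intros hi; simpl; [tauto|]. rewrite IH. tauto.
Qed.

Lemma map_nth_seq {T : Type} (l : list T) d k :
  map (fun i => nth (i - k) l d) (seq k (length l)) = l.
Proof.
  revert k. induction l as [|x l IH]; intros k; simpl; auto.
  rewrite Nat.sub_diag. f_equal. rewrite <- (IH (S k)) at 2.
  apply map_ext_in. intros i Hi. apply in_seq in Hi.
  replace (i - k)%nat with (S (i - S k))%nat by lia. reflexivity.
Qed.

Lemma map_nth_all {T : Type} (l : list T) d : map (fun i => nth i l d) (seq 0 (length l)) = l.
Proof.
  rewrite <- (map_nth_seq l d 0) at 2. apply map_ext. intros i. now rewrite Nat.sub_0_r.
Qed.

(** The ends of the new stack are placed from top to bottom. Here [Y] is the top of the current new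
    tile, and [t] is an ordinate below which its lower end has to lie in order to come after the
    ends already treated. *)
Lemma Pat_build cb p : forall l ls h lo t Y, chain cb (l :: ls) h lo ->
  length (l :: ls) = lefts p -> ry0 (cb l) < t -> t <= Y ->
  exists rs : list (R * R), length rs = rights p /\
    forall c N, (forall i, In i (l :: ls) -> ry0 (c i) = ry0 (cb i) /\ ry1 (c i) = ry1 (cb i)) ->
      map (fun i => (ry0 (c i), ry1 (c i))) N = rs ->
      Pat c (l :: ls) N p /\ chain c N Y lo /\ (forall n N', N = n :: N' -> ry0 (c n) < t).
Proof.
  induction p as [|[] p IH]; intros l ls h lo t Y HC HL H1 H2; unfold lefts, rights in *; simpl in HL.
  - destruct ls; [|easy]. exists [(ry0 (cb l), Y)]. split; auto.
    intros c N Hc HN. destruct N as [|n [|]]; try easy. injection HN as E1 E2.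
    destruct (Hc l) as [Q1 Q2]; [now left|]. destruct HC as [_ [_ HC]]. simpl in HC.
    split; [constructor; lra|]. split; [simpl; repeat split; lra|].
    intros n' N' E. injection E as <- <-. lra.
  - destruct ls as [|l' ls]; [easy|]. destruct HC as [C1 [C2 C3]].
    destruct (IH l' ls (ry0 (cb l)) lo (ry0 (cb l)) Y) as [rs [R1 R2]]; auto;
      try (simpl in *; lia); try apply C3; try lra.
    exists rs. split; auto. intros c N Hc HN.
      destruct (R2 c N) as [P1 [P2 P3]]; auto.
      { intros i Hi. apply Hc. now right. }
      destruct (Hc l) as [Q1 Q2]; [now left|]. destruct (Hc l') as [Q3 Q4]; [right; now left|].
      destruct C3 as [C3 _].
      destruct N as [|n N]; [simpl in HN; subst rs; easy|].
      specialize (P3 n N eq_refl). split; [constructor; auto; lra|]. split; auto.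
      intros n' N' E. injection E as <- <-. lra.
  (* An end of the new stack only: any ordinate strictly between the next end of [L] and [t] would
     do. *)
  - set (t' := (ry0 (cb l) + t) / 2).
    destruct (IH l ls h lo t' t') as [rs [R1 R2]]; auto; try (unfold t'; lra).
    exists ((t', Y) :: rs). split; [simpl; lia|]. intros c N Hc HN.
    destruct N as [|n N]; [easy|]. injection HN as E1 E2 E3.
    destruct (R2 c N) as [P1 [P2 P3]]; auto.
    destruct N as [|n' N]; [simpl in E3; subst rs; easy|].
    destruct (Hc l) as [Q1 Q2]; [now left|].
    assert (P2' := P2). destruct P2' as [P4 _].
    split; [constructor; auto; try lra; unfold t' in *; lra|].
    split; [simpl; split; auto; split; [unfold t' in *; lra|]; rewrite E1; exact P2|].
    intros n1 N1 E. injection E as <- <-. unfold t' in *; lra.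
  - destruct ls as [|l' ls]; [simpl in HL; lia|]. destruct HC as [C1 [C2 C3]].
    destruct (IH l' ls (ry0 (cb l)) lo (ry0 (cb l)) (ry0 (cb l))) as [rs [R1 R2]]; auto;
      try (simpl in *; lia); try apply C3; try lra.
    exists ((ry0 (cb l), Y) :: rs). split; [simpl; lia|]. intros c N Hc HN.
      destruct N as [|n N]; [easy|]. injection HN as E1 E2 E3.
      destruct (R2 c N) as [P1 [P2 P3]]; auto.
      { intros i Hi. apply Hc. now right. }
      destruct (Hc l) as [Q1 Q2]; [now left|]. destruct (Hc l') as [Q3 Q4]; [right; now left|].
      destruct C3 as [C3 _].
      destruct N as [|n' N]; [simpl in E3; subst rs; easy|].
      assert (P2' := P2). destruct P2' as [P4 _].
      split; [constructor; auto; lra|].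
      split; [simpl; split; auto; split; [lra|]; rewrite E1; exact P2|].
      intros n1 N1 E. injection E as <- <-. lra.
Qed.

Lemma root_exists k : (1 <= k)%nat -> exists c, Real c (Root k).
Proof.
  intros Hk. set (K := INR k). assert (HK : 0 < K) by (apply lt_0_INR; lia).
  set (c := fun i => Rect 0 1 (1 - INR (S i) / K) (1 - INR i / K)).
  exists c. constructor; [simpl; auto|].
  assert (G : forall m j, chain c (seq j m) (1 - INR j / K) (1 - INR (j + m) / K)).
  { induction m as [|m IH]; intros j.
    - simpl. now rewrite Nat.add_0_r.
    - replace (j + S m)%nat with (S j + m)%nat by lia. cbn [seq chain].
      split; [reflexivity|]. split; [|apply IH].
      unfold c; cbn [ry0]. rewrite S_INR. assert (0 < / K) by now apply Rinv_0_lt_compat.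
      unfold Rdiv. nra. }
  specialize (G k 0%nat). simpl INR in G at 1. rewrite Nat.add_0_l in G.
  replace (1 - 0 / K) with 1 in G by (field; lra).
  replace (1 - INR k / K) with 0 in G by (unfold K; field; fold K; lra). exact G.
Qed.

Lemma Real_exists w : valid w -> exists c, Real c w.
Proof.
  induction w as [k|w IH u p]; intros V.
  - now apply root_exists.
  - destruct V as [V [Hu Hw]]. destruct (IH V) as [cb HR].
    destruct (Real_inv HR) as [Hb Fb].
    assert (HF : frontier w = firstn u (frontier w) ++ firstn (lefts p) (skipn u (frontier w)) ++
                   skipn (lefts p) (skipn u (frontier w))) by now rewrite !firstn_skipn.
    assert (HA : length (firstn u (frontier w)) = u).
    { rewrite length_firstn, (Real_width HR). lia. }
    assert (HL : length (firstn (lefts p) (skipn u (frontier w))) = lefts p).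
    { rewrite length_firstn, length_skipn, (Real_width HR). lia. }
    revert HF HA HL. generalize (firstn u (frontier w)) (firstn (lefts p) (skipn u (frontier w)))
      (skipn (lefts p) (skipn u (frontier w))). intros A L C HF HA HL.
    assert (CH := fr_chain Fb). rewrite HF in CH.
    apply chain_app in CH. destruct CH as [hi [CA CH]].
    apply chain_app in CH. destruct CH as [lo [CL CC]].
    (* With [a] to the right of every left abscissa, all tiles involved start before [a], whatever
       the position of the block. *)
    destruct (gap_below (map (fun i => rx0 (cb i)) (seq 0 (size w))) 1) as [x [Hx1 Hx2]]; [lra|].
    set (a := (x + 1) / 2).
    assert (Ha : forall i, In i (seq 0 (size w)) -> rx0 (cb i) < a).
    { intros i Hi. assert (rx0 (cb i) <= x); [|unfold a; lra].
      apply Hx2; [now apply (in_map (fun i => rx0 (cb i)))|].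
      assert (Vi := ht_valid Hb i Hi). unfold valid_rect in Vi. lra. }
    assert (HI : forall i, In i (A ++ L ++ C) -> In i (seq 0 (size w))).
    { rewrite <- HF. apply Fb. }
    destruct L as [|l ls]; [easy|].
    destruct (Pat_build cb p l ls hi lo hi hi) as [rs [R1 R2]]; auto; [apply CL|lra|].
    set (c := fun i => if lt_dec i (size w) then
         (if in_dec Nat.eq_dec i (l :: ls) then Rect (rx0 (cb i)) a (ry0 (cb i)) (ry1 (cb i)) else cb i)
         else Rect a 1 (fst (nth (i - size w) rs (0, 0))) (snd (nth (i - size w) rs (0, 0)))).
    assert (EL : forall i, In i (l :: ls) -> c i = Rect (rx0 (cb i)) a (ry0 (cb i)) (ry1 (cb i))).
    { intros i Hi. unfold c. assert (Hd := HI i). rewrite !in_app_iff in Hd.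
      specialize (Hd (or_intror (or_introl Hi))). apply in_seq in Hd.
      destruct lt_dec; [|lia]. destruct in_dec; [reflexivity|contradiction]. }
    assert (EN : forall i, In i (seq (size w) (rights p)) ->
      c i = Rect a 1 (fst (nth (i - size w) rs (0, 0))) (snd (nth (i - size w) rs (0, 0)))).
    { intros i Hi. apply in_seq in Hi. unfold c. destruct lt_dec; [lia|reflexivity]. }
    destruct (R2 c (seq (size w) (rights p))) as [P1 [P2 _]].
    { intros i Hi. now rewrite (EL i Hi). }
    { rewrite <- R1. rewrite <- (map_nth_seq rs (0, 0) (size w)) at 2.
      apply map_ext_in. intros i Hi. rewrite R1 in Hi. rewrite (EN i Hi). simpl.
      now destruct (nth (i - size w) rs (0, 0)). }
    exists c. apply RealExt with cb A (l :: ls) C a hi lo; auto.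
    split; auto.
    + intros i Hi Hn. apply in_seq in Hi. unfold c. destruct lt_dec; [|lia].
      destruct in_dec; [contradiction|reflexivity].
    + intros i Hi. split; auto. apply Ha, HI. rewrite !in_app_iff. auto.
    + unfold a. lra.
    + intros i Hi. now rewrite (EN i Hi).
    + intros A' z E. apply Ha, HI. rewrite E, !in_app_iff. simpl. auto.
    + intros z C' E. apply Ha, HI. rewrite E, !in_app_iff. simpl. auto.
Qed.

(** * The profile of left abscissas along the right side *)

Fixpoint ascending (c : nat -> rect) (l : list nat) : Prop :=
  match l with
  | i :: ((j :: _) as l') => rx0 (c i) <= rx0 (c j) /\ ascending c l'
  | _ => True
  end.

Lemma ascending_mid c l1 i j l2 : ascending c (l1 ++ i :: j :: l2) -> rx0 (c i) <= rx0 (c j).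
Proof.
  induction l1 as [|k l1 IH]; [simpl; tauto|].
  intros H. apply IH. simpl app in H. destruct (l1 ++ i :: j :: l2) eqn:E; [now destruct l1|].
  apply H.
Qed.

Lemma ascending_app c l1 l2 : ascending c l1 -> ascending c l2 ->
  (forall i l1' j l2', l1 = l1' ++ [i] -> l2 = j :: l2' -> rx0 (c i) <= rx0 (c j)) ->
  ascending c (l1 ++ l2).
Proof.
  intros H1 H2 H. induction l1 as [|k l1 IH]; auto.
  simpl app. destruct l1 as [|m l1].
  - simpl. destruct l2 as [|j l2]; [easy|]. split; auto. now apply (H k [] j l2).
  - simpl in H1 |- *. split; [tauto|]. apply IH; [tauto|].
    intros i l1' j l2' E1 E2. apply (H i (k :: l1') j l2'); auto. now rewrite E1.
Qed.

Lemma ascending_prefix c l1 l2 : ascending c (l1 ++ l2) -> ascending c l1.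
Proof.
  induction l1 as [|i l1 IH]; [easy|]. destruct l1 as [|j l1]; [easy|].
  simpl. tauto.
Qed.

Lemma ascending_ext c c' l : (forall i, In i l -> rx0 (c i) = rx0 (c' i)) ->
  ascending c l -> ascending c' l.
Proof.
  induction l as [|i l IH]; intros H; [easy|]. destruct l as [|j l]; [easy|].
  intros [H1 H2]. split.
  - rewrite <- !H; simpl; auto.
  - apply IH; auto. intros k Hk. apply H. now right.
Qed.

Lemma ascending_map f c l : ascending (fun i => c (f i)) l <-> ascending c (map f l).
Proof.
  induction l as [|i l IH]; [easy|]. destruct l as [|j l]; [easy|]. simpl in *. tauto.
Qed.

Lemma ascending_const c l a : (forall i, In i l -> rx0 (c i) = a) -> ascending c l.
Proof.
  induction l as [|i l IH]; intros H; [easy|]. destruct l as [|j l]; [easy|].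
  split; [rewrite !H; simpl; auto; lra|]. apply IH. intros k Hk. apply H. now right.
Qed.

(** The bound [u <= ends w] keeps the tiles above a new block inside the ascending prefix, so the
    block becomes the first peak met from the top, and the profile drops just below it. *)
Lemma Real_profile c w : Real c w -> exists G H, frontier w = G ++ H /\ length G = ends w /\
  G <> [] /\ ascending c G /\
  (forall G' g z H', G = G' ++ [g] -> H = z :: H' -> rx0 (c z) < rx0 (c g)).
Proof.
  induction 1 as [c k Hx Hc|cb c w u p A L C a hi lo HR [G [H [IH1 [IH2 [IH3 [IH4 IH5]]]]]] E HA Hu HS].
  - exists (seq 0 k), []. simpl. rewrite app_nil_r, length_seq. repeat split; auto.
    + intros E. rewrite E in Hc. simpl in Hc. lra.
    + apply ascending_const with 0. intros i Hi. now apply Hx.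
    + easy.
  - rewrite (Real_frontier_ext E HA HS).
    destruct (Real_inv HR) as [Hb Fb]. rewrite E in Fb.
    generalize (new_fresh (size w) (rights p)). intros HN.
    exists (A ++ seq (size w) (rights p)), C. rewrite app_assoc. split; auto.
    split; [rewrite length_app, length_seq; simpl; lia|].
    assert (NE := step_L_nonempty HS Hb Fb HN).
    split; [|split].
    + intros Q. apply app_eq_nil in Q. tauto.
    + apply ascending_app.
      * apply ascending_ext with cb.
        { intros i Hi. symmetry. apply (step_x0 HS Hb Fb HN).
          apply (step_in_Db HS Hb Fb HN). auto. }
        apply ascending_prefix with (skipn u G).
        replace (A ++ skipn u G) with G; auto.
        rewrite <- (firstn_skipn u G) at 1. f_equal.
        assert (Q : firstn u (frontier w) = A) by (rewrite E, <- HA, firstn_app, Nat.sub_diag,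
          firstn_all; simpl; apply app_nil_r).
        rewrite <- Q, IH1, firstn_app. replace (u - length G)%nat with 0%nat by lia.
        simpl. now rewrite app_nil_r.
      * apply ascending_const with a. intros i Hi. now apply HS.
      * intros i A' j N' E1 E2.
        assert (Hi : In i A) by (rewrite E1; apply in_or_app; right; now left).
        rewrite (step_x0 HS Hb Fb HN).
        2:{ apply (step_in_Db HS Hb Fb HN). auto. }
        destruct (st_new HS j) as [-> _].
        { rewrite E2. now left. }
        apply Rlt_le. now apply (st_above HS A' i).
    + intros G' g z C' E1 E2.
      destruct (exists_last (proj2 NE)) as [N' [n EN]]. rewrite EN, app_assoc in E1.
      apply app_inj_tail in E1. destruct E1 as [_ <-].
      destruct (st_new HS n) as [-> _].
      { rewrite EN. apply in_or_app; right; now left. }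
      rewrite (step_x0 HS Hb Fb HN).
      * now apply (st_below HS z C').
      * apply (step_in_Db HS Hb Fb HN). rewrite E2. simpl. auto.
Qed.

Arguments Real_profile {c w}.

(** A longer ascending prefix would contain the drop at [ends w]. This gives the condition
    [u <= ends w] when a word is read off a tiling by removing topmost peaks. *)
Lemma ascending_ends c w A B : Real c w -> frontier w = A ++ B -> ascending c A ->
  (length A <= ends w)%nat.
Proof.
  intros HR E HA. destruct (Real_profile HR) as [G [H [H1 [H2 [H3 [H4 H5]]]]]].
  destruct (le_lt_dec (length A) (ends w)) as [|Hlt]; auto. exfalso.
  assert (Q : firstn (length G) A = G).
  { assert (Q : firstn (length G) (frontier w) = G)
      by (rewrite H1, firstn_app, Nat.sub_diag, firstn_all; simpl; apply app_nil_r).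
    rewrite E, firstn_app in Q. replace (length G - length A)%nat with 0%nat in Q by lia.
    simpl in Q. now rewrite app_nil_r in Q. }
  assert (EA : A = G ++ skipn (length G) A) by (rewrite <- Q at 1; now rewrite firstn_skipn).
  destruct (skipn (length G) A) as [|z A'] eqn:ES.
  { rewrite app_nil_r in EA. subst A. lia. }
  destruct (exists_last H3) as [G' [g EG]].
  assert (K : rx0 (c z) < rx0 (c g)).
  { apply (H5 G' g z (A' ++ B)); auto. rewrite EA, H1, <- app_assoc in E.
    apply app_inv_head in E. exact E. }
  rewrite EA, EG, <- app_assoc in HA. simpl in HA. apply ascending_mid in HA. lra.
Qed.

(** * Every tiling realizes a word *)

Lemma filter_length_lt {T : Type} (f g : T -> bool) l x :
  (forall y, f y = true -> g y = true) -> In x l -> g x = true -> f x = false ->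
  (length (filter f l) < length (filter g l))%nat.
Proof.
  intros H. assert (LE : forall l, (length (filter f l) <= length (filter g l))%nat).
  { intros l'. induction l' as [|y l' IH]; simpl; auto. specialize (H y).
    destruct (f y), (g y); simpl; try lia; now specialize (H eq_refl). }
  induction l as [|y l IH]; [easy|]. intros [->|Hx] Hg Hf; simpl.
  - rewrite Hg, Hf. simpl. specialize (LE l). lia.
  - specialize (IH Hx Hg Hf). specialize (H y). destruct (f y), (g y); simpl; try lia;
    now specialize (H eq_refl).
Qed.

(** A descent along the line at [a]: the half-open tile at the current ordinate ends there, and its
    lower side is the next ordinate. *)
Lemma stack_exists c D a hi lo :
  HT c D -> 0 < a <= 1 -> 0 <= lo <= hi -> hi <= 1 ->
  (forall y q, lo < y <= hi -> In q D -> in_half (c q) a y ->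
     rx1 (c q) = a /\ lo <= ry0 (c q) /\ ry1 (c q) <= hi) ->
  exists S, chain c S hi lo /\ forall q, In q S -> In q D /\ rx1 (c q) = a.
Proof.
  intros H Ha Hlo Hhi HQ.
  (* The number of tiles whose top is at most [y] decreases at each step and bounds the descent. *)
  assert (W : forall m y, (length (filter (fun i => if Rle_dec (ry1 (c i)) y then true else false) D) <= m)%nat ->
    lo <= y <= hi -> (forall q, lo < y -> In q D -> in_half (c q) a y -> ry1 (c q) = y) ->
    exists S, chain c S y lo /\ forall q, In q S -> In q D /\ rx1 (c q) = a).
  { induction m as [|m IH]; intros y Hm Hy HA;
      (destruct (Req_dec y lo) as [->|N]; [exists []; split; [reflexivity|easy]|]);
      (destruct (ht_cover H a y) as [q [Hq Iq]]; [lra|lra|]);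
      assert (Eq := HA q ltac:(lra) Hq Iq); destruct (HQ y q ltac:(lra) Hq Iq) as [Xq [Q1 Q2]];
      assert (Vq := ht_valid H q Hq); unfold valid_rect in Vq.
    - exfalso. assert (LT := filter_length_lt (fun _ => false)
        (fun i => if Rle_dec (ry1 (c i)) y then true else false) D q ltac:(easy) Hq).
      specialize (LT ltac:(cbv beta; destruct Rle_dec; [reflexivity|lra]) eq_refl). lia.
    - destruct (IH (ry0 (c q))) as [S [S1 S2]].
      + assert (LT := filter_length_lt
          (fun i => if Rle_dec (ry1 (c i)) (ry0 (c q)) then true else false)
          (fun i => if Rle_dec (ry1 (c i)) y then true else false) D q).
        enough (length (filter (fun i => if Rle_dec (ry1 (c i)) (ry0 (c q)) then true else false) D)
          < length (filter (fun i => if Rle_dec (ry1 (c i)) y then true else false) D))%nat by lia.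
        apply LT; auto.
        * intros r. destruct Rle_dec; [|easy]. destruct (Rle_dec (ry1 (c r)) y); auto. lra.
        * destruct Rle_dec; auto. lra.
        * destruct Rle_dec; auto. lra.
      + lra.
      + intros r Hlr Hr Ir. destruct (HQ (ry0 (c q)) r ltac:(lra) Hr Ir) as [Xr [R1 R2]].
        unfold in_half in *.
        assert (Nr : r <> q) by (intros ->; lra).
        assert (S := ht_sep H r q Hr Hq Nr). unfold sep in S. lra.
      + exists (q :: S). split; [simpl; repeat split; auto; lra|].
        intros r [<-|Hr]; auto. }
  apply (W _ hi (Nat.le_refl _)); [lra|].
  intros q Hl Hq Iq. destruct (HQ hi q ltac:(lra) Hq Iq). unfold in_half in Iq. lra.
Qed.

Lemma Front_exists c D : HT c D -> exists F, Front c D F.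
Proof.
  intros H. destruct (stack_exists c D 1 1 0 H) as [F [F1 F2]]; try lra.
  - intros y q Hy Hq Iq. assert (V := ht_valid H q Hq). unfold valid_rect, in_half in *. lra.
  - exists F. split; auto.
    + intros i Hi. now apply F2.
    + intros i Hi. split; [|apply F2].
      intros E. assert (V := ht_valid H i Hi). unfold valid_rect in V.
      destruct (chain_cover _ _ _ _ (ry1 (c i)) F1) as [r [R1 R2]]; [lra|].
      destruct (F2 r R1) as [R3 R4]. assert (Vr := ht_valid H r R3). unfold valid_rect in Vr.
      destruct (Nat.eq_dec i r) as [->|N]; auto.
      assert (S := ht_sep H i r Hi R3 N). unfold sep in S. lra.
Qed.

Lemma Front_unique c D F F' : HT c D -> Front c D F -> Front c D F' -> F = F'.
Proof.
  intros H [A1 A2 A3] [B1 B2 B3].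
  assert (RA : forall i, In i F -> In i D /\ rx1 (c i) = 1) by (intros; split; auto; apply A2; auto).
  assert (RB : forall i, In i F' -> In i D /\ rx1 (c i) = 1) by (intros; split; auto; apply B2; auto).
  clear A1 A2 B1 B2. revert F' A3 B3 RA RB. generalize 1 at 1 2.
  intros h F'. revert h F'.
  induction F as [|i F IH]; intros h [|j F'] A3 B3 RA RB; auto.
  - apply chain_lt in B3; [|easy]. simpl in A3. lra.
  - apply chain_lt in A3; [|easy]. simpl in B3. lra.
  - destruct (RA i) as [I1 I2]; [now left|]. destruct (RB j) as [J1 J2]; [now left|].
    assert (Vi := ht_valid H i I1). assert (Vj := ht_valid H j J1). unfold valid_rect in *.
    destruct A3 as [A1 [A2 A3]], B3 as [B1 [B2 B3]].
    destruct (Nat.eq_dec i j) as [->|N].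
    + f_equal. apply (IH (ry0 (c j))); auto; intros k Hk; [apply RA|apply RB]; now right.
    + assert (S := ht_sep H i j I1 J1 N). unfold sep in S. lra.
Qed.

(** A new top tile either is a peak by itself, or joins the peak below it when the latter starts the
    list with the same abscissa, or prolongs the ascent above that peak. *)
Lemma topmost_peak c F : F <> [] -> exists A N C a, F = A ++ N ++ C /\ N <> [] /\
  (forall i, In i N -> rx0 (c i) = a) /\ ascending c A /\
  (forall A' z, A = A' ++ [z] -> rx0 (c z) < a) /\
  (forall z C', C = z :: C' -> rx0 (c z) < a).
Proof.
  induction F as [|f F IH]; [easy|]. intros _.
  destruct F as [|g F].
  { exists [], [f], [], (rx0 (c f)). repeat split; try easy.
    - now intros i [<-|[]].
    - intros A' z E. now destruct A'. }
  destruct IH as [A [N [C [a [E [H1 [H2 [H3 [H4 H5]]]]]]]]]; [easy|].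
  assert (SNG : rx0 (c g) < rx0 (c f) -> exists A N C a, f :: g :: F = A ++ N ++ C /\ N <> [] /\
    (forall i, In i N -> rx0 (c i) = a) /\ ascending c A /\
    (forall A' z, A = A' ++ [z] -> rx0 (c z) < a) /\
    (forall z C', C = z :: C' -> rx0 (c z) < a)).
  { intros L. exists [], [f], (g :: F), (rx0 (c f)). repeat split; try easy.
    - now intros i [<-|[]].
    - intros A' z E'. now destruct A'.
    - intros z C' E'. now injection E' as <- <-. }
  destruct (Rlt_dec (rx0 (c g)) (rx0 (c f))) as [L|L]; auto.
  destruct A as [|g' A].
  - destruct N as [|g' N]; [easy|]. injection E as <- E.
    assert (Eg := H2 g (or_introl eq_refl)).
    destruct (Req_dec (rx0 (c f)) (rx0 (c g))) as [Q|Q].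
    + exists [], (f :: g :: N), C, a. repeat split; try easy.
      * simpl. now rewrite E.
      * intros i [<-|Hi]; auto. lra.
    + exists [f], (g :: N), C, a. repeat split; try easy.
      * simpl. now rewrite E.
      * intros A' z E'. destruct A' as [|? [|? ?]]; try easy. injection E' as <-. lra.
  - injection E as <- E. exists (f :: g :: A), N, C, a. repeat split; auto.
    + simpl. now rewrite E.
    + lra.
    + intros A' z E'. destruct A' as [|x A']; [easy|]. injection E' as <- E'. eauto.
Qed.

Lemma Step_reindex (f : nat -> nat) cb c cb' c' Db D0 A L C N p a hi lo :
  Step cb c Db (map f A) (map f L) (map f C) (map f N) p a hi lo ->
  (forall i, In i (A ++ L ++ C) -> In i D0) ->
  (forall i, In i D0 -> In (f i) Db) ->
  (forall i j, In i D0 -> In j D0 -> f i = f j -> i = j) ->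
  (forall i, In i D0 -> cb' i = cb (f i)) ->
  (forall i, In i (D0 ++ N) -> c' i = c (f i)) ->
  Step cb' c' D0 A L C N p a hi lo.
Proof.
  intros HS HI HD HJ Hcb Hc.
  assert (HIA : forall i, In i A -> In i D0) by (intros; apply HI; rewrite !in_app_iff; auto).
  assert (HIL : forall i, In i L -> In i D0) by (intros; apply HI; rewrite !in_app_iff; auto).
  assert (HIC : forall i, In i C -> In i D0) by (intros; apply HI; rewrite !in_app_iff; auto).
  assert (HcD : forall i, In i D0 -> c' i = c (f i)) by (intros; apply Hc; rewrite in_app_iff; auto).
  assert (HcN : forall i, In i N -> c' i = c (f i)) by (intros; apply Hc; rewrite in_app_iff; auto).
  assert (CH : forall l h m, (forall i, In i l -> In i D0) -> chain cb (map f l) h m -> chain cb' l h m).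
  { intros l h m Hl Q. apply chain_map in Q. revert Q. apply chain_ext.
    intros i Hi. rewrite (Hcb i); auto. }
  destruct HS as [S1 S2 S3 S4 S5 S6 S7 S8 S9 S10 S11]. split; auto.
  - intros i Hi Hn. rewrite (HcD i Hi), (Hcb i Hi). apply S1; auto.
    intros Q. apply in_map_iff in Q. destruct Q as [j [E Hj]].
    apply HJ in E; auto. now subst.
  - intros i Hi. rewrite (HcD i), (Hcb i) by auto. apply S2. now apply in_map.
  - intros i Hi. rewrite HcN by auto. apply S4. now apply in_map.
  - intros A' z E. assert (Hz : In z D0) by (apply HIA; rewrite E, in_app_iff; simpl; auto).
    rewrite (Hcb z Hz). apply (S5 (map f A')). now rewrite E, map_app.
  - intros z C' E. assert (Hz : In z D0) by (apply HIC; rewrite E; simpl; auto).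
    rewrite (Hcb z Hz). apply (S6 _ (map f C')). now rewrite E.
  - apply chain_map in S10. revert S10. apply chain_ext. intros i Hi. now rewrite HcN.
  - apply (Pat_reindex f c); auto. intros i Hi. apply in_app_or in Hi.
    destruct Hi as [Hi|Hi]; [rewrite HcD by auto|rewrite HcN by auto]; auto.
Qed.

Section Removal.
Variables (c : nat -> rect) (D A N C : list nat) (a hi lo : R).
Hypothesis H : HT c D.
Hypothesis F : Front c D (A ++ N ++ C).
Hypothesis HN : N <> [].
Hypothesis HNa : forall i, In i N -> rx0 (c i) = a.
Hypothesis Hab : forall A' z, A = A' ++ [z] -> rx0 (c z) < a.
Hypothesis Hbe : forall z C', C = z :: C' -> rx0 (c z) < a.
Hypothesis Ha : 0 < a.
Hypothesis CA : chain c A 1 hi.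
Hypothesis CN : chain c N hi lo.
Hypothesis CC : chain c C lo 0.
#[local] Set Default Proof Using "H F HN HNa Hab Hbe Ha CA CN CC".

Lemma removal_front i : In i A \/ In i N \/ In i C -> In i D /\ rx1 (c i) = 1.
Proof.
  intros Hi. assert (I : In i (A ++ N ++ C)) by (rewrite !in_app_iff; auto).
  assert (Hd := fr_in F i I). split; auto. now apply (fr_right F).
Qed.

Lemma removal_a : a < 1.
Proof.
  destruct (nonempty_In N HN) as [n Hn]. destruct (removal_front n) as [Dn Xn]; auto.
  assert (V := ht_valid H n Dn). rewrite <- (HNa n Hn). unfold valid_rect in V. lra.
Qed.

Lemma removal_bounds : 0 <= lo /\ lo < hi /\ hi <= 1.
Proof.
  split; [eapply chain_le; exact CC|]. split; [eapply chain_lt; eauto|eapply chain_le; exact CA].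
Qed.

(** The tiles behind the block end at [a] and cannot stick out above [hi] or below [lo], since the
    neighbours of the block reach further to the left and stand in their way. *)
Lemma removal_left_stack : exists L, chain c L hi lo /\
  forall q, In q L -> In q D /\ rx1 (c q) = a.
Proof.
  assert (B := removal_bounds). assert (Ha1 := removal_a).
  apply stack_exists; auto; try lra.
  intros y q Hy Hq Iq. assert (Vq := ht_valid H q Hq). unfold valid_rect, in_half in *.
  destruct (chain_cover _ _ _ _ y CN) as [n [Hn Yn]]; [lra|].
  destruct (removal_front n) as [Dn Xn]; auto.
  assert (En := HNa n Hn).
  assert (X : rx1 (c q) = a).
  { assert (S := ht_sep H q n Hq Dn ltac:(intros ->; lra)). unfold sep in S. lra. }
  split; auto. split.
  - apply Rnot_lt_le. intros HL.
    assert (EC : C = [] \/ exists z C', C = z :: C') by (destruct C; eauto).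
    destruct EC as [EC|[z [C' EC]]].
    { rewrite EC in CC. simpl in CC. lra. }
    destruct (removal_front z) as [Dz Xz]; [rewrite EC; simpl; auto|].
    assert (Xz' := Hbe z C' EC).
    assert (Yz : ry1 (c z) = lo) by (rewrite EC in CC; apply CC).
    assert (Vz := ht_valid H z Dz). unfold valid_rect in Vz.
    assert (S := ht_sep H q z Hq Dz ltac:(intros ->; lra)). unfold sep in S. lra.
  - apply Rnot_lt_le. intros HL.
    destruct (exists_last (l := A)) as [A' [z EA]].
    { intros E. rewrite E in CA. simpl in CA. lra. }
    destruct (removal_front z) as [Dz Xz]; [rewrite EA, in_app_iff; simpl; auto|].
    assert (Xz' := Hab A' z EA).
    assert (Yz : ry0 (c z) = hi) by (rewrite EA in CA; eapply chain_last; exact CA).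
    assert (Vz := ht_valid H z Dz). unfold valid_rect in Vz.
    assert (S := ht_sep H q z Hq Dz ltac:(intros ->; lra)). unfold sep in S. lra.
Qed.

Lemma removal_step : exists cb L p,
  let Db := filter (fun i => if in_dec Nat.eq_dec i N then false else true) D in
  Step cb c Db A L C N p a hi lo /\ HT cb Db /\ Front cb Db (A ++ L ++ C).
Proof.
  assert (B := removal_bounds). assert (Ha1 := removal_a).
  destruct removal_left_stack as [L [CL HL]].
  assert (NE : L <> []) by (intros ->; simpl in CL; lra).
  destruct (Pat_exists c L N hi hi lo NE HN CL CN) as [p Hp].
  set (cb := fun i => if in_dec Nat.eq_dec i L then Rect (rx0 (c i)) 1 (ry0 (c i)) (ry1 (c i)) else c i).
  exists cb, L, p. intros Db.
  assert (ND := Front_NoDup F). apply NoDup_app_iff in ND. destruct ND as [_ [ND D1]].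
  apply NoDup_app_iff in ND. destruct ND as [_ [_ D2]].
  assert (DB : forall i, In i Db <-> In i D /\ ~ In i N).
  { intros i. unfold Db. rewrite filter_In. destruct in_dec; split; intros [? ?]; split; auto; easy. }
  assert (LN : forall i, In i L -> ~ In i A /\ ~ In i N /\ ~ In i C).
  { intros i Hi. destruct (HL i Hi) as [_ E].
    repeat split; intros Q; destruct (removal_front i); auto; lra. }
  assert (LDb : forall i, In i L -> In i Db).
  { intros i Hi. apply DB. split; [now apply HL|]. now apply LN. }
  assert (CY : forall i, ry0 (cb i) = ry0 (c i) /\ ry1 (cb i) = ry1 (c i) /\ rx0 (cb i) = rx0 (c i)).
  { intros i. unfold cb. destruct in_dec; auto. }
  assert (CX : forall i, (In i L /\ rx1 (cb i) = 1) \/ (~ In i L /\ rx1 (cb i) = rx1 (c i))).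
  { intros i. unfold cb. destruct in_dec; auto. }
  assert (CHT : forall l h m, chain c l h m -> chain cb l h m).
  { intros l h m. apply chain_ext. intros i _. destruct (CY i) as [-> [-> _]]. auto. }
  (* A tile extended from [a] to 1 could collide only to the right of [a] within the strip, and that
     region was filled by the removed block. *)
  assert (SL : forall i j, In i L -> In j Db -> ~ In j L -> sep (cb i) (cb j)).
  { intros i j Hi Hj Hn. destruct (HL i Hi) as [Di Xi]. apply DB in Hj. destruct Hj as [Dj Nj].
    assert (S := ht_sep H i j Di Dj ltac:(now intros ->)).
    destruct (CX i) as [[_ X1]|[? _]]; [|contradiction].
    destruct (CX j) as [[? _]|[_ X2]]; [contradiction|].
    destruct (CY i) as [Y1 [Y2 X3]], (CY j) as [Y3 [Y4 X4]].
    unfold sep in *. rewrite X1, X2, Y1, Y2, Y3, Y4, X3, X4.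
    destruct S as [S|[S|[S|S]]]; auto.
    assert (Vi := ht_valid H i Di). assert (Vj := ht_valid H j Dj). unfold valid_rect in *.
    generalize (chain_in CL Hi). intros BI.
    destruct (Rle_dec hi (ry0 (c j))) as [|G1]; [lra|].
    destruct (Rle_dec (ry1 (c j)) lo) as [|G2]; [lra|]. exfalso.
    generalize (Rmin_l (ry1 (c j)) hi) (Rmin_r (ry1 (c j)) hi). intros.
    assert (ry0 (c j) < Rmin (ry1 (c j)) hi) by (apply Rmin_glb_lt; lra).
    destruct (chain_cover _ _ _ _ (Rmin (ry1 (c j)) hi) CN) as [n [Nn Yn]].
    { split; [apply Rmin_glb_lt; lra|lra]. }
    destruct (removal_front n) as [Dn Xn]; auto. assert (En := HNa n Nn).
    assert (S' := ht_sep H j n Dj Dn ltac:(intros ->; contradiction)). unfold sep in S'. lra. }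
  split; [|split].
  - split; auto.
    + intros i Hi Hn. unfold cb. destruct in_dec; [contradiction|reflexivity].
    + intros i Hi. destruct (HL i Hi) as [Di Xi]. destruct (CY i) as [-> [-> ->]].
      assert (V := ht_valid H i Di). unfold valid_rect in V. split; [|lra].
      destruct (c i); simpl in *. now subst.
    + intros i Hi. split; auto. apply removal_front; auto.
    + intros A' z E. destruct (CY z) as [_ [_ ->]]. eauto.
    + intros z C' E. destruct (CY z) as [_ [_ ->]]. eauto.
  - split.
    + apply NoDup_filter. apply H.
    + intros i Hi. apply DB in Hi. destruct Hi as [Di _].
      assert (V := ht_valid H i Di). unfold valid_rect in *. destruct (CY i) as [-> [-> ->]].
      destruct (CX i) as [[_ ->]|[_ ->]]; lra.
    + intros x y Hx Hy. destruct (ht_cover H x y Hx Hy) as [i [Di [I1 I2]]].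
      destruct (in_dec Nat.eq_dec i N) as [Hi|Hi].
      * assert (En := HNa i Hi). generalize (chain_in CN Hi). intros.
        destruct (chain_cover _ _ _ _ y CL) as [l [Hl Yl]]; [lra|].
        exists l. split; auto. destruct (HL l Hl) as [Dl Xl].
        assert (V := ht_valid H l Dl). unfold valid_rect in *.
        unfold in_half. destruct (CY l) as [-> [-> ->]].
        destruct (CX l) as [[_ ->]|[? _]]; [lra|contradiction].
      * exists i. split; [now apply DB|]. unfold in_half. destruct (CY i) as [-> [-> ->]].
        destruct (CX i) as [[_ ->]|[_ ->]]; lra.
    + intros i j Hi Hj Hn.
      destruct (in_dec Nat.eq_dec i L) as [Li|Li], (in_dec Nat.eq_dec j L) as [Lj|Lj].
      * generalize (chain_sep (CHT _ _ _ CL) Li Lj Hn). unfold sep. tauto.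
      * now apply SL.
      * generalize (SL j i Lj Hi Li). unfold sep. tauto.
      * unfold cb. destruct in_dec; [contradiction|]. destruct in_dec; [contradiction|].
        apply DB in Hi, Hj. apply H; tauto.
  - split.
    + intros i. rewrite !in_app_iff. intros Q.
      assert (Q' : In i L \/ (In i A \/ In i C)) by tauto.
      destruct Q' as [Q'|Q']; auto. apply DB. split; [apply removal_front; tauto|].
      intros HI. destruct Q' as [Q'|Q'].
      * apply (D1 i Q'). rewrite in_app_iff. auto.
      * now apply (D2 i HI).
    + intros i Hi. apply DB in Hi. destruct Hi as [Di Ni].
      assert (R := fr_right F i Di). rewrite !in_app_iff in *.
      destruct (CX i) as [[Li ->]|[Li ->]]; tauto.
    + apply chain_app. exists hi. split; auto. apply chain_app. exists lo. auto.
Qed.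
End Removal.

Lemma map_eq_app3 {S T : Type} (f : S -> T) l A B C : map f l = A ++ B ++ C ->
  exists A' B' C', l = A' ++ B' ++ C' /\ map f A' = A /\ map f B' = B /\ map f C' = C.
Proof.
  intros E. apply map_eq_app in E. destruct E as [A' [l' [-> [E1 E2]]]].
  apply map_eq_app in E2. destruct E2 as [B' [C' [-> [E2 E3]]]].
  exists A', B', C'. auto.
Qed.

(** Induction on the number of tiles, removing the topmost peak. [E] lists the tiles in the order in
    which the word adds them, so the removed block goes to its end. *)
Lemma tiling_Real k : forall c D, (length D <= k)%nat -> HT c D ->
  exists w E, Permutation E D /\ size w = length D /\ Real (fun i => c (nth i E 0%nat)) w.
Proof.
  induction k as [|k IH]; intros c D Hk H.
  { destruct (ht_cover H 1 1) as [i [Hi _]]; try lra. destruct D; simpl in *; [easy|lia]. }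
  destruct (Front_exists c D H) as [F HF].
  destruct (topmost_peak c F) as [A [N [C [a [E [N1 [N2 [N3 [N4 N5]]]]]]]]].
  { intros E. assert (Q := fr_chain HF). rewrite E in Q. simpl in Q. lra. }
  assert (RX : forall i, In i F -> In i D /\ rx1 (c i) = 1).
  { intros i Hi. assert (Di := fr_in HF i Hi). split; auto. now apply HF. }
  assert (X0 : forall i, In i F -> 0 <= rx0 (c i)).
  { intros i Hi. destruct (RX i Hi) as [Di _]. assert (V := ht_valid H i Di).
    unfold valid_rect in V. lra. }
  assert (a0 : 0 <= a).
  { destruct (nonempty_In N N1) as [n Hn]. rewrite <- (N2 n Hn). apply X0. rewrite E, !in_app_iff. auto. }
  destruct (Req_dec a 0) as [Ea|Ea].
  - assert (EA : A = []).
    { destruct A as [|z A'] using rev_ind; auto. exfalso.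
      assert (rx0 (c z) < a) by now apply (N4 A').
      assert (0 <= rx0 (c z)) by (apply X0; rewrite E, !in_app_iff; simpl; auto). lra. }
    assert (EC : C = []).
    { destruct C as [|z C']; auto. exfalso.
      assert (rx0 (c z) < a) by now apply (N5 z C').
      assert (0 <= rx0 (c z)) by (apply X0; rewrite E, !in_app_iff; simpl; auto). lra. }
    subst A C. rewrite app_nil_r in E. simpl in E. subst N.
    assert (P : Permutation F D).
    { apply NoDup_Permutation; [eapply Front_NoDup; eauto|apply H|].
      intros i. split; [apply HF|]. intros Hi.
      assert (V := ht_valid H i Hi). unfold valid_rect in V.
      destruct (chain_cover _ _ _ _ (ry1 (c i)) (fr_chain HF)) as [r [R1 R2]]; [lra|].
      destruct (RX r R1) as [R3 R4]. assert (R5 := N2 r R1).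
      destruct (Nat.eq_dec i r) as [->|Nr]; auto.
      assert (S := ht_sep H i r Hi R3 Nr). unfold sep in S. lra. }
    exists (Root (length F)), F. split; auto. split; [now apply Permutation_length|].
    constructor.
    + intros i Hi. apply in_seq in Hi. assert (Hn : In (nth i F 0%nat) F) by (apply nth_In; lia).
      rewrite (N2 _ Hn). split; auto. now apply RX.
    + apply (chain_map (fun i => nth i F 0%nat)). rewrite map_nth_all. apply HF.
  - assert (CH := fr_chain HF). rewrite E in CH.
    apply chain_app in CH. destruct CH as [hi [CA CH]].
    apply chain_app in CH. destruct CH as [lo [CN CC]].
    rewrite E in HF.
    destruct (removal_step c D A N C a hi lo H HF N1 N2 N4 N5 ltac:(lra) CA CN CC)
      as [cb [L [p [HS [Hb Fb]]]]].
    set (Db := filter (fun i => if in_dec Nat.eq_dec i N then false else true) D) in *.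
    assert (DB : forall i, In i Db <-> In i D /\ ~ In i N).
    { intros i. unfold Db. rewrite filter_In. destruct in_dec; split; intros [? ?]; split; auto; easy. }
    assert (HNd : forall i, In i N -> ~ In i Db) by (intros i Hi Q; apply DB in Q; tauto).
    assert (NDN : NoDup N) by (eapply chain_NoDup; eauto).
    assert (PD : Permutation (Db ++ N) D).
    { apply NoDup_Permutation.
      - apply NoDup_app_iff. split; [apply Hb|]. split; auto. intros i Hi Q. now apply (HNd i).
      - apply H.
      - intros i. rewrite in_app_iff, DB. destruct (in_dec Nat.eq_dec i N) as [Q|Q]; [|tauto].
        assert (In i D) by (apply RX; rewrite E, !in_app_iff; auto). tauto. }
    assert (LD : (length Db + length N)%nat = length D).
    { rewrite <- length_app. now apply Permutation_length. }
    assert (LN : (1 <= length N)%nat) by (destruct N; simpl; [easy|lia]).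
    destruct (IH cb Db) as [w [Eb [PE [SZ HR]]]]; auto; [lia|].
    destruct (Pat_length (st_pat HS)) as [_ RP].
    destruct (Real_inv HR) as [Hw Fw].
    assert (LE : length Eb = size w) by (rewrite SZ; now apply Permutation_length).
    assert (NDE : NoDup Eb) by (eapply Permutation_NoDup; [apply Permutation_sym; exact PE|apply Hb]).
    assert (FF : map (fun i => nth i Eb 0%nat) (frontier w) = A ++ L ++ C).
    { apply (Front_unique cb Db); auto. split.
      - intros i Hi. apply in_map_iff in Hi. destruct Hi as [j [<- Hj]].
        apply (fr_in Fw) in Hj. apply in_seq in Hj.
        apply (Permutation_in _ PE). apply nth_In. lia.
      - intros i Hi. apply (Permutation_in _ (Permutation_sym PE)) in Hi.
        destruct (In_nth Eb i 0%nat Hi) as [j [J1 J2]].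
        assert (Hj : In j (seq 0 (size w))) by (apply in_seq; lia).
        rewrite <- J2. rewrite (fr_right Fw j Hj). rewrite in_map_iff. split; [eauto|].
        intros [j' [J3 J4]]. replace j with j'; auto.
        apply (fr_in Fw) in J4. apply in_seq in J4.
        apply (proj1 (NoDup_nth Eb 0%nat) NDE); auto. lia.
      - apply (chain_map (fun i => nth i Eb 0%nat)). apply Fw. }
    destruct (map_eq_app3 _ _ _ _ _ FF) as [A' [L' [C' [EF [EA [EL EC]]]]]].
    assert (N1' : forall i, (i < size w)%nat -> nth i (Eb ++ N) 0%nat = nth i Eb 0%nat).
    { intros i Hi. rewrite app_nth1; auto. lia. }
    assert (MA : forall l, (forall i, In i l -> In i (frontier w)) ->
      map (fun i => nth i (Eb ++ N) 0%nat) l = map (fun i => nth i Eb 0%nat) l).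
    { intros l Hl. apply map_ext_in. intros i Hi. apply N1'.
      apply Hl, (fr_in Fw), in_seq in Hi. lia. }
    exists (Ext w (length A') p), (Eb ++ N).
    split; [|split].
    + eapply perm_trans; [|exact PD]. now apply Permutation_app_tail.
    + simpl. lia.
    + apply RealExt with (fun i => cb (nth i Eb 0%nat)) A' L' C' a hi lo; auto.
      (* The tiles above the topmost peak are in ascending order, which makes the word valid. *)
      * apply (ascending_ends _ _ A' (L' ++ C') HR); auto.
        apply (ascending_map (fun i => nth i Eb 0%nat)). rewrite EA.
        apply ascending_ext with c; auto. intros i Hi. apply (step_x0 HS Hb Fb HNd).
        apply (step_in_Db HS Hb Fb HNd). auto.
      * apply (Step_reindex (fun i => nth i (Eb ++ N) 0%nat) cb c _ _ Db); auto.
        -- rewrite (MA A'), (MA L'), (MA C'), EA, EL, EC; try (intros i Hi; rewrite EF, !in_app_iff; auto).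
           replace (map (fun i => nth i (Eb ++ N) 0%nat) (seq (size w) (rights p))) with N; auto.
           rewrite <- (map_nth_seq N 0%nat (size w)) at 1. rewrite RP.
           apply map_ext_in. intros i Hi. apply in_seq in Hi.
           rewrite app_nth2 by lia. now rewrite LE.
        -- rewrite <- EF. apply Fw.
        -- intros i Hi. apply in_seq in Hi. rewrite N1' by lia.
           apply (Permutation_in _ PE), nth_In. lia.
        -- intros i j Hi Hj. apply in_seq in Hi, Hj. rewrite !N1' by lia.
           apply (proj1 (NoDup_nth Eb 0%nat) NDE); lia.
        -- intros i Hi. apply in_seq in Hi. now rewrite N1' by lia.
Qed.

(** * The word is determined by the adjacencies *)

Definition touch (p q : rect) : Prop := ry1 p = ry0 q \/ ry1 q = ry0 p.

Lemma chain_head_top c l ls h lo i : chain c (l :: ls) h lo -> In i (l :: ls) -> ry1 (c i) = h ->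
  i = l.
Proof.
  intros [H1 [H2 H3]] [<-|Hi] E; auto.
  generalize (chain_in H3 Hi). lra.
Qed.

(** Touching does not tell up from down, but the top tile is known. From there, each next tile
    touches the previous one and its image cannot have been met before, so it is the next one in the
    other stack. *)
Lemma chain_match c1 c2 phi l1 l2 h1 lo1 h2 lo2 :
  chain c1 l1 h1 lo1 -> chain c2 l2 h2 lo2 ->
  (forall i, In i l1 -> In (phi i) l2) ->
  (forall k, In k l2 -> exists i, In i l1 /\ phi i = k) ->
  (forall i j, In i l1 -> In j l1 -> phi i = phi j -> i = j) ->
  (forall i j, In i l1 -> In j l1 -> touch (c1 i) (c1 j) -> touch (c2 (phi i)) (c2 (phi j))) ->
  (forall i, In i l1 -> ry1 (c1 i) = h1 -> ry1 (c2 (phi i)) = h2) ->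
  map phi l1 = l2.
Proof.
  intros C1 C2 H1 H2 H3 H4 H5.
  assert (K : forall l f l' pre, l1 = pre ++ f :: l -> l2 = map phi pre ++ phi f :: l' ->
    map phi l = l').
  { induction l as [|g l IH]; intros f l' pre E1 E2.
    - destruct l' as [|z l']; auto. exfalso.
      destruct (H2 z) as [i [Hi Ei]]; [rewrite E2, in_app_iff; simpl; auto|].
      assert (ND := chain_NoDup _ _ _ _ C2). rewrite E2 in ND.
      apply NoDup_app_iff in ND. destruct ND as [_ [ND1 ND2]].
      rewrite E1 in Hi. apply in_app_or in Hi. destruct Hi as [Hi|[<-|[]]].
      + apply (ND2 z); [rewrite <- Ei; now apply in_map|]. simpl; auto.
      + inversion ND1 as [|? ? Q]. apply Q. rewrite Ei. now left.
    - assert (Hg : In g l1) by (rewrite E1, in_app_iff; simpl; auto).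
      assert (Hf : In f l1) by (rewrite E1, in_app_iff; simpl; auto).
      assert (Q := H1 g Hg). rewrite E2 in Q.
      assert (ND := chain_NoDup _ _ _ _ C1). rewrite E1 in ND.
      apply NoDup_app_iff in ND. destruct ND as [_ [ND1 ND2]].
      apply in_app_or in Q. destruct Q as [Q|[Q|Q]].
      + exfalso. apply in_map_iff in Q. destruct Q as [j [Ej Hj]].
        assert (Hj' : In j l1) by (rewrite E1, in_app_iff; auto).
        apply H3 in Ej; auto. subst j. apply (ND2 g Hj). simpl; auto.
      + exfalso. apply H3 in Q; auto. subst g. inversion ND1 as [|? ? Q]. apply Q. now left.
      + assert (T : touch (c1 f) (c1 g)).
        { rewrite E1 in C1. apply chain_app in C1. destruct C1 as [m [_ [_ [_ [C1 _]]]]].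
          right. exact C1. }
        apply H4 in T; auto.
        rewrite E2 in C2. apply chain_app in C2. destruct C2 as [m [_ [C3 [C4 C5]]]].
        destruct l' as [|z l']; [easy|].
        assert (Eg : phi g = z).
        { eapply chain_head_top; [exact C5|exact Q|].
          generalize (chain_in C5 Q). intros B. destruct T as [T|T]; [lra|auto]. }
        subst z. simpl. f_equal. apply (IH g l' (pre ++ [f])).
        * now rewrite <- app_assoc.
        * rewrite map_app, <- app_assoc. exact E2. }
  destruct l1 as [|f l1], l2 as [|f' l2]; auto.
  - exfalso. destruct (H2 f') as [i [[] _]]. now left.
  - exfalso. apply (H1 f). now left.
  - assert (E : phi f = f').
    { eapply chain_head_top; [exact C2|apply H1; now left|]. apply H5; [now left|apply C1]. }
    simpl. rewrite E. f_equal. apply (K l1 f l2 []); auto. simpl. now rewrite E.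
Qed.

Definition overlap (p q : rect) : Prop := ry0 p < ry1 q /\ ry0 q < ry1 p.

(** When the first tiles overlap, the next letter is seen from overlaps: for [EL] the second tile of
    [L] overlaps the first of [N], for [ER] the other way round, for [EB] neither. *)
Lemma Pat_unique c1 c2 L N p1 p2 h1 k1 lo1 h2 k2 lo2 :
  Pat c1 L N p1 -> Pat c2 L N p2 ->
  chain c1 L h1 lo1 -> chain c1 N k1 lo1 -> chain c2 L h2 lo2 -> chain c2 N k2 lo2 ->
  (forall l n, In l L -> In n N -> (overlap (c1 l) (c1 n) <-> overlap (c2 l) (c2 n))) ->
  (forall l n L' N', L = l :: L' -> N = n :: N' -> overlap (c1 l) (c1 n)) ->
  p1 = p2.
Proof.
  intros P1. revert p2 h1 k1 h2 k2.
  unfold overlap.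
  induction P1 as [l n E|l l' ls n ns p E1 E2 P1 IH|l ls n n' ns p E1 E2 P1 IH
    |l l' ls n n' ns p E1 E2 E3 P1 IH]; intros p2 h1 k1 h2 k2 P2 A1 B1 A2 B2 HO HH;
    assert (HH1 := HH _ _ _ _ eq_refl eq_refl); clear HH;
    assert (HH2 := proj1 (HO _ _ (or_introl eq_refl) (or_introl eq_refl)) HH1);
    inversion P2; subst; clear P2; auto;
    destruct A1 as [A1 [A1' A1'']], A2 as [A2 [A2' A2'']];
    destruct B1 as [B1 [B1' B1'']], B2 as [B2 [B2' B2'']];
    try (assert (Q1 := HO l' n ltac:(simpl; auto) ltac:(simpl; auto)));
    try (assert (Q2 := HO l n' ltac:(simpl; auto) ltac:(simpl; auto))).
  - f_equal. apply (IH p0 (ry0 (c1 l)) k1 (ry0 (c2 l)) k2); simpl; auto.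
    + intros i j Hi Hj. apply HO; auto. now right.
    + intros ? ? ? ? R1 R2. injection R1 as <- <-. injection R2 as <- <-.
      destruct A1'' as [? [? _]]. lra.
  - exfalso. destruct A1'' as [? [? _]], B1'' as [? [? _]], A2'' as [? [? _]], B2'' as [? [? _]]. lra.
  - exfalso. destruct A1'' as [? [? _]], B1'' as [? [? _]], A2'' as [? [? _]], B2'' as [? [? _]]. lra.
  - exfalso. destruct A1'' as [? [? _]], B1'' as [? [? _]], A2'' as [? [? _]], B2'' as [? [? _]]. lra.
  - f_equal. apply (IH p0 h1 (ry0 (c1 n)) h2 (ry0 (c2 n))); simpl; auto.
    + intros i j Hi Hj. apply HO; auto. now right.
    + intros ? ? ? ? R1 R2. injection R1 as <- <-. injection R2 as <- <-.
      destruct B1'' as [? [? _]]. lra.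
  - exfalso. destruct A1'' as [? [? _]], B1'' as [? [? _]], A2'' as [? [? _]], B2'' as [? [? _]]. lra.
  - exfalso. destruct A1'' as [? [? _]], B1'' as [? [? _]], A2'' as [? [? _]], B2'' as [? [? _]]. lra.
  - exfalso. destruct A1'' as [? [? _]], B1'' as [? [? _]], A2'' as [? [? _]], B2'' as [? [? _]]. lra.
  - f_equal. apply (IH p0 (ry0 (c1 l)) (ry0 (c1 n)) (ry0 (c2 l)) (ry0 (c2 n))); simpl; auto.
    + intros i j Hi Hj. apply HO; now right.
    + intros ? ? ? ? R1 R2. injection R1 as <- <-. injection R2 as <- <-.
      destruct A1'' as [? [? _]], B1'' as [? [? _]]. lra.
Qed.

(** * Rises and drops of the profile in terms of adjacencies *)

Lemma cover_upper c D x y : HT c D -> 0 < x <= 1 -> 0 <= y < 1 ->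
  exists i, In i D /\ rx0 (c i) < x <= rx1 (c i) /\ ry0 (c i) <= y < ry1 (c i).
Proof.
  intros H Hx Hy.
  destruct (gap_above (sides c D) y) as [h [H1 H2]]; [lra|].
  destruct (ht_cover H x ((y + h) / 2)) as [i [Hi [I1 I2]]]; [lra|lra|].
  exists i. split; auto. split; auto. destruct (in_sides c D i Hi) as [_ [_ [S3 _]]].
  split; [|lra]. apply Rnot_lt_le. intros L. specialize (H2 _ S3 L). lra.
Qed.

Section Compare.
Variables (c : nat -> rect) (D l1 l2 : list nat) (f g : nat).
Hypothesis H : HT c D.
Hypothesis F : Front c D (l1 ++ f :: g :: l2).

Lemma consecutive : In f D /\ In g D /\ rx1 (c f) = 1 /\ rx1 (c g) = 1 /\
  ry0 (c f) = ry1 (c g) /\ 0 < ry1 (c g) /\ ry0 (c f) < 1 /\ f <> g.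
Proof.
  assert (If : In f (l1 ++ f :: g :: l2)) by (rewrite in_app_iff; simpl; auto).
  assert (Ig : In g (l1 ++ f :: g :: l2)) by (rewrite in_app_iff; simpl; auto).
  assert (Df := fr_in F f If). assert (Dg := fr_in F g Ig).
  assert (Vf := ht_valid H f Df). assert (Vg := ht_valid H g Dg). unfold valid_rect in *.
  assert (C := fr_chain F). apply chain_app in C. destruct C as [m [_ [_ [_ [C _]]]]].
  repeat split; auto; try lra; try (apply (fr_right F); auto).
  intros E. rewrite E in *. lra.
Qed.

(** If [f] reaches further to the left than [g], the tile at the upper left corner of [g] fits below
    [f] and beside [g]; conversely, such a tile lies to the left of [g] and under a part of [f]. *)
Lemma ascent_iff : rx0 (c f) < rx0 (c g) <-> exists z, In z D /\ vadj (c z) (c f) /\ hadj (c z) (c g).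
Proof.
  destruct consecutive as [Df [Dg [Xf [Xg [Y [Y0 [Y1 N]]]]]]].
  assert (Vf := ht_valid H f Df). assert (Vg := ht_valid H g Dg). unfold valid_rect in *.
  split.
  - intros L. destruct (ht_cover H (rx0 (c g)) (ry1 (c g))) as [z [Dz [Z1 Z2]]]; [lra|lra|].
    exists z. split; auto.
    assert (Vz := ht_valid H z Dz). unfold valid_rect in Vz.
    assert (S1 := ht_sep H z g Dz Dg ltac:(intros ->; lra)).
    assert (S2 := ht_sep H z f Dz Df ltac:(intros ->; lra)).
    unfold sep, vadj, hadj in *. lra.
  - intros [z [Dz [V E]]]. assert (Vz := ht_valid H z Dz).
    unfold vadj, hadj, valid_rect in *. lra.
Qed.

Lemma descent_iff : rx0 (c g) < rx0 (c f) <-> exists z, In z D /\ vadj (c z) (c g) /\ hadj (c z) (c f).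
Proof.
  destruct consecutive as [Df [Dg [Xf [Xg [Y [Y0 [Y1 N]]]]]]].
  assert (Vf := ht_valid H f Df). assert (Vg := ht_valid H g Dg). unfold valid_rect in *.
  split.
  - intros L. destruct (cover_upper _ _ (rx0 (c f)) (ry0 (c f)) H) as [z [Dz [Z1 Z2]]]; [lra|lra|].
    exists z. split; auto.
    assert (Vz := ht_valid H z Dz). unfold valid_rect in Vz.
    assert (S1 := ht_sep H z g Dz Dg ltac:(intros ->; lra)).
    assert (S2 := ht_sep H z f Dz Df ltac:(intros ->; lra)).
    unfold sep, vadj, hadj in *. lra.
  - intros [z [Dz [V E]]]. assert (Vz := ht_valid H z Dz).
    unfold vadj, hadj, valid_rect in *. lra.
Qed.
End Compare.

Lemma nth_split2 (F : list nat) k : (S k < length F)%nat ->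
  exists l1 l2, F = l1 ++ nth k F 0%nat :: nth (S k) F 0%nat :: l2.
Proof.
  revert k. induction F as [|f F IH]; intros k Hk; simpl in Hk; [lia|].
  destruct k as [|k].
  - destruct F as [|g F]; simpl in Hk; [lia|]. exists [], F. reflexivity.
  - destruct (IH k) as [l1 [l2 E]]; [lia|]. exists (f :: l1), l2. simpl. f_equal. exact E.
Qed.

Lemma ascending_nth c l k : ascending c l -> (S k < length l)%nat ->
  rx0 (c (nth k l 0%nat)) <= rx0 (c (nth (S k) l 0%nat)).
Proof.
  intros HA Hk. destruct (nth_split2 l k Hk) as [l1 [l2 E]].
  rewrite E in HA. now apply ascending_mid in HA.
Qed.

Lemma ext_profile c w u p : Real c (Ext w u p) ->
  let F := frontier (Ext w u p) in let e := (u + rights p)%nat in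
  let v := fun k => rx0 (c (nth k F 0%nat)) in
  (e <= length F)%nat /\
  (forall k, (S k < e)%nat -> v k <= v (S k)) /\
  (forall k, e = S k -> (S k < length F)%nat -> v (S k) < v k) /\
  (forall k, (u <= k)%nat -> (S k < e)%nat -> v k = v (S k)) /\
  (forall k, u = S k -> v k < v (S k)).
Proof.
  intros HR F e v. assert (HR' := HR).
  destruct (Real_profile HR') as [G [H [E1 [E2 [E3 [E4 E5]]]]]].
  simpl ends in E2. fold e in E2. fold F in E1.
  inversion HR as [|cb c' w' u' p' A L C a hi lo HRb EF EA Hu HS]; subst c' w' u' p'.
  destruct (Real_inv HRb) as [Hb Fb]. rewrite EF in Fb.
  assert (HN := new_fresh (size w) (rights p)).
  assert (EF' : F = A ++ seq (size w) (rights p) ++ C)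
    by (apply (Real_frontier_ext EF EA HS)).
  split; [rewrite E1, length_app; lia|].
  split; [|split; [|split]].
  - intros k Hk. unfold v. rewrite E1, !app_nth1 by lia. apply ascending_nth; auto. lia.
  - intros k Ek Hk. destruct (exists_last E3) as [G' [g EG]].
    assert (LG : length G' = k) by (rewrite EG, length_app in E2; simpl in E2; lia).
    destruct H as [|z H']; [rewrite E1, app_nil_r in Hk; lia|].
    assert (Q := E5 G' g z H' EG eq_refl). unfold v.
    rewrite E1, EG, <- app_assoc. simpl app.
    rewrite app_nth2, app_nth2 by lia. rewrite LG, Nat.sub_diag.
    replace (S k - k)%nat with 1%nat by lia. exact Q.
  - assert (NV : forall k, (u <= k < e)%nat -> v k = a).
    { intros k Hk. unfold v. rewrite EF', app_nth2, app_nth1 by (rewrite ?length_seq; unfold e in *; lia).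
      apply (st_new HS). apply nth_In. rewrite length_seq. unfold e in *. lia. }
    intros k H1 H2. rewrite !NV by lia. reflexivity.
  - intros k Ek.
    destruct (exists_last (l := A)) as [A' [z EA']].
    { intros Q. rewrite Q in EA. simpl in EA. lia. }
    assert (LA : length A' = k) by (rewrite EA', length_app in EA; simpl in EA; lia).
    assert (V1 : v (S k) = a).
    { unfold v. rewrite EF', app_nth2, app_nth1 by (rewrite ?length_seq; unfold rights; lia).
      apply (st_new HS). apply nth_In. rewrite length_seq. unfold rights. lia. }
    assert (V2 : v k = rx0 (c z)).
    { unfold v. rewrite EF', app_nth1 by lia. rewrite EA', app_nth2 by lia.
      rewrite LA, Nat.sub_diag. reflexivity. }
    rewrite V1, V2, (step_x0 HS Hb Fb HN).
    + now apply (st_above HS A').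
    + apply (step_in_Db HS Hb Fb HN). rewrite EA', in_app_iff. simpl. auto.
Qed.

Lemma frontier_match c1 D1 F1 c2 D2 F2 phi :
  HT c1 D1 -> HT c2 D2 -> Front c1 D1 F1 -> Front c2 D2 F2 -> adj_iso c1 D1 c2 D2 phi ->
  map phi F1 = F2.
Proof.
  intros H1 H2 A B I.
  assert (RA : forall i, In i F1 -> In i D1 /\ rx1 (c1 i) = 1)
    by (intros i Hi; assert (Q := fr_in A i Hi); split; auto; now apply A).
  assert (RB : forall i, In i F2 -> In i D2 /\ rx1 (c2 i) = 1)
    by (intros i Hi; assert (Q := fr_in B i Hi); split; auto; now apply B).
  apply (chain_match c1 c2 phi F1 F2 1 0 1 0); try apply A; try apply B.
  - intros i Hi. destruct (RA i Hi) as [Di Xi]. apply (fr_right B).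
    + now apply I.
    + now apply (ai_right I).
  - intros k Hk. destruct (RB k Hk) as [Dk Xk]. destruct (ai_surj I k Dk) as [i [Di Ei]].
    exists i. split; auto. apply (fr_right A i Di). apply (ai_right I i Di).
    now rewrite Ei.
  - intros i j Hi Hj. apply (ai_inj I); now apply RA.
  - intros i j Hi Hj T. destruct (RA i Hi) as [Di Xi], (RA j Hj) as [Dj Xj].
    apply (ai_v I i j Di Dj).
    assert (Vi := ht_valid H1 i Di). assert (Vj := ht_valid H1 j Dj).
    unfold vadj, touch, valid_rect in *. lra.
  - intros i Hi. apply (ai_top I). now apply RA.
Qed.

Lemma adj_iso_ends c1 w1 u1 p1 c2 w2 u2 p2 phi :
  Real c1 (Ext w1 u1 p1) -> Real c2 (Ext w2 u2 p2) ->
  adj_iso c1 (seq 0 (size (Ext w1 u1 p1))) c2 (seq 0 (size (Ext w2 u2 p2))) phi ->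
  u1 = u2 /\ rights p1 = rights p2.
Proof.
  intros R1 R2 I.
  destruct (Real_inv R1) as [H1 F1]. destruct (Real_inv R2) as [H2 F2].
  assert (M := frontier_match _ _ _ _ _ _ _ H1 H2 F1 F2 I).
  assert (P1 := ext_profile _ _ _ _ R1). assert (P2 := ext_profile _ _ _ _ R2).
  cbv zeta in P1, P2.
  set (W1 := Ext w1 u1 p1) in *. set (W2 := Ext w2 u2 p2) in *.
  set (e1 := (u1 + rights p1)%nat) in *. set (e2 := (u2 + rights p2)%nat) in *.
  assert (LE : length (frontier W1) = length (frontier W2)) by (rewrite <- M; now rewrite length_map).
  set (v1 := fun k => rx0 (c1 (nth k (frontier W1) 0%nat))) in *.
  set (v2 := fun k => rx0 (c2 (nth k (frontier W2) 0%nat))) in *.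
  assert (CMP : forall k, (S k < length (frontier W1))%nat ->
    (v1 k < v1 (S k) <-> v2 k < v2 (S k)) /\ (v1 (S k) < v1 k <-> v2 (S k) < v2 k)).
  { intros k Hk. unfold v1, v2.
    assert (Mk : forall j, (j < length (frontier W1))%nat ->
      nth j (frontier W2) 0%nat = phi (nth j (frontier W1) 0%nat)).
    { intros j Hj. rewrite <- M. rewrite (nth_indep _ _ (phi 0%nat)) by now rewrite length_map.
      apply map_nth. }
    destruct (nth_split2 _ k Hk) as [l1 [l2 E]].
    assert (E' : frontier W2 = map phi l1 ++ nth k (frontier W2) 0%nat ::
        nth (S k) (frontier W2) 0%nat :: map phi l2).
    { rewrite !Mk by lia. rewrite <- M, E at 1. rewrite map_app. reflexivity. }
    rewrite E in F1. rewrite E' in F2.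
    destruct (consecutive _ _ _ _ _ _ H1 F1) as [Df [Dg _]].
    rewrite (ascent_iff _ _ _ _ _ _ H1 F1), (ascent_iff _ _ _ _ _ _ H2 F2),
      (descent_iff _ _ _ _ _ _ H1 F1), (descent_iff _ _ _ _ _ _ H2 F2).
    rewrite !Mk by lia.
    split; split.
    - intros [z [Dz [V E0]]]. exists (phi z). split; [now apply I|].
      split; [now apply (ai_v I)|now apply (ai_h I)].
    - intros [z [Dz [V E0]]]. destruct (ai_surj I z Dz) as [y [Dy <-]].
      exists y. split; auto.
      split; [now apply (ai_v I)|now apply (ai_h I)].
    - intros [z [Dz [V E0]]]. exists (phi z). split; [now apply I|].
      split; [now apply (ai_v I)|now apply (ai_h I)].
    - intros [z [Dz [V E0]]]. destruct (ai_surj I z Dz) as [y [Dy <-]].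
      exists y. split; auto.
      split; [now apply (ai_v I)|now apply (ai_h I)]. }
  destruct P1 as [B1 [A1 [D1 [C1 U1]]]], P2 as [B2 [A2 [D2 [C2 U2]]]].
  assert (K1 : (1 <= rights p1)%nat) by (unfold rights; lia).
  assert (K2 : (1 <= rights p2)%nat) by (unfold rights; lia).
  (* Comparisons of consecutive left abscissas agree in both tilings, and the first strict drop
     gives the end of the block. *)
  assert (EE : e1 = e2).
  { destruct (lt_eq_lt_dec e1 e2) as [[L|L]|L]; auto; exfalso.
    - destruct e1 as [|k] eqn:Ek; [unfold e1 in Ek; lia|].
      specialize (D1 k eq_refl ltac:(lia)). specialize (A2 k ltac:(lia)).
      destruct (CMP k) as [_ Q]; [lia|]. apply Q in D1. lra.
    - destruct e2 as [|k] eqn:Ek; [unfold e2 in Ek; lia|].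
      specialize (D2 k eq_refl ltac:(lia)). specialize (A1 k ltac:(lia)).
      destruct (CMP k) as [_ Q]; [lia|]. apply Q in D2. lra. }
  enough (u1 = u2) by (split; unfold e1, e2 in *; lia).
  (* The strict rise before one block would fall into the constant part of the other. *)
  destruct (lt_eq_lt_dec u1 u2) as [[L|L]|L]; auto; exfalso.
  - destruct u2 as [|k]; [lia|]. specialize (U2 k eq_refl).
    specialize (C1 k ltac:(lia) ltac:(unfold e1, e2 in *; lia)).
    destruct (CMP k) as [Q _]; [unfold e1, e2 in *; lia|]. apply Q in U2. lra.
  - destruct u1 as [|k]; [lia|]. specialize (U1 k eq_refl).
    specialize (C2 k ltac:(lia) ltac:(unfold e1, e2 in *; lia)).
    destruct (CMP k) as [Q _]; [unfold e1, e2 in *; lia|]. apply Q in U1. lra.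
Qed.

(** * An adjacency isomorphism and the removal of the last blocks *)

Section Restrict.
Variables (cb1 c1 cb2 c2 : nat -> rect) (Db1 A1 L1 C1 N1 Db2 A2 L2 C2 N2 : list nat).
Variables (p1 p2 : list letter) (a1 hi1 lo1 a2 hi2 lo2 : R) (phi : nat -> nat).
Hypothesis HS1 : Step cb1 c1 Db1 A1 L1 C1 N1 p1 a1 hi1 lo1.
Hypothesis HS2 : Step cb2 c2 Db2 A2 L2 C2 N2 p2 a2 hi2 lo2.
Hypothesis (H1 : HT cb1 Db1) (H2 : HT cb2 Db2).
Hypothesis (F1 : Front cb1 Db1 (A1 ++ L1 ++ C1)) (F2 : Front cb2 Db2 (A2 ++ L2 ++ C2)).
Hypothesis (HN1 : forall i, In i N1 -> ~ In i Db1) (HN2 : forall i, In i N2 -> ~ In i Db2).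
Hypothesis I : adj_iso c1 (Db1 ++ N1) c2 (Db2 ++ N2) phi.
Hypothesis (EA : map phi A1 = A2) (EN : map phi N1 = N2) (EC : map phi C1 = C2).
#[local] Set Default Proof Using "HS1 HS2 H1 H2 F1 F2 HN1 HN2 I EA EN EC".

Lemma restrict_new i : In i (Db1 ++ N1) -> (In i N1 <-> In (phi i) N2).
Proof.
  intros Hi. rewrite <- EN, in_map_iff. split; [eauto|].
  intros [j [E Hj]]. apply (ai_inj I) in E; auto; [now subst|apply in_or_app; auto].
Qed.

Lemma restrict_old i : In i (Db1 ++ N1) -> (In i Db1 <-> In (phi i) Db2).
Proof.
  intros Hi. assert (Q := restrict_new i Hi). assert (J := ai_in I i Hi).
  apply in_app_or in Hi, J. generalize (HN1 i) (HN2 (phi i)). tauto.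
Qed.

Lemma restrict_left i : In i (Db1 ++ N1) -> (In i L1 <-> In (phi i) L2).
Proof.
  intros Hi. assert (J := ai_in I i Hi).
  rewrite (step_left_adj HS1 H1 F1 HN1 i Hi).
  rewrite (step_left_adj HS2 H2 F2 HN2 (phi i) J).
  split.
  - intros [n [Hn E]]. assert (Dn : In n (Db1 ++ N1)) by (apply in_or_app; auto).
    exists (phi n). split; [now apply restrict_new|]. now apply (ai_h I).
  - intros [n [Hn E]]. assert (Dn : In n (Db2 ++ N2)) by (apply in_or_app; auto).
    destruct (ai_surj I n Dn) as [m [Dm <-]].
    exists m. split; [now apply restrict_new|]. now apply (ai_h I).
Qed.

(** By [chain_match], once the top tile of the stack is recognized: it is vertically adjacent to the
    neighbour above the block, or on the top side of the square when there is none. *)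
Lemma restrict_match : map phi L1 = L2.
Proof.
  destruct (step_chain HS1 H1 F1 HN1) as [CA1 [CL1 [_ CN1]]].
  destruct (step_chain HS2 H2 F2 HN2) as [CA2 [CL2 [_ CN2]]].
  assert (A1' := st_a HS1).
  assert (XL : forall i, In i L1 -> In i Db1 /\ rx0 (c1 i) < a1 /\ rx1 (c1 i) = a1).
  { intros i Hi. assert (Di : In i Db1) by (apply (step_in_Db HS1 H1 F1 HN1); auto).
    split; auto. destruct (st_left HS1 i Hi) as [-> ?]. auto. }
  assert (DL : forall i, In i L1 -> In i (Db1 ++ N1)) by (intros i Hi; apply in_or_app; left; now apply XL).
  apply (chain_match c1 c2 phi L1 L2 hi1 lo1 hi2 lo2); auto.
  - intros i Hi. now apply restrict_left; auto.
  - intros k Hk. assert (Dk : In k (Db2 ++ N2)).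
    { apply in_or_app; left. apply (step_in_Db HS2 H2 F2 HN2); auto. }
    destruct (ai_surj I k Dk) as [i [Di <-]]. exists i. split; auto. now apply restrict_left.
  - intros i j Hi Hj. apply (ai_inj I); auto.
  - intros i j Hi Hj T. apply (ai_v I i j); auto.
    destruct (XL i Hi) as [_ [? ?]], (XL j Hj) as [_ [? ?]]. unfold vadj, touch in *. lra.
  - intros i Hi E.
    assert (JL : In (phi i) L2) by (apply restrict_left; auto).
    generalize (chain_in CL2 JL). intros B2.
    destruct (list_eq_dec Nat.eq_dec A1 []) as [E0|E0].
    + rewrite E0 in *. simpl in EA. subst A2. simpl in CA1, CA2. rewrite <- CA2.
      apply (ai_top I); auto. congruence.
    + destruct (exists_last E0) as [A' [U EU]].
      assert (NU : neighbour A1 C1 U) by (left; eauto).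
      destruct (neighbour_spec HS1 H1 F1 HN1 U NU) as [DU [_ [U1 [U2 U3]]]].
      assert (YU : ry0 (c1 U) = hi1) by (rewrite EU in CA1; eapply chain_last; exact CA1).
      assert (EA2 : A2 = map phi A' ++ [phi U]) by (rewrite <- EA, EU, map_app; reflexivity).
      assert (YU2 : ry0 (c2 (phi U)) = hi2) by (rewrite EA2 in CA2; eapply chain_last; exact CA2).
      assert (JU : In (phi U) A2) by (rewrite EA2, in_app_iff; simpl; auto).
      generalize (chain_in CA2 JU). intros BU.
      assert (V : vadj (c1 U) (c1 i)).
      { destruct (XL i Hi) as [_ [? ?]]. rewrite <- U3 in *. unfold vadj. lra. }
      apply (ai_v I) in V; auto; [|apply in_or_app; auto].
      unfold vadj in V. lra.
Qed.

(** Between [L] and [N], overlap of ordinates is the same as horizontal adjacency, so [Pat_unique]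
    applies after transporting one tiling along [phi]. *)
Lemma restrict_pattern : p1 = p2.
Proof.
  destruct (step_chain HS1 H1 F1 HN1) as [CA1 [CL1 [_ CN1]]].
  destruct (step_chain HS2 H2 F2 HN2) as [CA2 [CL2 [_ CN2]]].
  assert (EL := restrict_match).
  assert (HA : forall (cb c : nat -> rect) Db A L C N p a hi lo, Step cb c Db A L C N p a hi lo ->
    forall l n, In l L -> In n N -> (hadj (c l) (c n) <-> overlap (c l) (c n))).
  { intros cb c Db A L C N p a hi lo HS l n Hl Hn.
    destruct (st_left HS l Hl) as [E _].
    destruct (st_new HS n Hn) as [E' _].
    assert (rx1 (c l) = rx0 (c n)) by now rewrite E, E'.
    unfold hadj, overlap. tauto. }
  assert (DL : forall i, In i L1 -> In i (Db1 ++ N1)).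
  { intros i Hi. apply in_or_app; left. apply (step_in_Db HS1 H1 F1 HN1); auto. }
  assert (DN : forall i, In i N1 -> In i (Db1 ++ N1)) by (intros; apply in_or_app; auto).
  apply (Pat_unique c1 (fun i => c2 (phi i)) L1 N1 p1 p2 hi1 hi1 lo1 hi2 hi2 lo2); auto.
  - apply HS1.
  - apply (Pat_reindex phi c2); auto. rewrite EL, EN. apply HS2.
  - apply (chain_map phi). now rewrite EL.
  - apply (chain_map phi). now rewrite EN.
  - intros l n Hl Hn. rewrite <- (HA _ _ _ _ _ _ _ _ _ _ _ HS1 l n Hl Hn).
    rewrite <- (HA _ _ _ _ _ _ _ _ _ _ _ HS2 (phi l) (phi n)).
    + apply (ai_h I); auto.
    + apply restrict_left; auto.
    + apply restrict_new; auto.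
  - intros l n L' N' E1 E2. rewrite E1 in CL1. rewrite E2 in CN1.
    destruct CL1 as [? [? _]], CN1 as [? [? _]]. unfold overlap. lra.
Qed.

Lemma restrict_iso : adj_iso cb1 Db1 cb2 Db2 phi.
Proof.
  assert (D1 : forall i, In i Db1 -> In i (Db1 ++ N1)) by (intros; apply in_or_app; auto).
  assert (D2 : forall i, In i Db1 -> In (phi i) Db2) by (intros i Hi; apply restrict_old; auto).
  split; auto.
  - intros i j Hi Hj. apply (ai_inj I); auto.
  - intros k Hk. destruct (ai_surj I k) as [i [Hi <-]]; [apply in_or_app; auto|].
    exists i. split; auto. now apply restrict_old.
  - intros i j Hi Hj. rewrite <- (step_hadj HS1 H1 F1 HN1) by auto.
    rewrite <- (step_hadj HS2 H2 F2 HN2) by auto.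
    apply (ai_h I); auto.
  - intros i j Hi Hj. rewrite <- (step_vadj HS1 H1 F1 HN1) by auto.
    rewrite <- (step_vadj HS2 H2 F2 HN2) by auto.
    apply (ai_v I); auto.
  - intros i Hi. rewrite (fr_right F1 i Hi), (fr_right F2 (phi i) (D2 i Hi)).
    rewrite <- EA, <- restrict_match, <- EC, <- !map_app, in_map_iff. split; [eauto|].
    intros [j [E Hj]]. apply (ai_inj I) in E; auto; [now subst|].
    apply D1. now apply (fr_in F1).
  - intros i Hi. destruct (step_y HS1 H1 F1 HN1 i Hi) as [_ <-].
    destruct (step_y HS2 H2 F2 HN2 (phi i) (D2 i Hi)) as [_ <-].
    apply (ai_top I); auto.
Qed.
End Restrict.

(** Together with the next lemma, it tells an [Ext] from a [Root]. *)
Lemma ext_hadj c w u p : Real c (Ext w u p) ->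
  exists i j, In i (seq 0 (size (Ext w u p))) /\ In j (seq 0 (size (Ext w u p))) /\
    hadj (c i) (c j).
Proof.
  intros HR. inversion HR as [|cb c' w' u' p' A L C a hi lo HRb EF EA Hu HS]; subst c' w' u' p'.
  destruct (Real_inv HRb) as [Hb Fb]. rewrite EF in Fb.
  assert (HN := new_fresh (size w) (rights p)).
  destruct (step_L_nonempty HS Hb Fb HN) as [NE _].
  destruct (nonempty_In L NE) as [l Hl]. simpl size. rewrite seq_split.
  assert (Dl : In l (seq 0 (size w) ++ seq (size w) (rights p))).
  { apply in_or_app; left. apply (step_in_Db HS Hb Fb HN); auto. }
  destruct (proj1 (step_left_adj HS Hb Fb HN l Dl) Hl) as [n [Hn E]].
  exists l, n. repeat split; auto; try apply E. apply in_or_app; auto.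
Qed.

Lemma root_no_hadj c k i j : Real c (Root k) -> In i (seq 0 k) -> In j (seq 0 k) ->
  ~ hadj (c i) (c j).
Proof.
  intros HR Hi Hj. inversion HR as [c' k' Hx _|]; subst.
  destruct (Hx i Hi), (Hx j Hj). unfold hadj. lra.
Qed.

(** The word is read from its end: the right side gives the position and size of the last block, the
    adjacencies to it give the pattern, and the isomorphism restricts to the tilings without it. *)
Lemma adj_iso_word c1 w1 : Real c1 w1 -> forall c2 w2 phi, Real c2 w2 ->
  adj_iso c1 (seq 0 (size w1)) c2 (seq 0 (size w2)) phi -> w1 = w2.
Proof.
  induction w1 as [k1|w1 IH u1 p1] in c1 |- *; intros R1 c2 w2 phi R2 I;
    destruct w2 as [k2|w2 u2 p2].
  - destruct (Real_inv R1) as [H1 F1]. destruct (Real_inv R2) as [H2 F2].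
    assert (M := frontier_match _ _ _ _ _ _ _ H1 H2 F1 F2 I).
    f_equal. apply (f_equal (@length nat)) in M. rewrite length_map in M. simpl in M.
    now rewrite !length_seq in M.
  - exfalso. destruct (ext_hadj _ _ _ _ R2) as [i [j [Hi [Hj E]]]].
    destruct (ai_surj I i Hi) as [i' [Hi' <-]].
    destruct (ai_surj I j Hj) as [j' [Hj' <-]].
    apply (ai_h I) in E; auto. now apply (root_no_hadj c1 k1 i' j').
  - exfalso. destruct (ext_hadj _ _ _ _ R1) as [i [j [Hi [Hj E]]]].
    apply (ai_h I) in E; auto.
    apply (root_no_hadj c2 k2 (phi i) (phi j)) in E; auto; now apply I.
  - destruct (adj_iso_ends _ _ _ _ _ _ _ _ _ R1 R2 I) as [Eu Er]. subst u2.
    destruct (Real_inv R1) as [G1 K1]. destruct (Real_inv R2) as [G2 K2].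
    assert (M := frontier_match _ _ _ _ _ _ _ G1 G2 K1 K2 I).
    inversion R1 as [|cb1 c1' w1' u1' p1' A1 L1 C1 a1 hi1 lo1 Rb1 E1 EA1 Hu1 HS1];
      subst c1' w1' u1' p1'.
    inversion R2 as [|cb2 c2' w2' u2' p2' A2 L2 C2 a2 hi2 lo2 Rb2 E2 EA2 Hu2 HS2];
      subst c2' w2' u2' p2'.
    destruct (Real_inv Rb1) as [H1 F1]. destruct (Real_inv Rb2) as [H2 F2].
    rewrite E1 in F1. rewrite E2 in F2.
    assert (HN1 := new_fresh (size w1) (rights p1)). assert (HN2 := new_fresh (size w2) (rights p2)).
    rewrite (Real_frontier_ext E1 EA1 HS1) in M.
    rewrite (Real_frontier_ext E2 EA2 HS2) in M.
    rewrite !map_app in M.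
    destruct (app_split M) as [MA M']; [rewrite length_map; congruence|].
    destruct (app_split M') as [MN MC]; [rewrite length_map, !length_seq; congruence|].
    simpl size in I. rewrite !seq_split in I.
    assert (EP : p1 = p2) by (eapply restrict_pattern; eassumption).
    assert (J : adj_iso cb1 (seq 0 (size w1)) cb2 (seq 0 (size w2)) phi)
      by (eapply restrict_iso; eassumption).
    rewrite (IH _ Rb1 _ _ _ Rb2 J), EP. reflexivity.
Qed.

Lemma comb_equiv_word c1 w1 c2 w2 : Real c1 w1 -> Real c2 w2 ->
  comb_equiv (map c1 (seq 0 (size w1))) (map c2 (seq 0 (size w2))) -> w1 = w2.
Proof.
  intros R1 R2 E. destruct (Real_inv R1) as [H1 _]. destruct (Real_inv R2) as [H2 _].
  destruct (comb_equiv_adj_iso _ _ _ _ H1 H2 E) as [phi I].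
  eapply adj_iso_word; eauto.
Qed.

(** * Sums over words *)

Section Counting.
#[local] Open Scope Z_scope.

Definition zs {T : Type} (f : T -> Z) (l : list T) : Z := fold_right (fun x s => f x + s) 0 l.

Lemma zs_app {T} (f : T -> Z) l1 l2 : zs f (l1 ++ l2) = zs f l1 + zs f l2.
Proof. induction l1 as [|x l1 IH]; simpl; lia. Qed.

Lemma zs_ext_in {T} (f g : T -> Z) l : (forall x, In x l -> f x = g x) -> zs f l = zs g l.
Proof.
  induction l as [|x l IH]; intros H; simpl; auto.
  rewrite H by now left. rewrite IH; auto. intros y Hy. apply H. now right.
Qed.

Lemma zs_add {T} (f g : T -> Z) l : zs (fun x => f x + g x) l = zs f l + zs g l.
Proof. induction l as [|x l IH]; simpl; lia. Qed.

Lemma zs_scal {T} (f : T -> Z) k l : zs (fun x => k * f x) l = k * zs f l.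
Proof. induction l as [|x l IH]; simpl; lia. Qed.

Lemma zs_zero {T} (f : T -> Z) l : (forall x, In x l -> f x = 0) -> zs f l = 0.
Proof.
  induction l as [|x l IH]; intros H; simpl; auto.
  rewrite H by now left. rewrite IH; auto. intros y Hy. apply H. now right.
Qed.

Lemma zs_flat_map {S T} (f : T -> Z) (g : S -> list T) l :
  zs f (flat_map g l) = zs (fun x => zs f (g x)) l.
Proof. induction l as [|x l IH]; simpl; auto. rewrite zs_app, IH. reflexivity. Qed.

Lemma zs_map {S T} (f : T -> Z) (g : S -> T) l : zs f (map g l) = zs (fun x => f (g x)) l.
Proof. induction l as [|x l IH]; simpl; auto. rewrite IH. reflexivity. Qed.

Lemma zs_filter {T} (f : T -> Z) (b : T -> bool) l :
  zs f (filter b l) = zs (fun x => if b x then f x else 0) l.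
Proof. induction l as [|x l IH]; simpl; auto. destruct (b x); simpl; rewrite IH; lia. Qed.

Lemma zs_swap {S T} (f : S -> T -> Z) l1 l2 :
  zs (fun x => zs (f x) l2) l1 = zs (fun y => zs (fun x => f x y) l1) l2.
Proof.
  induction l1 as [|x l1 IH]; simpl.
  - symmetry. now apply zs_zero.
  - rewrite IH, <- zs_add. reflexivity.
Qed.

Lemma zs_length {T} (b : T -> bool) l :
  Z.of_nat (length (filter b l)) = zs (fun x => if b x then 1 else 0) l.
Proof. induction l as [|x l IH]; simpl; auto. destruct (b x); simpl length; lia. Qed.

Lemma zs_single (g : nat -> Z) x a n :
  zs (fun i => if (x =? i)%nat then g i else 0) (seq a n) =
  if ((a <=? x) && (x <? a + n))%nat then g x else 0.
Proof.
  revert a. induction n as [|n IH]; intros a; simpl.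
  - destruct (Nat.leb_spec a x), (Nat.ltb_spec x (a + 0)); simpl; auto; lia.
  - rewrite IH. destruct (Nat.eqb_spec x a), (Nat.leb_spec (S a) x), (Nat.leb_spec a x),
      (Nat.ltb_spec x (S a + n)), (Nat.ltb_spec x (a + S n)); simpl; try lia; subst; lia.
Qed.

Lemma zs_seq_extend (f : nat -> Z) a n n' : (n <= n')%nat ->
  (forall i, (a + n <= i)%nat -> f i = 0) -> zs f (seq a n') = zs f (seq a n).
Proof.
  intros Hn H. replace n' with (n + (n' - n))%nat by lia. rewrite seq_app, zs_app.
  rewrite (zs_zero f (seq (a + n) _)); [lia|]. intros i Hi. apply in_seq in Hi. apply H. lia.
Qed.

(** * Binomial coefficients and numbers of sequences of patterns *)

Lemma binom_gt n k : (n < k)%nat -> binom n k = 0%nat.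
Proof.
  revert k. induction n as [|n IH]; intros [|k] H; simpl; try lia.
  rewrite !IH; lia.
Qed.

Lemma binom_0 n : binom n 0 = 1%nat.
Proof. now destruct n. Qed.

Lemma binZ_0 n : 0 <= n -> binZ n 0 = 1.
Proof.
  intros H. unfold binZ. destruct (Z.leb_spec 0 n); [|lia]. simpl. now rewrite binom_0.
Qed.

Lemma binZ_out n k : n < 0 \/ k < 0 \/ n < k -> binZ n k = 0.
Proof.
  intros H. unfold binZ. destruct (Z.leb_spec 0 n), (Z.leb_spec 0 k); simpl; auto.
  rewrite binom_gt; lia.
Qed.

Lemma binZ_pascal n k : n <> 0 \/ k <> 0 -> binZ n k = binZ (n - 1) (k - 1) + binZ (n - 1) k.
Proof.
  intros H.
  destruct (Z_lt_dec n 0); [rewrite !binZ_out by lia; lia|].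
  destruct (Z_lt_dec k 0); [rewrite !binZ_out by lia; lia|].
  destruct (Z.eq_dec n 0); [rewrite !binZ_out by lia; lia|].
  destruct (Z.eq_dec k 0) as [->|].
  { rewrite (binZ_out (n - 1) (0 - 1)), !binZ_0 by lia. lia. }
  unfold binZ. destruct (Z.leb_spec 0 n), (Z.leb_spec 0 k), (Z.leb_spec 0 (n - 1)),
    (Z.leb_spec 0 (k - 1)); try lia. simpl andb. cbv iota.
  replace (Z.to_nat n) with (S (Z.to_nat (n - 1))) by lia.
  replace (Z.to_nat k) with (S (Z.to_nat (k - 1))) by lia. simpl binom. lia.
Qed.

(* [multi k a b r] is the number of words with [a], [b], [r], [k] letters of four kinds. *)
Definition multi (k a b r : Z) : Z :=
  binZ (a + b + k) k * binZ (a + b) b * binZ (r + a + b + k) (a + b + k).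

(* The number of sequences of [c] patterns with [a] letters [EL], [b] letters [EB]
   and [r] letters [ER] in total. *)
Definition Q (c : nat) (a b r : Z) : Z :=
  match c with
  | O => if (a =? 0) && (b =? 0) && (r =? 0) then 1 else 0
  | S k => multi (Z.of_nat k) a b r
  end.

Lemma multi_neg k a b r : 0 <= k -> a < 0 \/ b < 0 \/ r < 0 -> multi k a b r = 0.
Proof.
  intros Hk H. unfold multi.
  destruct (Z_lt_dec b 0); [rewrite (binZ_out (a + b) b) by lia; lia|].
  destruct (Z_lt_dec a 0); [rewrite (binZ_out (a + b) b) by lia; lia|].
  rewrite (binZ_out (r + a + b + k)) by lia. lia.
Qed.

Lemma Q_neg c a b r : a < 0 \/ b < 0 \/ r < 0 -> Q c a b r = 0.
Proof.
  intros H. destruct c as [|k]; simpl; [|apply multi_neg; lia].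
  destruct (Z.eqb_spec a 0), (Z.eqb_spec b 0), (Z.eqb_spec r 0); simpl; auto; lia.
Qed.

(** Nonempty words are classified by one extremal letter; in the formula this is Pascal's rule,
    applied to each factor in turn. *)
Lemma multi_rec k a b r : 0 <= a -> 0 <= b -> 0 <= r -> 0 <= k -> 0 < a + b + k ->
  multi k a b r = multi (k - 1) a b r + multi k (a - 1) b r + multi k a (b - 1) r +
    multi k a b (r - 1).
Proof.
  intros Ha Hb Hr Hk Hn. unfold multi.
  replace (a + b + (k - 1)) with (a + b + k - 1) by lia.
  replace (a - 1 + b + k) with (a + b + k - 1) by lia.
  replace (a + (b - 1) + k) with (a + b + k - 1) by lia.
  replace (r + a + b + (k - 1)) with (r + a + b + k - 1) by lia.
  replace (r + (a - 1) + b + k) with (r + a + b + k - 1) by lia.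
  replace (r + a + (b - 1) + k) with (r + a + b + k - 1) by lia.
  replace (r - 1 + a + b + k) with (r + a + b + k - 1) by lia.
  replace (a - 1 + b) with (a + b - 1) by lia.
  replace (a + (b - 1)) with (a + b - 1) by lia.
  rewrite (binZ_pascal (r + a + b + k)) by lia.
  rewrite Z.mul_add_distr_l. f_equal.
  rewrite (binZ_pascal (a + b + k) k) by lia.
  destruct (Z.eq_dec (a + b) 0) as [E|E].
  - assert (a = 0) by lia. assert (b = 0) by lia. subst.
    rewrite (binZ_out (0 + 0 + k - 1) k) by lia.
    rewrite (binZ_out (0 + 0 - 1) 0), (binZ_out (0 + 0 - 1) (0 - 1)) by lia. ring.
  - rewrite (binZ_pascal (a + b) b) by lia. ring.
Qed.


Lemma multi_minus1 a b r : multi (-1) a b r = 0.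
Proof. unfold multi. rewrite (binZ_out _ (-1)) by lia. ring. Qed.

(** Either the first of the [S c] patterns is empty and [c] patterns remain, or removing its first
    letter lowers one of the three totals. *)
Lemma Q_rec c a b r : 0 <= a -> 0 <= b -> 0 <= r ->
  Q (S c) a b r = Q c a b r + Q (S c) (a - 1) b r + Q (S c) a (b - 1) r + Q (S c) a b (r - 1).
Proof.
  intros Ha Hb Hr.
  destruct (Z.eq_dec (a + b + Z.of_nat c) 0) as [E|E].
  - assert (a = 0) by lia. assert (b = 0) by lia. assert (c = 0%nat) by lia. subst.
    assert (M0 : forall r, 0 <= r -> Q 1 0 0 r = 1).
    { intros r' Hr'. unfold Q, multi. change (Z.of_nat 0) with 0. change (0 + 0 + 0) with 0.
      rewrite !binZ_0 by lia. reflexivity. }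
    rewrite (Q_neg 1 (0 - 1)), (Q_neg 1 0 (0 - 1)), (M0 r) by lia. unfold Q at 1. simpl andb.
    destruct (Z.eqb_spec r 0).
    + rewrite Q_neg by lia. lia.
    + rewrite M0 by lia. lia.
  (* For [c = 0] both sides vanish here, because [a + b > 0]; the patterns are seen as one word with
     [c - 1] separators. *)
  - assert (E' : Q c a b r = multi (Z.of_nat c - 1) a b r).
    { destruct c as [|c].
      - simpl. rewrite multi_minus1.
        destruct (Z.eqb_spec a 0), (Z.eqb_spec b 0); simpl; auto; lia.
      - unfold Q. f_equal. lia. }
    rewrite E'. unfold Q. apply multi_rec; lia.
Qed.

(** * Enumeration of patterns and words *)

Fixpoint pats (B : nat) : list (list letter) :=
  match B with
  | O => [[]]
  | S B => [] :: flat_map (fun p => [EL :: p; ER :: p; EB :: p]) (pats B)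
  end.

Definition zL p := Z.of_nat (nL p).
Definition zR p := Z.of_nat (nR p).
Definition zB p := Z.of_nat (nB p).

(** The first pattern is split off. The hypothesis ensures that [B] cuts no pattern that could
    contribute. *)
Lemma sum_pats B c a b r : a < 0 \/ b < 0 \/ r < 0 \/ a + b + r <= Z.of_nat B ->
  zs (fun p => Q c (a - zL p) (b - zB p) (r - zR p)) (pats B) = Q (S c) a b r.
Proof.
  assert (Z0 : forall a b r, Q c (a - zL []) (b - zB []) (r - zR []) = Q c a b r).
  { intros. unfold zL, zB, zR; simpl. now rewrite !Z.sub_0_r. }
  revert a b r. induction B as [|B IH]; intros a b r H.
  - simpl zs. rewrite Z0.
    destruct (Z_lt_dec a 0); [rewrite !Q_neg by lia; lia|].
    destruct (Z_lt_dec b 0); [rewrite !Q_neg by lia; lia|].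
    destruct (Z_lt_dec r 0); [rewrite !Q_neg by lia; lia|].
    rewrite Q_rec by lia. rewrite (Q_neg (S c) (a - 1)), (Q_neg (S c) a (b - 1)),
      (Q_neg (S c) a b (r - 1)) by lia. lia.
  - simpl pats. simpl zs. rewrite Z0. rewrite zs_flat_map.
    rewrite (zs_ext_in _ (fun p => Q c (a - 1 - zL p) (b - zB p) (r - zR p) +
      (Q c (a - zL p) (b - zB p) (r - 1 - zR p) + Q c (a - zL p) (b - 1 - zB p) (r - zR p)))).
    2:{ intros p _. simpl zs. rewrite Z.add_0_r.
        assert (QE : forall x x' y y' z z', x = x' -> y = y' -> z = z' -> Q c x y z = Q c x' y' z')
          by (now intros; subst).
        apply (f_equal2 Z.add); [|apply (f_equal2 Z.add)]; apply QE;
          unfold zL, zB, zR; simpl nL; simpl nB; simpl nR; lia. }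
    rewrite !zs_add. rewrite !IH by lia.
    destruct (Z_lt_dec a 0); [rewrite !Q_neg by lia; lia|].
    destruct (Z_lt_dec b 0); [rewrite !Q_neg by lia; lia|].
    destruct (Z_lt_dec r 0); [rewrite !Q_neg by lia; lia|].
    rewrite (Q_rec c a b r) by lia. lia.
Qed.

Lemma in_pats B p : In p (pats B) <-> (length p <= B)%nat.
Proof.
  revert p. induction B as [|B IH]; intros p; simpl.
  - split; [intros [<-|[]]; auto|]. destruct p; simpl; auto; lia.
  - rewrite in_flat_map. split.
    + intros [<-|[q [Hq H]]]; simpl; [lia|]. apply IH in Hq.
      destruct H as [<-|[<-|[<-|[]]]]; simpl; lia.
    + destruct p as [|x p]; [auto|]. simpl. intros H. right. exists p.
      split; [apply IH; lia|]. destruct x; auto.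
Qed.

Lemma NoDup_flat_map {S T : Type} (f : S -> list T) l :
  NoDup l -> (forall x, In x l -> NoDup (f x)) ->
  (forall x y z, In x l -> In y l -> In z (f x) -> In z (f y) -> x = y) ->
  NoDup (flat_map f l).
Proof.
  induction l as [|x l IH]; intros H1 H2 H3; simpl; [constructor|].
  inversion H1 as [|? ? N1 N2]; subst. apply NoDup_app_iff. split; [apply H2; now left|]. split.
  - apply IH; auto; [intros; apply H2; now right|]. intros; eapply H3; eauto; now right.
  - intros z Hz Hz'. apply in_flat_map in Hz'. destruct Hz' as [y [Hy Hz']].
    apply N1. replace x with y; auto. apply (H3 y x z); simpl; auto.
Qed.

Lemma NoDup_pats B : NoDup (pats B).
Proof.
  induction B as [|B IH]; simpl.
  - constructor; [easy|constructor].
  - constructor.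
    + rewrite in_flat_map. intros [q [_ H]]. simpl in H. intuition discriminate.
    + apply NoDup_flat_map; auto.
      * intros p _. repeat (constructor; [simpl; intuition discriminate|]). constructor.
      * intros p q z _ _ H H'. simpl in H, H'.
        destruct H as [<-|[<-|[<-|[]]]], H' as [H'|[H'|[H'|[]]]]; congruence.
Qed.

Definition exts (B : nat) (w : word) : list word :=
  flat_map (fun u => map (Ext w u) (filter (fun p => (u + lefts p <=? width w)%nat) (pats B)))
    (seq 0 (S (ends w))).

(** Sorted by size: only the extensions of size exactly [S M] are added at stage [S M], so each word
    occurs once. *)
Fixpoint words (B M : nat) : list word :=
  match M with
  | O => []
  | S M => words B M ++ Root (S M) ::
      flat_map (fun w => filter (fun w' => (size w' =? S M)%nat) (exts B w)) (words B M)
  end.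

Lemma in_exts B w w' : In w' (exts B w) <-> exists u p, w' = Ext w u p /\ (u <= ends w)%nat /\
  (u + lefts p <= width w)%nat /\ (length p <= B)%nat.
Proof.
  unfold exts. rewrite in_flat_map. split.
  - intros [u [Hu H]]. apply in_map_iff in H. destruct H as [p [<- Hp]].
    apply filter_In in Hp. destruct Hp as [H1 H2]. apply in_pats in H1.
    apply Nat.leb_le in H2. apply in_seq in Hu. exists u, p. repeat split; auto; lia.
  - intros [u [p [-> [H1 [H2 H3]]]]]. exists u. split; [apply in_seq; lia|].
    apply in_map_iff. exists p. split; auto. apply filter_In. split; [now apply in_pats|].
    now apply Nat.leb_le.
Qed.

Lemma valid_width w : valid w -> (1 <= width w)%nat /\ (width w <= size w)%nat /\
  (ends w <= width w)%nat.
Proof.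
  induction w as [k|w IH u p]; simpl; [lia|].
  intros [V [H1 H2]]. specialize (IH V). unfold lefts, rights in *. lia.
Qed.

Lemma pattern_length p : (length p = nL p + nR p + nB p)%nat.
Proof. induction p as [|[] p IH]; simpl; lia. Qed.

(** A pattern in such a word has at most [M] tiles on either side, hence length at most [2 * M]. *)
Lemma in_words B M w : (2 * M <= B)%nat -> (In w (words B M) <-> valid w /\ (size w <= M)%nat).
Proof.
  revert w. induction M as [|M IH]; intros w HB.
  - simpl. split; [easy|]. intros [V H]. apply valid_width in V. lia.
  - simpl words. rewrite in_app_iff, IH by lia. simpl In. rewrite in_flat_map.
    split.
    + intros [[V H]|[<-|[w0 [H0 H]]]]; [split; auto; lia|simpl; lia|].
      apply IH in H0; [|lia]. apply filter_In in H. destruct H as [H1 H2].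
      apply Nat.eqb_eq in H2. apply in_exts in H1. destruct H1 as [u [p [-> H1]]].
      simpl in *. split; [tauto|lia].
    + intros [V H]. destruct (le_lt_dec (size w) M) as [|L]; [auto|]. right.
      destruct w as [k|w u p].
      * left. simpl in *. f_equal. lia.
      * right. simpl in V, H, L. destruct V as [V [V1 V2]].
        assert (VW := valid_width w V).
        exists w. split; [apply IH; [lia|]; split; auto; unfold rights in *; lia|].
        apply filter_In. split; [|apply Nat.eqb_eq; simpl; lia].
        apply in_exts. exists u, p. repeat split; auto.
        rewrite pattern_length. unfold lefts, rights in *. lia.
Qed.

Lemma NoDup_exts B w : NoDup (exts B w).
Proof.
  apply NoDup_flat_map.
  - apply seq_NoDup.
  - intros u _. apply FinFun.Injective_map_NoDup; [intros p q E; congruence|].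
    apply NoDup_filter, NoDup_pats.
  - intros u v z _ _ H H'. apply in_map_iff in H, H'. destruct H as [p [<- _]], H' as [q [E _]].
    congruence.
Qed.

Lemma words_size B M w : In w (words B M) -> (size w <= M)%nat.
Proof.
  induction M as [|M IH]; [easy|]. simpl words. rewrite in_app_iff. simpl In.
  rewrite in_flat_map. intros [H|[<-|[w0 [_ H]]]]; [apply IH in H; lia|simpl; lia|].
  apply filter_In in H. destruct H as [_ H]. apply Nat.eqb_eq in H. lia.
Qed.

Lemma NoDup_words B M : NoDup (words B M).
Proof.
  induction M as [|M IH]; simpl; [constructor|].
  apply NoDup_app_iff. split; auto. split.
  - constructor.
    + rewrite in_flat_map. intros [w [_ H]]. apply filter_In in H. destruct H as [H _].
      apply in_exts in H. destruct H as [u [p [H _]]]. discriminate.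
    + apply NoDup_flat_map; auto.
      * intros w _. apply NoDup_filter, NoDup_exts.
      * intros w w' z _ _ H H'. apply filter_In in H, H'. destruct H as [H _], H' as [H' _].
        apply in_exts in H, H'. destruct H as [u [p [-> _]]], H' as [u' [p' [H' _]]]. congruence.
  - intros w Hw H. apply words_size in Hw. destruct H as [<-|H]; [simpl in Hw; lia|].
    apply in_flat_map in H. destruct H as [w0 [_ H]]. apply filter_In in H.
    destruct H as [_ H]. apply Nat.eqb_eq in H. lia.
Qed.

Definition is_root (w : word) : bool := match w with Root _ => true | _ => false end.

(** Every word other than a root is in a unique way an extension of a shorter word. *)
Lemma sum_nonroot B M (f : word -> Z) :
  zs (fun w => if is_root w then 0 else f w) (words B M) =
  zs (fun w => zs (fun w' => if (size w' <=? M)%nat then f w' else 0) (exts B w)) (words B M).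
Proof.
  induction M as [|M IH]; auto.
  assert (EX : forall w w', In w' (exts B w) -> (size w < size w')%nat /\ is_root w' = false).
  { intros w w' H. apply in_exts in H. destruct H as [u [p [-> _]]].
    simpl. unfold rights. split; auto; lia. }
  simpl words. rewrite !zs_app. simpl zs. rewrite !zs_flat_map, IH.
  rewrite (zs_ext_in (fun w => zs (fun w' => if (size w' <=? S M)%nat then f w' else 0) (exts B w))
    (fun w => zs (fun w' => if (size w' <=? M)%nat then f w' else 0) (exts B w) +
       zs (fun w' => if (size w' =? S M)%nat then f w' else 0) (exts B w)) (words B M)).
  2:{ intros w _. rewrite <- zs_add. apply zs_ext_in. intros w' _.
      destruct (Nat.leb_spec (size w') (S M)), (Nat.leb_spec (size w') M),
        (Nat.eqb_spec (size w') (S M)); lia. }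
  rewrite zs_add.
  rewrite (zs_ext_in (fun x => zs (fun w => if is_root w then 0 else f w)
      (filter (fun w' => (size w' =? S M)%nat) (exts B x)))
    (fun w => zs (fun w' => if (size w' =? S M)%nat then f w' else 0) (exts B w))).
  2:{ intros w _. rewrite zs_filter. apply zs_ext_in. intros w' Hw'.
      destruct (EX w w' Hw') as [_ ->]. reflexivity. }
  rewrite (zs_zero _ (exts B (Root (S M)))).
  2:{ intros w' Hw'. destruct (EX _ w' Hw') as [H _]. simpl in H.
      destruct (Nat.leb_spec (size w') (S M)); auto; lia. }
  rewrite (zs_zero (fun x => zs (fun w => zs (fun w' => if (size w' <=? S M)%nat then f w' else 0)
     (exts B w)) (filter (fun w' => (size w' =? S M)%nat) (exts B x)))).
  - lia.
  - intros w _. apply zs_zero. intros w' Hw'. apply filter_In in Hw'. destruct Hw' as [_ Hs].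
    apply Nat.eqb_eq in Hs. apply zs_zero. intros w'' Hw''. destruct (EX w' w'' Hw'') as [H _].
    destruct (Nat.leb_spec (size w'') (S M)); auto; lia.
Qed.

(** * The recursion *)

Definition matches (m r s : nat) (w : word) : bool :=
  (size w =? m)%nat && (width w =? r + 1)%nat && (sing w =? s)%nat.

Definition word_list (m r s : nat) : list word := filter (matches m r s) (words (2 * m) m).

Definition count (m r s : nat) : nat := length (word_list m r s).

Lemma matches_spec m r s w : matches m r s w = true <->
  size w = m /\ width w = (r + 1)%nat /\ sing w = s.
Proof. unfold matches. rewrite !andb_true_iff, !Nat.eqb_eq. tauto. Qed.

Lemma in_word_list m r s w : In w (word_list m r s) <->
  valid w /\ size w = m /\ width w = (r + 1)%nat /\ sing w = s.
Proof.
  unfold word_list. rewrite filter_In, in_words, matches_spec by lia.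
  split; [tauto|]. intros [V [E1 [E2 E3]]]. repeat split; auto. lia.
Qed.

Lemma count_words m r s B M : (m <= M)%nat -> (2 * M <= B)%nat ->
  count m r s = length (filter (matches m r s) (words B M)).
Proof.
  intros H1 H2. apply Permutation_length, NoDup_Permutation.
  - apply NoDup_filter, NoDup_words.
  - apply NoDup_filter, NoDup_words.
  - intros w. rewrite in_word_list, filter_In, in_words, matches_spec by lia.
    split; [|tauto]. intros [V [E1 [E2 E3]]]. repeat split; auto. lia.
Qed.

(** The sum over the position [u] of the topmost block, when [c] more blocks are placed below it. *)
Lemma hockey X c e :
  zs (fun u => binZ (X - Z.of_nat u) (Z.of_nat c)) (seq 0 (S e)) =
  binZ (X + 1) (Z.of_nat (S c)) - binZ (X - Z.of_nat e) (Z.of_nat (S c)).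
Proof.
  assert (P : forall n, binZ (n + 1) (Z.of_nat (S c)) = binZ n (Z.of_nat c) + binZ n (Z.of_nat (S c))).
  { intros n. rewrite (binZ_pascal (n + 1)) by lia. f_equal; f_equal; lia. }
  induction e as [|e IH].
  - cbn [seq zs fold_right]. change (Z.of_nat 0) with 0. rewrite !Z.sub_0_r, P. lia.
  - rewrite seq_S, zs_app, IH. cbn [zs fold_right]. rewrite Nat.add_0_l.
    replace (X - Z.of_nat e) with (X - Z.of_nat (S e) + 1) by lia.
    rewrite (P (X - Z.of_nat (S e))). lia.
Qed.

(* A word [w] is to be completed to size [m], width [R] and [s] singular vertices by [c]
   pairwise nonadjacent blocks in front of [zl w] right tiles, with [za c w], [zb w], [zr c w]
   letters [EL], [EB], [ER] in total. There are [Yf c w] such completions. In [Mf c w]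
   of them, all blocks are below the last block of [w] and not adjacent to it. In the others,
   the topmost of the [c] blocks may be moved to [w]; they are counted by [Nf B (c - 1) w],
   where [B] bounds the length of the patterns considered. *)
Section Telescope.
Variables m s R : nat.

Definition zb (w : word) : Z := Z.of_nat s - Z.of_nat (sing w).
Definition zr (c : nat) (w : word) : Z := Z.of_nat m - Z.of_nat (size w) - zb w - Z.of_nat c.
Definition za (c : nat) (w : word) : Z := Z.of_nat (width w) + zr c w - Z.of_nat R.
Definition zl (w : word) : Z :=
  Z.of_nat m - Z.of_nat (size w) + Z.of_nat (width w) - Z.of_nat R.
Definition Yf (c : nat) (w : word) : Z :=
  binZ (Z.of_nat (width w) + 1 - zl w) (Z.of_nat c) * Q c (za c w) (zb w) (zr c w).
Definition Mf (c : nat) (w : word) : Z :=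
  binZ (Z.of_nat (width w) - Z.of_nat (ends w) - zl w) (Z.of_nat c) * Q c (za c w) (zb w) (zr c w).
Definition Nf (B c : nat) (w : word) : Z :=
  zs (fun u => zs (fun p => binZ (Z.of_nat (width w) - zl w - Z.of_nat u) (Z.of_nat c) *
    Q c (za (S c) w - zL p) (zb w - zB p) (zr (S c) w - zR p)) (pats B)) (seq 0 (S (ends w))).

Lemma za_zl c w : za c w + zb w + Z.of_nat c = zl w.
Proof. unfold za, zr, zl. lia. Qed.

(** The topmost of the [S c] blocks either starts at some [u <= ends w], and could be moved to the
    word, or all blocks are strictly below the last block of [w]. [hockey] sums over [u] and
    [sum_pats] over the pattern of the topmost block. *)
Lemma Y_split B c w : (2 * m + 1 <= B)%nat -> valid w -> (size w <= m)%nat ->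
  Yf (S c) w = Nf B c w + Mf (S c) w.
Proof.
  intros HB V Hm. destruct (valid_width w V) as [W1 [W2 W3]].
  assert (ZL := za_zl (S c) w). unfold Yf, Nf, Mf.
  rewrite (zs_ext_in _ (fun u => Q (S c) (za (S c) w) (zb w) (zr (S c) w) *
    binZ (Z.of_nat (width w) - zl w - Z.of_nat u) (Z.of_nat c))).
  - rewrite zs_scal, hockey.
    replace (Z.of_nat (width w) - zl w + 1) with (Z.of_nat (width w) + 1 - zl w) by lia.
    replace (Z.of_nat (width w) - zl w - Z.of_nat (ends w)) with
      (Z.of_nat (width w) - Z.of_nat (ends w) - zl w) by lia. ring.
  - intros u _. rewrite zs_scal.
    (* Either the blocks fit into the right side, and then the letters number at most [2 * m], or
       the binomial of the positions vanishes. *)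
    assert (D : (za (S c) w < 0 \/ zb w < 0 \/ zr (S c) w < 0 \/
       za (S c) w + zb w + zr (S c) w <= Z.of_nat B) \/
       Z.of_nat (width w) - zl w - Z.of_nat u < 0).
    { unfold zr in *. lia. }
    destruct D as [D|D].
    + rewrite sum_pats by exact D. ring.
    + rewrite binZ_out by lia. ring.
Qed.

(** Moving the topmost block into the word: after [Ext w u p], the other blocks have
    [width w - u - lefts p] tiles below the last block, of which they cover [zl w - lefts p], so the
    difference does not depend on [p]. *)
Lemma N_exts B c w : valid w -> zs (Mf c) (exts B w) = Nf B c w.
Proof.
  intros V. destruct (valid_width w V) as [W1 [W2 W3]].
  unfold exts, Nf. rewrite zs_flat_map. apply zs_ext_in. intros u Hu. apply in_seq in Hu.
  rewrite zs_map, zs_filter. apply zs_ext_in. intros p _.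
  destruct (Nat.leb_spec (u + lefts p) (width w)) as [L|L].
  - unfold Mf, za, zr, zb, zl, zL, zB, zR. simpl ends. simpl width. simpl size. simpl sing.
    f_equal; f_equal; unfold lefts, rights in *; lia.
  (* A pattern too long for the right side is absent from [exts], and its term in [Nf] vanishes. *)
  - symmetry.
    destruct (Z_lt_dec (za (S c) w - zL p) 0); [rewrite Q_neg by lia; ring|].
    destruct (Z_lt_dec (zb w - zB p) 0); [rewrite Q_neg by lia; ring|].
    rewrite binZ_out; [ring|]. right; right.
    assert (ZL := za_zl (S c) w). unfold zL, zB, lefts in *. lia.
Qed.

Lemma Mf_zero c w : (m < size w + c)%nat -> Mf c w = 0.
Proof.
  intros H. unfold Mf. destruct (Z_lt_dec (zb w) 0); [rewrite Q_neg by lia; ring|].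
  rewrite Q_neg; [ring|]. unfold zr. lia.
Qed.

(** A root has no tiles below its [ends], so no room for a further block. For no block at all the
    value may be nonzero: this is the exception made by the stacks. *)
Lemma Mf_root c k : Mf (S c) (Root k) = 0.
Proof.
  assert (ZL := za_zl (S c) (Root k)). unfold Mf.
  destruct (Z_lt_dec (zb (Root k)) 0); [rewrite Q_neg by lia; ring|].
  destruct (Z_lt_dec (za (S c) (Root k)) 0); [rewrite Q_neg by lia; ring|].
  rewrite binZ_out; [ring|]. left. simpl width in *. simpl ends. lia.
Qed.

Lemma N_nonroot B c : (2 * m <= B)%nat ->
  zs (Nf B c) (words B m) = zs (fun w => if is_root w then 0 else Mf c w) (words B m).
Proof.
  intros HB. rewrite sum_nonroot. apply zs_ext_in. intros w Hw.
  apply in_words in Hw; auto. rewrite <- N_exts by tauto. apply zs_ext_in. intros w' _.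
  destruct (Nat.leb_spec (size w') m) as [|L]; auto. apply Mf_zero. lia.
Qed.

(** [Y_split] writes [Yf c] as [Nf (c - 1)] plus [Mf c], and for positive [c] the sums of [Mf c] and
    of [Nf c] over all words agree, so consecutive terms cancel. *)
Lemma telescope B K : (2 * m + 1 <= B)%nat ->
  zs (fun c => (-1) ^ (Z.of_nat c + 1) * zs (Yf c) (words B m)) (seq 1 K) =
  zs (Nf B 0) (words B m) + (-1) ^ (Z.of_nat K + 1) * zs (Nf B K) (words B m).
Proof.
  intros HB. induction K as [|K IH].
  - simpl seq. simpl zs. change ((-1) ^ (Z.of_nat 0 + 1)) with (-1). lia.
  - rewrite seq_S, zs_app, IH. change (1 + K)%nat with (S K).
    change (zs ?f [S K]) with (f (S K) + 0). cbv beta. rewrite Z.add_0_r.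
    rewrite (zs_ext_in (Yf (S K)) (fun w => Nf B K w + Mf (S K) w)).
    2:{ intros w Hw. apply in_words in Hw; [|lia]. apply Y_split; tauto. }
    rewrite zs_add.
    replace (zs (Nf B (S K)) (words B m)) with (zs (Mf (S K)) (words B m)).
    + replace (Z.of_nat (S K) + 1) with (Z.of_nat K + 1 + 1) by lia.
      rewrite (Z.pow_add_r (-1) (Z.of_nat K + 1) 1) by lia. change ((-1) ^ 1) with (-1).
      generalize ((-1) ^ (Z.of_nat K + 1)). intros z. ring.
    + rewrite N_nonroot by lia. apply zs_ext_in. intros w _.
      destruct w as [k|w u p]; simpl is_root; cbv iota; auto. apply Mf_root.
Qed.

(** Each block has at least one new tile, so [m + 1] blocks are impossible and the last remainder
    vanishes. *)
Lemma alternating_sum B : (2 * m + 1 <= B)%nat ->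
  zs (fun c => (-1) ^ (Z.of_nat c + 1) * zs (Yf c) (words B m)) (seq 1 (m + 1)) =
  zs (fun w => if is_root w then 0 else Mf 0 w) (words B m).
Proof.
  intros HB. rewrite telescope by auto. rewrite !N_nonroot by lia.
  rewrite (zs_zero (fun w => if is_root w then 0 else Mf (m + 1) w)); [ring|].
  intros w _. destruct (is_root w); auto. apply Mf_zero. lia.
Qed.

Lemma Mf_0 w : valid w -> Mf 0 w =
  if (size w =? m)%nat && (width w =? R)%nat && (sing w =? s)%nat then 1 else 0.
Proof.
  intros V. destruct (valid_width w V) as [W1 [W2 W3]].
  unfold Mf, Q, zl, za, zr, zb.
  destruct (Nat.eqb_spec (size w) m), (Nat.eqb_spec (width w) R), (Nat.eqb_spec (sing w) s);
    simpl andb; cbv iota.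
  1:{ rewrite binZ_0 by lia.
      assert (E : forall x, x = 0 -> (x =? 0) = true) by (intros; now apply Z.eqb_eq).
      rewrite !E by lia. reflexivity. }
  all: match goal with |- context [if ?b then _ else _] => destruct b eqn:E0 end; [|ring];
    exfalso; rewrite !andb_true_iff, !Z.eqb_eq in E0; lia.
Qed.

(** These are the summation bounds of the recursion; the last one says that [c] nonadjacent blocks
    need at least [2 * c - 1] right tiles. *)
Lemma Yf_zero c w : (1 <= c)%nat -> (m <= size w)%nat \/ (s < sing w)%nat \/
  ((width w + 1) / 2 < c)%nat -> Yf c w = 0.
Proof.
  intros Hc H. assert (ZL := za_zl c w). unfold Yf.
  destruct (Z_lt_dec (zb w) 0); [rewrite Q_neg by lia; ring|].
  destruct (Z_lt_dec (za c w) 0); [rewrite Q_neg by lia; ring|].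
  destruct (Z_lt_dec (zr c w) 0); [rewrite Q_neg by lia; ring|].
  destruct H as [H|[H|H]]; [unfold zr in *; lia|unfold zb in *; lia|].
  rewrite binZ_out; [ring|]. right; right.
  assert (width w + 1 < 2 * c)%nat; [|lia].
  generalize (Nat.div_mod_eq (width w + 1) 2) (Nat.mod_upper_bound (width w + 1) 2). lia.
Qed.
End Telescope.

(** Every added block hides at least one right tile, so only roots have as many right tiles as
    tiles. *)
Lemma count_root k : (1 <= k)%nat -> count k (k - 1) 0 = 1%nat.
Proof.
  intros Hk. unfold count.
  enough (P : Permutation (word_list k (k - 1) 0) [Root k]) by now apply Permutation_length in P.
  apply NoDup_Permutation.
  - apply NoDup_filter, NoDup_words.
  - repeat constructor. easy.
  - intros w. rewrite in_word_list. simpl In. split.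
    + intros [V [H1 [H2 _]]]. left. destruct w as [j|w u p].
      * simpl in H1. now subst.
      * exfalso. simpl in V, H1, H2. destruct V as [V [V1 V2]].
        destruct (valid_width w V) as [W1 [W2 W3]]. unfold lefts, rights in *. lia.
    + intros [<-|[]]. simpl. lia.
Qed.

Lemma count_recursion m r s : (1 <= m)%nat -> ~ (r = (m - 1)%nat /\ s = 0%nat) ->
  Z.of_nat (count m r s) = rec_rhs count m r s.
Proof.
  intros Hm Hroot. set (B := (2 * m + 1)%nat). set (ws := words B m).
  assert (WV : forall w, In w ws -> valid w /\ (size w <= m)%nat).
  { intros w Hw. apply in_words in Hw; auto. unfold B. lia. }
  transitivity (zs (fun c => (-1) ^ (Z.of_nat c + 1) * zs (Yf m s (r + 1) c) ws) (seq 1 (m + 1))).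
  - unfold ws. rewrite alternating_sum by (unfold B; lia).
    rewrite (count_words m r s B m) by (unfold B; lia). rewrite zs_length. apply zs_ext_in.
    intros w Hw. destruct (WV w Hw) as [V _]. rewrite Mf_0 by auto. unfold matches.
    destruct w as [k|w u p]; simpl is_root; cbv iota; auto.
    simpl size. simpl width. simpl sing.
    destruct (Nat.eqb_spec k m), (Nat.eqb_spec k (r + 1)), (Nat.eqb_spec 0 s); simpl; auto.
    (* The alternating sum omits the roots; a root with the required parameters is exactly the
       excluded base case. *)
    exfalso. apply Hroot. lia.
  - unfold rec_rhs.
    (* The coefficient of [t mb rb sb]. The sum over the three parameters becomes a sum over words,
       each counted at its own size, width minus one and number of singular vertices. *)
    set (H := fun mb rb sb : nat => zs (fun c : nat =>
      (-1) ^ (Z.of_nat c + 1) *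
      binZ (Z.of_nat m - Z.of_nat mb - (Z.of_nat r - Z.of_nat rb) - 1) (Z.of_nat c - 1) *
      binZ (Z.of_nat rb + 2 - (Z.of_nat m - Z.of_nat mb - (Z.of_nat r - Z.of_nat rb))) (Z.of_nat c) *
      binZ (Z.of_nat m - Z.of_nat mb - (Z.of_nat r - Z.of_nat rb) - Z.of_nat c) (Z.of_nat s - Z.of_nat sb) *
      binZ (Z.of_nat m - Z.of_nat mb - Z.of_nat c - (Z.of_nat s - Z.of_nat sb) +
         (Z.of_nat m - Z.of_nat mb - (Z.of_nat r - Z.of_nat rb)) - 1)
        (Z.of_nat m - Z.of_nat mb - (Z.of_nat r - Z.of_nat rb) - 1)) (seq 1 ((rb + 2) / 2))).
    transitivity (zs (fun mb => zs (fun rb => zs (fun sb =>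
      zs (fun w => if matches mb rb sb w then H mb rb sb else 0) ws)
        (seq 0 (s + 1))) (seq 0 mb)) (seq 1 (m - 1))).
    2:{ symmetry. unfold zsum. apply zs_ext_in. intros mb Hmb. apply in_seq in Hmb.
        apply zs_ext_in. intros rb _. apply zs_ext_in. intros sb _.
        transitivity (Z.of_nat (count mb rb sb) * H mb rb sb).
        - unfold H. rewrite <- zs_scal. apply zs_ext_in. intros c _. cbv zeta. ring.
        - rewrite (count_words mb rb sb B m) by (unfold B; lia).
          rewrite zs_length, Z.mul_comm, <- zs_scal. apply zs_ext_in. intros w _.
          destruct (matches mb rb sb w); ring. }
    transitivity (zs (fun w => zs (fun mb => zs (fun rb => zs (fun sb =>
      if matches mb rb sb w then H mb rb sb else 0)
        (seq 0 (s + 1))) (seq 0 mb)) (seq 1 (m - 1))) ws).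
    2:{ rewrite zs_swap. apply zs_ext_in. intros mb _. rewrite zs_swap.
        apply zs_ext_in. intros rb _. now rewrite zs_swap. }
    transitivity (zs (fun w => zs (fun c => (-1) ^ (Z.of_nat c + 1) * Yf m s (r + 1) c w)
      (seq 1 (m + 1))) ws).
    { rewrite zs_swap. apply zs_ext_in. intros c _. now rewrite zs_scal. }
    apply zs_ext_in. intros w Hw. destruct (WV w Hw) as [V Hs].
    destruct (valid_width w V) as [W1 [W2 W3]].
    rewrite (zs_ext_in (fun mb => zs (fun rb => zs (fun sb =>
      if matches mb rb sb w then H mb rb sb else 0) (seq 0 (s + 1))) (seq 0 mb))
      (fun mb => if (size w =? mb)%nat then
         (if (sing w <=? s)%nat then H mb (width w - 1)%nat (sing w) else 0) else 0)).
    + rewrite zs_single.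
      destruct (Nat.leb_spec 1 (size w)) as [_|L]; [|lia].
      destruct (Nat.ltb_spec (size w) (1 + (m - 1))) as [L|L]; simpl andb; cbv iota.
      2:{ apply zs_zero. intros c Hc. apply in_seq in Hc. rewrite Yf_zero by lia. ring. }
      destruct (Nat.leb_spec (sing w) s) as [L'|L'].
      2:{ apply zs_zero. intros c Hc. apply in_seq in Hc. rewrite Yf_zero by lia. ring. }
      unfold H. replace (width w - 1 + 2)%nat with (width w + 1)%nat by lia.
      transitivity (zs (fun c => (-1) ^ (Z.of_nat c + 1) * Yf m s (r + 1) c w)
        (seq 1 ((width w + 1) / 2))).
      (* The telescoping used a range of [c] independent of the word; the terms beyond the bound of
         the recursion vanish. *)
      * apply zs_seq_extend.
        -- apply Nat.Div0.div_le_upper_bound. lia.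
        -- intros c Hc. rewrite Yf_zero by lia. ring.
      * apply zs_ext_in. intros c Hc. apply in_seq in Hc.
        destruct c as [|c]; [lia|]. unfold Yf, Q, multi, zl, za, zr, zb.
        (* Matches the position factor of [Yf] and the three factors of [multi] with the four
           binomials of the recursion, argument by argument. *)
        assert (E4 : forall a1 a2 a3 a4 a5 a6 a7 b1 b2 b3 b4 b5 b6 b7 x : Z,
          a1 = b1 -> a2 = b2 -> a3 = b3 -> a4 = b4 -> a5 = b5 -> a6 = b6 -> a7 = b7 -> forall b8 a8,
          a8 = b8 -> x * (binZ a3 a4 * (binZ a1 a2 * binZ a5 a6 * binZ a7 a8)) =
          x * binZ b1 b2 * binZ b3 b4 * binZ b5 b6 * binZ b7 b8) by (intros; subst; ring).
        apply E4; lia.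
    + intros mb Hmb. apply in_seq in Hmb.
      rewrite (zs_ext_in _ (fun rb => if (width w - 1 =? rb)%nat then
        (if (size w =? mb)%nat then (if (sing w <=? s)%nat then H mb rb (sing w) else 0) else 0) else 0)).
      * rewrite zs_single. destruct (Nat.eqb_spec (size w) mb) as [E|N].
        -- destruct (Nat.leb_spec 0 (width w - 1)), (Nat.ltb_spec (width w - 1) (0 + mb)); try lia.
           reflexivity.
        -- destruct ((0 <=? width w - 1)%nat && (width w - 1 <? 0 + mb)%nat); reflexivity.
      * intros rb _.
        rewrite (zs_ext_in _ (fun sb => if (sing w =? sb)%nat then
          (if (size w =? mb)%nat then (if (width w - 1 =? rb)%nat then H mb rb sb else 0) else 0) else 0)).
        -- rewrite zs_single.
           destruct (Nat.leb_spec 0 (sing w)), (Nat.ltb_spec (sing w) (0 + (s + 1))),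
             (Nat.leb_spec (sing w) s), (Nat.eqb_spec (width w - 1) rb), (Nat.eqb_spec (size w) mb);
             simpl; auto; lia.
        -- intros sb _. unfold matches.
           replace (width w =? rb + 1)%nat with (width w - 1 =? rb)%nat.
           ++ destruct (size w =? mb)%nat, (width w - 1 =? rb)%nat, (sing w =? sb)%nat; reflexivity.
           ++ destruct (Nat.eqb_spec (width w - 1) rb), (Nat.eqb_spec (width w) (rb + 1)); auto; lia.
Qed.
End Counting.

(** * The theorem *)

Lemma listing_unique {T : Type} (P : T -> Prop) l l' :
  NoDup l -> NoDup l' -> (forall x, In x l <-> P x) -> (forall x, In x l' <-> P x) ->
  length l = length l'.
Proof.
  intros H H' E E'. apply Permutation_length, NoDup_Permutation; auto.
  intros x. now rewrite E, E'.
Qed.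

(** The heaviness and the number of singular vertices agree with those of the word because two
    duplicate-free lists of the same set have the same length. *)
Lemma good_word m r s T : good m r s T ->
  exists w c, valid w /\ size w = m /\ width w = (r + 1)%nat /\ sing w = s /\ Real c w /\
    forall p, skeleton T p <-> skeleton (map c (seq 0 (size w))) p.
Proof.
  intros [HT0 [HL [HH HS]]]. assert (H := is_tiling_HT T HT0).
  set (t := fun i => nth i T dummy_rect) in *. set (D := seq 0 (length T)) in *.
  destruct (tiling_Real (length D) t D (Nat.le_refl _) H) as [w [E [P [SZ HR]]]].
  set (c := fun i => t (nth i E 0%nat)) in *.
  assert (LD : length D = m) by (unfold D; now rewrite length_seq).
  assert (LE : length E = size w) by (rewrite SZ; now apply Permutation_length).
  assert (ET : map t D = T) by apply map_nth_all.
  assert (EE : map (fun i => nth i E 0%nat) (seq 0 (size w)) = E)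
    by (rewrite <- LE; apply map_nth_all).
  assert (PT : Permutation (map c (seq 0 (size w))) T).
  { rewrite <- ET. unfold c. rewrite <- (map_map (fun i => nth i E 0%nat) t), EE.
    now apply Permutation_map. }
  assert (SK : forall p, skeleton T p <-> skeleton (map c (seq 0 (size w))) p).
  { intros p. unfold skeleton. split; intros [q [Hq Hp]]; exists q; split; auto;
      [apply (Permutation_in _ (Permutation_sym PT))|apply (Permutation_in _ PT)]; auto. }
  assert (V := Real_valid HR). destruct (valid_width w V) as [W1 _].
  destruct (Real_good HR) as [_ [_ [[l [L1 [L2 L3]]] [ps [P1 [P2 P3]]]]]].
  destruct (Real_inv HR) as [H' _].
  exists w, c. split; auto. split; [congruence|]. split; [|split; [|auto]].
  - destruct HH as [l' [L1' [L2' L3']]].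
    assert (Q : length l = length l').
    { apply (listing_unique (right_hit T)); auto. intros y. rewrite L3. unfold right_hit.
      split; intros [Hy [a [Ha Hs]]]; split; auto; exists a; split; auto; intros p Hp; apply SK; auto. }
    lia.
  - destruct HS as [ps' [P1' [P2' P3']]].
    assert (Q : length ps = length ps').
    { apply (listing_unique (singular T)); auto. intros p. rewrite P3. rewrite <- ET.
      rewrite singular_corners, singular_corners by auto.
      split; intros S al be; destruct (S al be) as [i [Hi Hc]].
      - exists (nth i E 0%nat). split; auto. apply in_seq in Hi.
        apply (Permutation_in _ P), nth_In. lia.
      - apply (Permutation_in _ (Permutation_sym P)) in Hi.
        destruct (In_nth E i 0%nat Hi) as [j [J1 J2]]. exists j.
        split; [apply in_seq; lia|]. unfold c. now rewrite J2. }
    lia.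
Qed.

Lemma count_correct m r s : rect_count m r s (count m r s).
Proof.
  (* One realization per word serves as representative of its class; [comb_equiv_word] keeps
     different words inequivalent and [Real_equiv] shows that all tilings are covered. *)
  destruct (choice (fun w T => valid w -> exists c, Real c w /\ T = map c (seq 0 (size w))))
    as [rho Hrho].
  { intros w. destruct (classic (valid w)) as [V|V]; [|now exists []].
    destruct (Real_exists w V) as [c HR]. exists (map c (seq 0 (size w))). eauto. }
  assert (WL := in_word_list m r s).
  exists (map rho (word_list m r s)). split; [apply length_map|]. split; [|split].
  - intros T HT. apply in_map_iff in HT. destruct HT as [w [<- Hw]]. apply WL in Hw.
    destruct Hw as [V [E1 [E2 E3]]]. destruct (Hrho w V) as [c [HR ->]].
    assert (G := Real_good HR). rewrite E2, E3 in G. rewrite E1 in G at 1.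
    now replace (r + 1 - 1)%nat with r in G by lia.
  - intros i j Hi Hj N HE. apply N. unfold count in *.
    apply (proj1 (NoDup_nth (word_list m r s) (Root 0))); auto.
    { apply NoDup_filter, NoDup_words. }
    rewrite (nth_indep _ _ (rho (Root 0))), map_nth in HE by now rewrite length_map.
    rewrite (nth_indep (map rho _) nil (rho (Root 0))), map_nth in HE by now rewrite length_map.
    assert (Ii := nth_In (word_list m r s) (Root 0) Hi). apply WL in Ii.
    assert (Ij := nth_In (word_list m r s) (Root 0) Hj). apply WL in Ij.
    destruct (Hrho _ (proj1 Ii)) as [c1 [R1 E1]]. destruct (Hrho _ (proj1 Ij)) as [c2 [R2 E2]].
    rewrite E1, E2 in HE. eapply comb_equiv_word; eauto.
  - intros T HT. destruct (good_word m r s T HT) as [w [c [V [E1 [E2 [E3 [HR SK]]]]]]].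
    exists (rho w). split; [apply in_map, WL; auto|].
    destruct (Hrho w V) as [c' [HR' ->]].
    apply (comb_equiv_same_skeleton _ _ _ SK). now apply Real_equiv.
Qed.

Theorem theorem2 :
  exists t : nat -> nat -> nat -> nat,
    (forall m r s, rect_count m r s (t m r s)) /\
    (forall k, (1 <= k)%nat -> t k (k - 1)%nat 0%nat = 1%nat) /\
    (forall m r s, (1 <= m)%nat -> ~ (r = (m - 1)%nat /\ s = 0%nat) ->
       Z.of_nat (t m r s) = rec_rhs t m r s).
Proof.
  exists count. split; [exact count_correct|]. split; [exact count_root|exact count_recursion].
Qed.
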